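(* Let $b\in\mathbb{R}\setminus\{0\}$, $h\ge0$ and $p\in[1,\infty)$. For a potential matrix $Q$ let $K_Q^\pm$ be the kernel of its transformation operator. Then the composition $Q\mapsto K_Q^\pm\mapsto\mathcal{F}[K_Q^\pm]$ continuously maps $L^p([0,1];\mathbb{C}^{2\times2})$ (off-diagonal potential matrices) into $C_0(\Pi_h;\mathbb{C}^{2\times2})$ and is a Lipschitz mapping on balls: for every $r>0$ there is a constant $C(B,p,r)$ such that $$\|\mathcal{F}[K_Q^\pm]-\mathcal{F}[K_{\widetilde Q}^\pm]\|_{C(\Pi_h)}\le e^{|b|h}\cdot C(B,p,r)\cdot\|Q-\widetilde Q\|_p,\qquad Q,\widetilde Q\in\mathbb{U}_{p,r}^{2\times2}.$$
   Context: Fix real numbers $b_1<0<b_2$ and $B=\operatorname{diag}(b_1,b_2)$. A potential matrix is $Q=\begin{pmatrix}0&Q_{12}\\Q_{21}&0\end{pmatrix}$ with entries in $L^1[0,1]$; $\|Q\|_p$ is its norm in $L^p([0,1];\mathbb{C}^{2\times 2})$, and $\mathbb{U}_{p,r}^{2\times2}$ is the set of potential matrices with $\|Q\|_p\le r$. Let $\Omega=\{(x,t):0\le t\le x\le1\}$; $X^0_{1,1}(\Omega)$ and $X^0_{\infty,1}(\Omega)$ are the closures of $C(\Omega)$ in the norms $\operatorname{ess\,sup}_{t}\int_t^1|f(x,t)|dx$ and $\operatorname{ess\,sup}_{x}\int_0^x|f(x,t)|dt$, respectively. For $f\in X^0_{\infty,1}(\Omega)$ and each $x\in[0,1]$ the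 trace $f(x,\cdot)\in L^1[0,x]$ is well defined by continuous extension from $C(\Omega)$. Let $e_{\pm}(\cdot,\lambda)$ be the solution of $-iB^{-1}y'+Q(x)y=\lambda y$ on $[0,1]$ with $e_\pm(0,\lambda)=\binom{1}{\pm1}$, and $e^0_\pm(x,\lambda)=\binom{e^{ib_1\lambda x}}{\pm e^{ib_2\lambda x}}$. It is known that there are (uniquely determined) $2\times2$ matrix kernels $K^\pm_Q$ with entries in $X^0_{1,1}(\Omega)\cap X^0_{\infty,1}(\Omega)$ such that $e_\pm(x,\lambda)=e^0_\pm(x,\lambda)+\int_0^xK_Q^\pm(x,t)e^0_\pm(t,\lambda)\,dt$ for all $x\in[0,1]$, $\lambda\in\mathbb{C}$. $\Pi_h=\{z\in\mathbb{C}:|\operatorname{Im}z|\le h\}$; $C(\Pi_h)$ carries the sup norm, and $C_0(\Pi_h)=\{\varphi\in C(\Pi_h):\lim_{t\to\pm\infty}\varphi(t+iy)=0\text{ uniformly in }y\in[-h,h]\}$. For $G\in X^0_{\infty,1}(\Omega)$ put $$\mathcal{F}[G](\lambda)=\sup_{x\in[0,1]}\left|\int_0^xG(x,t)e^{ib\lambda t}\,dt\right|,\quad\lambda\in\mathbb{C};$$ for matrix kernels $\mathcal{F}$ is applied entrywise. *)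

(* Defs.v *)
From HB Require Import structures.
From mathcomp Require Import all_boot all_order all_algebra.
From mathcomp Require Import complex.
From mathcomp Require Import all_classical all_reals all_analysis ess_sup_inf.

Set Implicit Arguments.
Unset Strict Implicit.
Unset Printing Implicit Defensive.

Import Order.TTheory GRing.Theory Num.Theory.
Import numFieldNormedType.Exports.

Local Open Scope classical_set_scope.
Local Open Scope ring_scope.

(** * Complex-valued analysis

    [R[i]] is the field of complex numbers.  Its topology is that of the
    regular module [R[i]^o]; measurability, integrals and derivatives with
    respect to a real variable are taken on real and imaginary parts. *)

Notation cmod := Normc.normc.

Section ComplexValued.
Context {R : realType}.

Definition cexp (z : R[i]) : R[i] :=
  Complex (expR (complex.Re z) * cos (complex.Im z))
          (expR (complex.Re z) * sin (complex.Im z)).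

Definition cmeasurable d (T : measurableType d) (D : set T) (f : T -> R[i]) :=
  measurable_fun D (fun x => complex.Re (f x)) /\
  measurable_fun D (fun x => complex.Im (f x)).

Definition cintegrable (D : set R) (f : R -> R[i]) : Prop :=
  lebesgue_measure.-integrable D (fun x => (complex.Re (f x))%:E) /\
  lebesgue_measure.-integrable D (fun x => (complex.Im (f x))%:E).

Definition cintegral (D : set R) (f : R -> R[i]) : R[i] :=
  Complex (\int[lebesgue_measure]_(x in D) complex.Re (f x))
          (\int[lebesgue_measure]_(x in D) complex.Im (f x)).

Definition is_cderive (f : R -> R[i]) (x : R) (l : R[i]) : Prop :=
  is_derive x (1 : R) (fun u => complex.Re (f u)) (complex.Re l) /\
  is_derive x (1 : R) (fun u => complex.Im (f u)) (complex.Im l).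

Definition abs_continuous (a b : R) (f : R -> R[i]) : Prop :=
  forall eps : R, 0 < eps -> exists2 delta : R, 0 < delta &
    forall (n : nat) (u v : 'I_n -> R),
      (forall k, a <= u k /\ u k <= v k /\ v k <= b) ->
      (forall k l, k != l -> v k <= u l \/ v l <= u k) ->
      \sum_(k < n) (v k - u k) < delta ->
      \sum_(k < n) cmod (f (v k) - f (u k)) < eps.

(** Maximal modulus of the entries; on off-diagonal matrices this is the
    spectral norm. *)
Definition mxmod (M : 'M[R[i]]_2) : R :=
  \big[Num.max/0]_(jk : 'I_2 * 'I_2) cmod (M jk.1 jk.2).

End ComplexValued.

(** * Potential matrices *)

Section Potentials.
Context {R : realType}.
Implicit Types (p r : R) (Q : R -> 'M[R[i]]_2).

(** Representatives of classes modulo almost everywhere equality on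
    [[0, 1]]; their values outside [[0, 1]] play no role. *)
Definition potential Q : Prop :=
  (forall (x : R) (j : 'I_2), x \in `[0, 1] -> Q x j j = 0) /\
  (forall j k : 'I_2, cintegrable `[0, 1] (fun x => Q x j k)).

Definition Lpnorm p Q : \bar R :=
  Lnorm lebesgue_measure p%:E
    ((fun x : R => (mxmod (Q x))%:E) \_ `[0, 1]).

Definition Lp_potential p Q : Prop :=
  potential Q /\ (Lpnorm p Q < +oo)%E.

Definition Uball p r Q : Prop :=
  potential Q /\ (Lpnorm p Q <= r%:E)%E.

End Potentials.

(** * Kernels on the triangle *)

Section Kernels.
Context {R : realType}.
Implicit Types (f g : R * R -> R[i]) (x : R).

Definition Omega : set (R * R) :=
  [set q | 0 <= q.2 /\ q.2 <= q.1 /\ q.1 <= 1].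

Definition C_Omega f : Prop :=
  {within Omega, continuous (f : R * R -> R[i]^o)}.

Definition norm_X1 f : \bar R :=
  ess_sup lebesgue_measure
    ((fun t : R => \int[lebesgue_measure]_(x in `[t, 1%R]) (cmod (f (x, t)))%:E)%E
       \_ `[0, 1]).

Definition norm_Xinf f : \bar R :=
  ess_sup lebesgue_measure
    ((fun x : R => \int[lebesgue_measure]_(t in `[0%R, x]) (cmod (f (x, t)))%:E)%E
       \_ `[0, 1]).

Definition X1_0 f : Prop :=
  cmeasurable Omega f /\
  forall eps : R, 0 < eps ->
    exists2 g, C_Omega g & (norm_X1 (fun q => (f q - g q)%R) < eps%:E)%E.

Definition Xinf_0 f : Prop :=
  cmeasurable Omega f /\
  forall eps : R, 0 < eps ->
    exists2 g, C_Omega g & (norm_Xinf (fun q => (f q - g q)%R) < eps%:E)%E.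

(** [g] is the value at [f] of the continuous extension to the closure of
    [C_Omega] of the restriction map [phi |-> phi (x, .)] into [L^1[0, x]]. *)
Definition is_trace f x (g : R -> R[i]) : Prop :=
  cintegrable `[0, x] g /\
  forall phi : nat -> R * R -> R[i],
    (forall n, C_Omega (phi n)) ->
    norm_Xinf (fun q => phi n q - f q) @[n --> \oo] --> 0%E ->
    (\int[lebesgue_measure]_(t in `[0%R, x]) (cmod (phi n (x, t) - g t)%R)%:E)%E
      @[n --> \oo] --> 0%E.

(** For [f] in [Xinf_0] and [x] in [[0, 1]] the trace exists and is unique up
    to a null set, so integrals of it do not depend on the choice. *)
Definition trace f x : R -> R[i] :=
  xget (fun=> 0) [set g | is_trace f x g].

End Kernels.

(** * Transformation operators *)

Section Transformation.
Context {R : realType}.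
Implicit Types (b h x : R) (s : bool) (lambda : R[i]).
Implicit Types (Q : R -> 'M[R[i]]_2) (K : R * R -> 'M[R[i]]_2).

Definition Bmx b1 b2 : 'M[R[i]]_2 :=
  diag_mx (\row_j (if j == ord0 then b1%:C%C else b2%:C%C)).

(** The sign of [e_+] is [s = false], that of [e_-] is [s = true]. *)
Definition e_solution b1 b2 s Q lambda (y : R -> 'cV[R[i]]_2) : Prop :=
  [/\ forall j, abs_continuous 0 1 (fun x => y x j ord0),
      {ae lebesgue_measure, forall x : R, x \in `]0, 1[ ->
         exists2 dy : 'cV[R[i]]_2,
           forall j, is_cderive (fun u => y u j ord0) x (dy j ord0) &
           (- 'i%C) *: (invmx (Bmx b1 b2) *m dy) + Q x *m y x
             = lambda *: y x}
    & y 0 = \col_j (if j == ord0 then 1 else (-1) ^+ s)].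

Definition e0 b1 b2 s lambda x : 'cV[R[i]]_2 :=
  \col_j (if j == ord0 then cexp ('i%C * b1%:C%C * lambda * x%:C%C)
          else (-1) ^+ s * cexp ('i%C * b2%:C%C * lambda * x%:C%C)).

Definition mxtrace_at K x (t : R) : 'M[R[i]]_2 :=
  \matrix_(j, k) trace (fun q => K q j k) x t.

Definition is_kernel b1 b2 s Q K : Prop :=
  (forall j k, X1_0 (fun q => K q j k) /\ Xinf_0 (fun q => K q j k)) /\
  forall lambda (e : R -> 'cV[R[i]]_2),
    e_solution b1 b2 s Q lambda e ->
    forall x, x \in `[0, 1] ->
      e x = e0 b1 b2 s lambda x
            + \col_j cintegral `[0, x]
                (fun t => (mxtrace_at K x t *m e0 b1 b2 s lambda t) j ord0).

Definition calF b (G : R * R -> R[i]) lambda : R[i] :=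
  real_complex R (sup [set cmod (cintegral `[0, x]
                 (fun t => trace G x t *
                           cexp ('i%C * b%:C%C * lambda * t%:C%C)))
              | x in `[0, 1]]).

Definition mxcalF b K lambda : 'M[R[i]]_2 :=
  \matrix_(j, k) calF b (fun q => K q j k) lambda.

Definition strip h : set R[i]^o := [set z | `|complex.Im z| <= h].

Definition C0_strip h (phi : R[i] -> R[i]) : Prop :=
  {within strip h, continuous (phi : R[i]^o -> R[i]^o)} /\
  forall eps : R, 0 < eps -> exists T : R, forall t y : R,
    T <= `|t| -> `|y| <= h -> cmod (phi (Complex t y)) < eps.

Definition mxC0_strip h (Phi : R[i] -> 'M[R[i]]_2) : Prop :=
  forall j k, C0_strip h (fun z => Phi z j k).

Definition norm_strip h (Phi : R[i] -> 'M[R[i]]_2) : \bar R :=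
  ereal_sup [set (mxmod (Phi z))%:E | z in strip h].

End Transformation.

(* Main.v *)
(* A kernel is tested only against the solutions at [lambda = - i k], [k] a
   natural number, where the exponentials are real.  For a real polynomial [p]
   put [E_j (x, tau) = \sum_k p_k e^{k tau} e_j (x, - i k)].  If
   [|p (e^u)| <= 1] on [[b1, b2]], variation of constants and a Gronwall
   argument over the [(x, tau)] with [[b1 x, b2 x] + tau] inside [[b1, b2]]
   (a family stable under the shifts that the variation of constants produces)
   bound [E] by a constant and the difference of the [E]'s of two potentials by
   [C |Q - Q'|_1].  By the kernel identity [E_j (x, 0) - e^0] is the integral of
   [p (e^u)] against the measure obtained by placing [K_{j1} (x, .)] on
   [[b1 x, 0]] and [K_{j2} (x, .)] on [[0, b2 x]].  As the functions [p (e^u)]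
   are uniformly dense, the total variation [\int_0^x |K - K'| (x, t) dt] is
   bounded by [C |Q - Q'|_1], uniformly in [x], which is the Lipschitz estimate.
   That [F[K]] lies in [C_0] only uses that [K] is a limit of continuous
   kernels in the norm of [X_{infty,1}]: these are almost constant in [t] on
   short intervals, where the exponential oscillates. *)
Require Import Defs.
From HB Require Import structures.
From mathcomp Require Import all_boot all_order all_algebra.
From mathcomp Require Import complex.
From mathcomp Require Import all_classical all_reals all_analysis.
From mathcomp Require Import ess_sup_inf measurable_realfun.
From mathcomp Require Import ring lra.
Set Implicit Arguments.
Unset Strict Implicit.
Unset Printing Implicit Defensive.
Import Order.TTheory GRing.Theory Num.Theory.
Import numFieldNormedType.Exports.
Local Open Scope classical_set_scope.
Local Open Scope ring_scope.


(** What is known of [K] is its membership in the closures of the continuous kernels and the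
    identity for solutions. No integral equation for [K] is at hand, so every estimate has to be
    read off the [e_j], and solutions have to be constructed before the identity says anything. A
    single solution at [lambda = - i k] may be as large as e^{k b2 x}, hence no bound uniform in k
    holds solution by solution. Combinations are controlled by the supremum of |p (e^u)|, and the
    shift tau lets the variation of constants act on a combination as a whole. The interval [b1, b2]
    is used twice: it contains all frequencies reached by the shifts, and since b1 < 0 < b2 it
    carries the two kernels of a row on opposite sides of 0, where they cannot cancel. With P and P'
    the weighted L^1 norms of the two potentials, the kernel distance is at most 8 e^{4P} e^{4P'}
    times the weighted L^1 norm of the difference: a factor 2 for each of two Gronwall arguments and
    a third for treating real and imaginary parts separately. This bound does not see b, h or the
    sign; e^{|b| h} enters when the kernels are paired with the exponential. *)

(** * Modulus, real part and imaginary part of complex numbers *)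

Section Modulus.
Context {R : realType}.
Implicit Types z w : R[i].

Lemma cmodE z : cmod z = Num.sqrt (complex.Re z ^+ 2 + complex.Im z ^+ 2).
Proof. by case: z. Qed.

Lemma cReD z w : complex.Re (z + w) = complex.Re z + complex.Re w.
Proof. by case: z w => ? ? [? ?]. Qed.
Lemma cImD z w : complex.Im (z + w) = complex.Im z + complex.Im w.
Proof. by case: z w => ? ? [? ?]. Qed.
Lemma cReN z : complex.Re (- z) = - complex.Re z.
Proof. by case: z. Qed.
Lemma cImN z : complex.Im (- z) = - complex.Im z.
Proof. by case: z. Qed.
Lemma cReM z w : complex.Re (z * w) =
  complex.Re z * complex.Re w - complex.Im z * complex.Im w.
Proof. by case: z w => ? ? [? ?]. Qed.
Lemma cImM z w : complex.Im (z * w) =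
  complex.Re z * complex.Im w + complex.Im z * complex.Re w.
Proof. by case: z w => ? ? [? ?]. Qed.

Definition ReImE := (cReD, cImD, cReN, cImN, cReM, cImM).

Lemma cmod_ge0 z : 0 <= cmod z.
Proof. by rewrite cmodE sqrtr_ge0. Qed.

Lemma normCE z : `|z| = (cmod z)%:C%C.
Proof. by case: z. Qed.

Lemma cmodD z w : cmod (z + w) <= cmod z + cmod w.
Proof. by have := ler_normD z w; rewrite !normCE -rmorphD lecR. Qed.

Lemma cmodM z w : cmod (z * w) = cmod z * cmod w.
Proof. exact: Normc.normcM. Qed.

Lemma cmodN z : cmod (- z) = cmod z.
Proof. by rewrite !cmodE !ReImE !sqrrN. Qed.

Lemma cmodB z w : cmod (z - w) <= cmod z + cmod w.
Proof. by rewrite -[cmod w]cmodN cmodD. Qed.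

Lemma cmodC (x : R) : cmod x%:C%C = `|x|.
Proof. by rewrite cmodE /= expr0n addr0 sqrtr_sqr. Qed.

Lemma cmod0 : cmod (0 : R[i]) = 0.
Proof. exact: Normc.normc0. Qed.

Lemma cmod1 : cmod (1 : R[i]) = 1.
Proof. exact: Normc.normc1. Qed.

Lemma cmod_i : cmod ('i%C : R[i]) = 1.
Proof. by rewrite cmodE /= expr0n expr1n add0r sqrtr1. Qed.

Lemma cmod_sq z : cmod z ^+ 2 = complex.Re z ^+ 2 + complex.Im z ^+ 2.
Proof. by rewrite cmodE sqr_sqrtr// addr_ge0// sqr_ge0. Qed.

Lemma Re_le_cmod z : `|complex.Re z| <= cmod z.
Proof.
rewrite -(ler_pXn2r (n := 2))// ?nnegrE ?cmod_ge0//.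
by rewrite cmod_sq real_normK ?num_real// lerDl sqr_ge0.
Qed.

Lemma Im_le_cmod z : `|complex.Im z| <= cmod z.
Proof.
rewrite -(ler_pXn2r (n := 2))// ?nnegrE ?cmod_ge0//.
by rewrite cmod_sq real_normK ?num_real// lerDr sqr_ge0.
Qed.

Lemma cmod_le_ReIm z : cmod z <= `|complex.Re z| + `|complex.Im z|.
Proof.
rewrite -(ler_pXn2r (n := 2))// ?nnegrE ?cmod_ge0 ?addr_ge0//.
rewrite cmod_sq sqrrD !real_normK ?num_real// lerD2r lerDl.
by rewrite mulrn_wge0// mulr_ge0.
Qed.

Lemma cmod_sum (I : Type) (r : seq I) (P : pred I) (F : I -> R[i]) :
  cmod (\sum_(i <- r | P i) F i) <= \sum_(i <- r | P i) cmod (F i).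
Proof.
elim/big_rec2: _ => [|i x y _ ih]; first by rewrite cmod0.
by rewrite (le_trans (cmodD _ _))// lerD2l.
Qed.

Lemma complex_ext z w :
  complex.Re z = complex.Re w -> complex.Im z = complex.Im w -> z = w.
Proof. by case: z w => ? ? [? ?] /= -> ->. Qed.

Lemma dist_cmod z w : `|cmod z - cmod w| <= cmod (z - w).
Proof.
by have := ler_dist_dist z w; rewrite !normCE -rmorphB lecR cmodC.
Qed.

End Modulus.

(** * Integrability of real functions *)

Section LebesgueIntegrable.
Context {R : realType}.
Local Notation mu := (@lebesgue_measure R).
Implicit Types (D E : set R) (f g : R -> R).

Lemma rint_meas D f : mu.-integrable D (fun x => (f x)%:E) ->
  measurable_fun D f.
Proof. by move=> /integrableP[/measurable_EFinP]. Qed.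

Lemma rint_le D f g : measurable D -> measurable_fun D f ->
  (forall x, D x -> `|f x| <= g x) ->
  mu.-integrable D (fun x => (g x)%:E) -> mu.-integrable D (fun x => (f x)%:E).
Proof.
move=> mD mf fg ig; apply: (@le_integrable _ _ _ mu D mD _ _ _ _ ig).
  exact/measurable_EFinP.
by move=> x Dx; rewrite /= lee_fin (le_trans (fg _ Dx))// ler_norm.
Qed.

Lemma rintD D f g : measurable D -> mu.-integrable D (fun x => (f x)%:E) ->
  mu.-integrable D (fun x => (g x)%:E) ->
  mu.-integrable D (fun x => (f x + g x)%:E).
Proof. by move=> mD fi gi; exact: (@integrableD _ _ _ mu D mD _ _ fi gi). Qed.

Lemma rintN D f : measurable D -> mu.-integrable D (fun x => (f x)%:E) ->
  mu.-integrable D (fun x => (- f x)%:E).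
Proof. by move=> mD fi; exact: (@integrableN _ _ _ mu D _ fi). Qed.

Lemma rintB D f g : measurable D -> mu.-integrable D (fun x => (f x)%:E) ->
  mu.-integrable D (fun x => (g x)%:E) ->
  mu.-integrable D (fun x => (f x - g x)%:E).
Proof. by move=> mD fi gi; exact/rintD/rintN. Qed.

Lemma rintZ D (c : R) f : measurable D -> mu.-integrable D (fun x => (f x)%:E) ->
  mu.-integrable D (fun x => (c * f x)%:E).
Proof. by move=> mD fi; exact: (@integrableZl _ _ _ mu D mD c _ fi). Qed.

Lemma rintS D E f : measurable D -> measurable E -> D `<=` E ->
  mu.-integrable E (fun x => (f x)%:E) -> mu.-integrable D (fun x => (f x)%:E).
Proof. by move=> mD mE DE fi; exact: (@integrableS _ _ _ mu E D _ mE mD DE fi). Qed.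

Lemma eq_rint D f g : measurable D -> {in D, f =1 g} ->
  mu.-integrable D (fun x => (f x)%:E) -> mu.-integrable D (fun x => (g x)%:E).
Proof.
move=> mD fg; apply: (@eq_integrable _ _ _ mu D mD) => x xD.
by rewrite fg.
Qed.

Lemma rint0 D : mu.-integrable D (fun=> (0 : R)%:E).
Proof. exact: (@integrable0 _ _ _ mu D). Qed.

Lemma rint_norm D f : measurable D -> mu.-integrable D (fun x => (f x)%:E) ->
  mu.-integrable D (fun x => `|f x|%:E).
Proof. by move=> mD fi; exact: (@integrable_abse _ _ _ mu D _ fi). Qed.

Lemma rint_sum D (I : Type) (r : seq I) (F : I -> R -> R) : measurable D ->
  (forall i, mu.-integrable D (fun x => (F i x)%:E)) ->
  mu.-integrable D (fun x => (\sum_(i <- r) F i x)%:E).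
Proof.
move=> mD Fi; elim: r => [|i r ih].
  by under eq_fun do rewrite big_nil; exact: rint0.
by under eq_fun do rewrite big_cons; exact: rintD.
Qed.

End LebesgueIntegrable.

(** * Integrals of complex-valued functions of a real variable *)

Section ComplexIntegral.
Context {R : realType}.
Local Notation mu := (@lebesgue_measure R).
Implicit Types (D E : set R) (f g : R -> R[i]) (c : R[i]).

Lemma cmeasurable_cmod D f : cmeasurable D f ->
  measurable_fun D (fun x => cmod (f x)).
Proof.
move=> [mr mi]; under eq_fun do rewrite cmodE.
apply: (@measurableT_comp _ _ _ _ _ _ (@Num.sqrt R)) => //.
  by apply: continuous_measurable_fun; exact: sqrt_continuous.
by apply: measurable_funD; apply: measurable_funX.
Qed.

Lemma cmeasurableD D f g : cmeasurable D f -> cmeasurable D g ->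
  cmeasurable D (fun x => f x + g x).
Proof.
move=> [fr fi] [gr gi]; split; under eq_fun do rewrite ReImE;
exact: measurable_funD.
Qed.

Lemma cmeasurableN D f : cmeasurable D f -> cmeasurable D (fun x => - f x).
Proof.
move=> [fr fi]; split; under eq_fun do rewrite ReImE;
exact: measurableT_comp.
Qed.

Lemma cmeasurableM D f g : cmeasurable D f -> cmeasurable D g ->
  cmeasurable D (fun x => f x * g x).
Proof.
move=> [fr fi] [gr gi]; split; under eq_fun do rewrite ReImE;
by [apply: measurable_funB; apply: measurable_funM |
    apply: measurable_funD; apply: measurable_funM].
Qed.

Lemma cmeasurable_cst D c : cmeasurable D (fun=> c).
Proof. by split; exact: measurable_cst. Qed.

Lemma cmeasurable_real D (f : R -> R) : measurable_fun D f ->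
  cmeasurable D (fun x => (f x)%:C%C).
Proof. by move=> mf; split => //; exact: measurable_cst. Qed.

Lemma cintegrable_meas D f : cintegrable D f -> cmeasurable D f.
Proof.
by move=> [/integrableP[/measurable_EFinP ? _] /integrableP[/measurable_EFinP ? _]].
Qed.

Lemma cintegrable_cmod D f : measurable D -> cintegrable D f ->
  mu.-integrable D (fun x => (cmod (f x))%:E).
Proof.
move=> mD cf; have /cmeasurable_cmod mf := cintegrable_meas cf; case: cf => fr fi.
apply: (rint_le (g := fun x => `|complex.Re (f x)| + `|complex.Im (f x)|)) => //.
- by move=> x _; rewrite ger0_norm ?cmod_ge0// cmod_le_ReIm.
- by apply: rintD => //; exact: rint_norm.
Qed.

Lemma cintegrable_dominated D f (h : R -> R) : measurable D ->
  cmeasurable D f -> mu.-integrable D (fun x => (h x)%:E) ->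
  (forall x, D x -> cmod (f x) <= h x) -> cintegrable D f.
Proof.
move=> mD [fr fi] ih fh; split; apply: (rint_le (g := h)) => // x Dx.
- by rewrite (le_trans (Re_le_cmod _))// fh.
- by rewrite (le_trans (Im_le_cmod _))// fh.
Qed.

Lemma cintegrableM_bounded D f g (M : R) : measurable D ->
  cintegrable D f -> cmeasurable D g -> (forall x, D x -> cmod (g x) <= M) ->
  cintegrable D (fun x => g x * f x).
Proof.
move=> mD cf mg gM.
apply: (@cintegrable_dominated _ _ (fun x => M * cmod (f x))) => //.
- exact: cmeasurableM (cintegrable_meas cf).
- exact/rintZ/cintegrable_cmod.
- by move=> x Dx; rewrite cmodM ler_wpM2r ?cmod_ge0 ?gM.
Qed.

Lemma cintegrableD D f g : measurable D -> cintegrable D f -> cintegrable D g ->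
  cintegrable D (fun x => f x + g x).
Proof.
by move=> mD [fr fi] [gr gi]; split; under eq_fun do rewrite ReImE; exact: rintD.
Qed.

Lemma cintegrableN D f : measurable D -> cintegrable D f ->
  cintegrable D (fun x => - f x).
Proof.
by move=> mD [fr fi]; split; under eq_fun do rewrite ReImE; exact: rintN.
Qed.

Lemma cintegrableB D f g : measurable D -> cintegrable D f -> cintegrable D g ->
  cintegrable D (fun x => f x - g x).
Proof. by move=> mD cf cg; apply: cintegrableD => //; exact: cintegrableN. Qed.

Lemma cintegrableZ D c f : measurable D -> cintegrable D f ->
  cintegrable D (fun x => c * f x).
Proof.
move=> mD cf; apply: (@cintegrableM_bounded _ _ _ (cmod c)) => //.
Qed.

Lemma cintegrableS D E f : measurable D -> measurable E -> D `<=` E ->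
  cintegrable E f -> cintegrable D f.
Proof. by move=> mD mE DE [fr fi]; split; exact: rintS DE _. Qed.

Lemma eq_cintegrable D f g : measurable D -> {in D, f =1 g} ->
  cintegrable D f -> cintegrable D g.
Proof.
by move=> mD fg [fr fi]; split; [move: fr|move: fi]; apply: eq_rint => // x xD;
  rewrite fg.
Qed.

Lemma cintegrable0 D : cintegrable D (fun=> 0).
Proof. by split; exact: rint0. Qed.

Lemma cintegrable_sum D (I : Type) (r : seq I) (F : I -> R -> R[i]) :
  measurable D -> (forall i, cintegrable D (F i)) ->
  cintegrable D (fun x => \sum_(i <- r) F i x).
Proof.
move=> mD cF; elim: r => [|i r ih].
  by under eq_fun do rewrite big_nil; exact: cintegrable0.
by under eq_fun do rewrite big_cons; exact: cintegrableD.
Qed.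

Lemma eq_cintegral D f g : {in D, f =1 g} -> cintegral D f = cintegral D g.
Proof.
by move=> fg; congr Complex; apply: eq_Rintegral => x xD; rewrite fg.
Qed.

Lemma cintegral0 D : cintegral D (fun=> 0 : R[i]) = 0.
Proof.
by apply: complex_ext => /=; rewrite /Rintegral integral0.
Qed.

Lemma cintegralD D f g : measurable D -> cintegrable D f -> cintegrable D g ->
  cintegral D (fun x => f x + g x) = cintegral D f + cintegral D g.
Proof.
move=> mD [fr fi] [gr gi]; apply: complex_ext; rewrite ReImE /= -RintegralD//;
by apply: eq_Rintegral => x _; rewrite ReImE.
Qed.

Lemma cintegralZ D c f : measurable D -> cintegrable D f ->
  cintegral D (fun x => c * f x) = c * cintegral D f.
Proof.
move=> mD [fr fi]; apply: complex_ext; rewrite ReImE /=.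
- rewrite -!RintegralZl// -RintegralB//; [|exact: rintZ|exact: rintZ].
  by apply: eq_Rintegral => x _; rewrite ReImE.
- rewrite -!RintegralZl// -RintegralD//; [|exact: rintZ|exact: rintZ].
  by apply: eq_Rintegral => x _; rewrite ReImE.
Qed.

Lemma cintegralB D f g : measurable D -> cintegrable D f -> cintegrable D g ->
  cintegral D (fun x => f x - g x) = cintegral D f - cintegral D g.
Proof.
move=> mD cf cg; rewrite cintegralD//; last exact: cintegrableN.
congr (_ + _); rewrite -mulN1r -cintegralZ//.
by apply: eq_cintegral => x _; rewrite mulN1r.
Qed.

Lemma cintegral_sum D (I : Type) (r : seq I) (F : I -> R -> R[i]) :
  measurable D -> (forall i, cintegrable D (F i)) ->
  cintegral D (fun x => \sum_(i <- r) F i x) = \sum_(i <- r) cintegral D (F i).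
Proof.
move=> mD cF; elim: r => [|i r ih].
  rewrite big_nil -[RHS](cintegral0 D); congr cintegral.
  by apply/funext => x; rewrite big_nil.
rewrite big_cons -ih -cintegralD//; last exact: cintegrable_sum.
by apply: eq_cintegral => x _; rewrite big_cons.
Qed.

(* Testing against the constant [w = cintegral D f] reduces the bound to the
   Cauchy-Schwarz inequality in the plane. *)
Lemma le_cmod_cintegral D f : measurable D -> cintegrable D f ->
  cmod (cintegral D f) <= \int[mu]_(x in D) cmod (f x).
Proof.
move=> mD cf; set w := cintegral D f.
have icf := cintegrable_cmod mD cf; case: (cf) => fr fi.
have wr : complex.Re w = \int[mu]_(x in D) complex.Re (f x) by [].
have wi : complex.Im w = \int[mu]_(x in D) complex.Im (f x) by [].
clearbody w; have [->|w0] := eqVneq (cmod w) 0.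
  by apply: Rintegral_ge0 => x _; exact: cmod_ge0.
have wp : 0 < cmod w by rewrite lt_def w0 cmod_ge0.
rewrite -(ler_pM2l wp) -expr2 cmod_sq -RintegralZl//.
rewrite !expr2 {2}wr {2}wi -!RintegralZl// -RintegralD//; [|exact: rintZ|exact: rintZ].
apply: le_Rintegral => //.
- by apply: rintD => //; exact: rintZ.
- exact: rintZ.
- move=> x _; apply: le_trans (ler_norm _) _.
  rewrite -(ler_pXn2r (n := 2))// ?nnegrE ?mulr_ge0 ?cmod_ge0//.
  rewrite exprMn !cmod_sq real_normK ?num_real//.
  set a := complex.Re w; set b := complex.Im w.
  set u := complex.Re _; set v := complex.Im _.
  rewrite -subr_ge0 (_ : _ - _ = (a * v - b * u) ^+ 2) ?sqr_ge0//; ring.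
Qed.

Lemma le_cmod_cintegral_bound D f (h : R -> R) : measurable D ->
  cintegrable D f -> mu.-integrable D (fun x => (h x)%:E) ->
  (forall x, D x -> cmod (f x) <= h x) ->
  cmod (cintegral D f) <= \int[mu]_(x in D) h x.
Proof.
move=> mD cf ih fh; apply: le_trans (le_cmod_cintegral mD cf) _.
by apply: le_Rintegral => //; exact: cintegrable_cmod.
Qed.

End ComplexIntegral.

(** * Integrals over intervals and the exponential weight of Gronwall's argument *)

Section IntervalIntegral.
Context {R : realType}.
Local Notation mu := (@lebesgue_measure R).
Implicit Types (f g q : R -> R) (x y z e : R).

Lemma sub_cc x y x' y' : x' <= x -> y <= y' -> `[x, y] `<=` `[x', y'].
Proof. by move=> xx yy; apply: subset_itv; rewrite bnd_simp. Qed.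

Lemma rint_cc f x y x' y' : x' <= x -> y <= y' ->
  mu.-integrable `[x', y'] (fun t => (f t)%:E) ->
  mu.-integrable `[x, y] (fun t => (f t)%:E).
Proof. by move=> xx yy; apply: rintS => //; exact: sub_cc. Qed.

Lemma Rintegral_split f x y z : x <= y -> y <= z ->
  mu.-integrable `[x, z] (fun t => (f t)%:E) ->
  \int[mu]_(t in `[x, z]) f t =
  \int[mu]_(t in `[x, y]) f t + \int[mu]_(t in `[y, z]) f t.
Proof.
move=> xy yz fi; apply/eqP; rewrite addrC -subr_eq; apply/eqP.
rewrite (Rintegral_itvB (x := y) fi) ?bnd_simp//.
rewrite Rintegral_itv_obnd_cbnd//; apply: rintS fi => //.
by apply: subset_itv; rewrite bnd_simp.
Qed.

Lemma le_Rintegral_cc f x y z : x <= y -> y <= z ->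
  (forall t, x <= t <= z -> 0 <= f t) ->
  mu.-integrable `[x, z] (fun t => (f t)%:E) ->
  \int[mu]_(t in `[x, y]) f t <= \int[mu]_(t in `[x, z]) f t.
Proof.
move=> xy yz f0 fi; rewrite (Rintegral_split xy yz fi) lerDl.
apply: Rintegral_ge0 => t; rewrite /= in_itv/= => /andP[yt tz].
by rewrite f0// tz (le_trans xy yt).
Qed.

Lemma rint_restrict (E : set R) f : measurable E ->
  mu.-integrable E (fun t => (f t)%:E) ->
  mu.-integrable setT (fun t => ((f \_ E) t)%:E).
Proof.
move=> mE fi; have := (@integrable_mkcond _ _ _ mu E _ mE).1 fi.
by apply: (@eq_integrable _ _ _ mu setT) => // t _ /=; rewrite !patchE; case: ifP.
Qed.

(** Absolute continuity of the integral, localized to [E] by extending [f] by zero. *)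
Lemma rint_small (E : set R) f e : measurable E ->
  mu.-integrable E (fun t => (f t)%:E) -> 0 < e ->
  exists2 d : R, 0 < d & forall A : set R, measurable A -> A `<=` E ->
    (mu A < d%:E)%E -> \int[mu]_(t in A) `|f t| < e.
Proof.
move=> mE fi e0; have fi' := rint_restrict mE fi.
have [d [d0 dP]] := integral_normr_continuous fi' e0.
exists d => // A mA AE /(dP _ mA); apply: le_lt_trans; rewrite le_eqVlt.
apply/orP; left; apply/eqP/eq_Rintegral => t /set_mem /AE Et.
by rewrite patchE mem_set.
Qed.

Lemma mu_cc x y : x <= y -> mu `[x, y] = (y - x)%:E.
Proof.
move=> xy; rewrite lebesgue_measure_itv/= lte_fin.
by case: ltgtP xy => // -> _; rewrite subrr.
Qed.

Lemma Rintegral_cst_cc (c x y : R) : x <= y ->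
  \int[mu]_(t in `[x, y]) c = c * (y - x).
Proof.
move=> xy; rewrite Rintegral_cst//; congr (_ * _).
exact: (congr1 fine (mu_cc xy)).
Qed.

Lemma rint_cst_cc (c x y : R) : mu.-integrable `[x, y] (fun=> c%:E).
Proof.
apply: (@continuous_compact_integrable _ (fun=> c)); first exact: segment_compact.
by move=> t; apply: cvg_cst.
Qed.

(* On a piece where [a] grows by little, [q e^{ka} <= 2 q e^{k a(y)}] with [y]
   the left end, and [q = a'] makes the bounds telescope. *)
Lemma exp_weight q k : 0 < k -> (forall t, 0 <= t <= 1 -> 0 <= q t) ->
  mu.-integrable `[0, 1] (fun t => (q t)%:E) ->
  let a x := \int[mu]_(t in `[0, x]) q t in
  forall x, 0 <= x <= 1 ->
    mu.-integrable `[0, x] (fun t => (q t * expR (k * a t))%:E) /\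
    \int[mu]_(t in `[0, x]) (q t * expR (k * a t)) <= 2 / k * expR (k * a x).
Proof.
move=> k0 q0 qi a.
have qi_ x y : 0 <= x -> y <= 1 -> mu.-integrable `[x, y] (fun t => (q t)%:E).
  by move=> x0 y1; apply: rint_cc qi.
have aS x y : 0 <= x -> x <= y -> y <= 1 ->
    a y = a x + \int[mu]_(t in `[x, y]) q t.
  by move=> x0 xy y1; rewrite /a (Rintegral_split x0 xy)//; exact: qi_.
have a_homo x y : 0 <= x -> x <= y -> y <= 1 -> a x <= a y.
  move=> x0 xy y1; rewrite (aS x y)// lerDl; apply: Rintegral_ge0 => t.
  rewrite /= in_itv/= => /andP[xt ty]; apply: q0.
  by rewrite (le_trans x0 xt) (le_trans ty y1).
(* Clamping the argument to [0, 1] extends [a] to a monotone function on the whole line, which gives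
   its measurability. *)
pose a' x := a (Num.max 0 (Num.min 1 x)).
have a'_homo : {homo a' : x y / x <= y}.
  move=> x y xy; apply: a_homo.
  - by rewrite le_max lexx.
  - by apply: le_max2 => //; apply: le_min2.
  - by rewrite ge_max ler01 ge_min lexx.
have a'E t : 0 <= t <= 1 -> a' t = a t.
  by move=> /andP[t0 t1]; rewrite /a' min_r// max_r.
have ma' : measurable_fun setT a' by exact: nondecreasing_measurable.
pose w t := expR (k * a t).
have w_homo x y : 0 <= x -> x <= y -> y <= 1 -> w x <= w y.
  by move=> x0 xy y1; rewrite /w ler_expR ler_pM2l// a_homo.
have mw : measurable_fun (`[0, 1] : set R) w.
  apply: (@eq_measurable_fun _ _ _ _ _ (fun t => expR (k * a' t))).
    by move=> t /set_mem; rewrite /= in_itv/= => /a'E ->.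
  apply: measurable_funTS; apply: measurableT_comp => //.
  by apply: measurable_funM.
have qwi x y : 0 <= x -> y <= 1 ->
    mu.-integrable `[x, y] (fun t => (q t * w t)%:E).
  move=> x0 y1; apply: (rint_cc (x' := 0) (y' := 1)) => //.
  apply: (rint_le (g := fun t => w 1 * q t)) => //.
  - by apply: measurable_funM => //; exact: rint_meas.
  - move=> t; rewrite /= in_itv/= => /andP[t0 t1].
    rewrite ger0_norm ?mulr_ge0 ?expR_ge0 ?q0 ?t0//.
    by rewrite [leRHS]mulrC; apply: ler_wpM2l; rewrite ?q0 ?t0 ?w_homo.
  - exact: rintZ.
(* Induction over steps of length [d]. The bound is strengthened to [w x - 1], which vanishes at 0
   and telescopes. Smallness is asked for measure below [2 * d] because a step of length exactly [d]
   has to meet a strict inequality. *)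
suff main n : forall d, 0 < d ->
  (forall A : set R, measurable A -> A `<=` `[0, 1] -> (mu A < (2 * d)%:E)%E ->
    \int[mu]_(t in A) `|q t| < ln 2 / k) ->
  forall x, 0 <= x <= 1 -> x <= n%:R * d ->
  \int[mu]_(t in `[0, x]) (q t * w t) <= 2 / k * (w x - 1).
  move=> x /andP[x0 x1]; split; first exact: qwi.
  have lk : 0 < ln 2 / k by apply: divr_gt0 => //; rewrite ln_gt0// ltr1n.
  have [d d0 dP] := rint_small (measurable_itv _) qi lk.
  have d20 : 0 < d / 2 by rewrite divr_gt0.
  have [n xn] : exists n : nat, x <= n%:R * (d / 2).
    exists (Num.truncn (x / (d / 2))).+1; rewrite -ler_pdivrMr//.
    exact/ltW/truncnS_gt.
  apply: (le_trans (main n _ d20 _ x _ xn)).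
  - by rewrite mulrC divfK.
  - by rewrite x0.
  - by rewrite ler_pM2l ?divr_gt0// gerBl.
move=> d d0 dP; elim: n => [|n ih] x /andP[x0 x1] xn.
  have -> : x = 0 by apply/eqP; rewrite eq_le x0 andbT; rewrite mul0r in xn.
  rewrite set_itv1 Rintegral_set1 /w /a set_itv1 Rintegral_set1 mulr0 expR0.
  by rewrite subrr mulr0.
pose y := Num.max 0 (x - d).
have y0 : 0 <= y by rewrite le_max lexx.
have yx : y <= x by rewrite ge_max x0 gerBl ltW.
have y1 : y <= 1 by exact: le_trans yx x1.
(* Truncation at 0 makes the last step shorter than [d] when x < d; the induction then lands on
   0. *)
have yn : y <= n%:R * d.
  rewrite ge_max mulr_ge0 ?(ltW d0)//= lerBlDr (le_trans xn)//.
  by rewrite -natr1 mulrDl mul1r.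
rewrite (Rintegral_split y0 yx); last exact: qwi.
have small : k * (a x - a y) < ln 2.
  rewrite (aS y x)// addrAC subrr add0r mulrC -ltr_pdivlMr//.
  have -> : \int[mu]_(t in `[y, x]) q t = \int[mu]_(t in `[y, x]) `|q t|.
    apply: eq_Rintegral => t /set_mem; rewrite /= in_itv/= => /andP[yt tx].
    by rewrite ger0_norm// q0// (le_trans y0 yt) (le_trans tx x1).
  apply: dP => //; first exact: sub_cc.
  rewrite mu_cc// lte_fin (@le_lt_trans _ _ d)//; last by rewrite ltr_pMl// ltr1n.
  by rewrite lerBlDr -lerBlDl le_max lexx orbT.
have wx2 : w x <= 2 * w y.
  rewrite /w -(@lnK R 2) ?posrE// -expRD ler_expR -lerBlDr -mulrBr.
  exact: ltW.
have step : \int[mu]_(t in `[y, x]) (q t * w t) <= w x * (a x - a y).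
  rewrite (aS y x)// addrAC subrr add0r -RintegralZl//; last exact: qi_.
  apply: le_Rintegral => //; [exact: qwi|by apply: rintZ => //; exact: qi_|].
  move=> t; rewrite /= in_itv/= => /andP[yt tx]; rewrite [leRHS]mulrC; apply: ler_wpM2l.
    by rewrite q0// (le_trans y0 yt) (le_trans tx x1).
  by rewrite w_homo// (le_trans y0 yt).
(* The inequality 1 + u <= e^u bounds the increment of [a] by that of the weight. *)
have convex : w y * (k * (a x - a y)) <= w x - w y.
  have -> : w x = w y * expR (k * (a x - a y)).
    by rewrite /w -expRD -mulrDr addrC subrK.
  rewrite -[X in _ <= _ - X]mulr1 -mulrBr ler_wpM2l ?expR_ge0//.
  by rewrite lerBrDl expR_ge1Dx.
have da : 0 <= a x - a y by rewrite subr_ge0 a_homo.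
apply: (le_trans (lerD (ih y _ yn) step)); first by rewrite y0.
rewrite -lerBrDl -mulrBr opprB addrA subrK.
apply: (le_trans (ler_wpM2r da wx2)).
rewrite (_ : 2 * w y * (a x - a y) = 2 / k * (w y * (k * (a x - a y)))).
  by apply: ler_wpM2l => //; rewrite divr_ge0// ltW.
move: (w y) (a x - a y) => u v.
by rewrite (mulrCA u) [RHS]mulrA divfK ?gt_eqF// mulrA.
Qed.

(** Gronwall's argument in abstract form: 2 al is the fixed point of M |-> al + M / 2, and as
    [w >= 1] the summand [al] can be absorbed into [al * w]. The a priori constant [M0] starts the
    iteration, and its contribution is halved at each round. *)
Lemma halving_bound (T : Type) (P : T -> Prop) (G w : T -> R) (M0 al : R) :
  0 <= al -> (forall s, P s -> G s <= M0 * w s) -> (forall s, P s -> 1 <= w s) ->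
  (forall M, 0 <= M -> (forall s, P s -> G s <= M * w s) ->
     forall s, P s -> G s <= al + M / 2 * w s) ->
  forall s, P s -> G s <= 2 * al * w s.
Proof.
move=> al0 G0 w1 step s Ps.
pose M1 := `|M0|.
have wge0 r : P r -> 0 <= w r by move=> /w1; apply: le_trans.
have iter n r : P r -> G r <= (2 * al + M1 * 2^-1 ^+ n) * w r.
  elim: n r => [|n ih] r Pr.
    rewrite expr0 mulr1 (le_trans (G0 _ Pr))// ler_wpM2r ?wge0//.
    by rewrite (le_trans (ler_norm _))// lerDr mulr_ge0.
  apply: le_trans (step _ _ ih _ Pr) _.
    by rewrite addr_ge0 ?mulr_ge0 ?exprn_ge0 ?invr_ge0 ?normr_ge0.
  have := w1 _ Pr; rewrite exprS; set u := w r; set v := M1 * _.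
  rewrite [M1 * _]mulrCA -/v; nra.
have lim : (fun n => (2 * al + M1 * 2^-1 ^+ n) * w s) @ \oo --> (2 * al + M1 * 0) * w s.
  apply: cvgM; last exact: cvg_cst.
  apply: cvgD; first exact: cvg_cst.
  apply: cvgM; first exact: cvg_cst.
  by apply: cvg_expr; rewrite ger0_norm// invf_lt1// ltr1n.
rewrite mulr0 addr0 in lim; rewrite -(cvg_lim _ lim)//.
apply: limr_ge; first by apply/cvg_ex; eexists; exact: lim.
by apply: nearW => n; exact: iter.
Qed.

End IntervalIntegral.

(** * Primitives of integrable functions and linear Volterra systems *)

Section Volterra.
Context {R : realType}.
Local Notation mu := (@lebesgue_measure R).
Implicit Types (f g : R -> R[i]) (x y z e : R).

Lemma cint_cc f x y x' y' : x' <= x -> y <= y' ->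
  cintegrable `[x', y'] f -> cintegrable `[x, y] f.
Proof. by move=> xx yy; apply: cintegrableS => //; exact: sub_cc. Qed.

Lemma cintegral_split f x y z : x <= y -> y <= z -> cintegrable `[x, z] f ->
  cintegral `[x, z] f = cintegral `[x, y] f + cintegral `[y, z] f.
Proof.
move=> xy yz [fr fi]; apply: complex_ext; rewrite ReImE /=;
exact: Rintegral_split.
Qed.

Lemma cintegralB_cc f x y z : x <= y -> y <= z -> cintegrable `[x, z] f ->
  cintegral `[x, z] f - cintegral `[x, y] f = cintegral `[y, z] f.
Proof. by move=> xy yz fi; rewrite (cintegral_split xy yz fi) addrAC subrr add0r. Qed.

Lemma cintegrable_restrict (E : set R) f : measurable E -> cintegrable E f ->
  cintegrable setT (fun t => if t \in E then f t else 0).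
Proof.
move=> mE [fr fi]; split.
- apply: eq_rint (rint_restrict mE fr) => // t _.
  by rewrite patchE; case: ifP.
- apply: eq_rint (rint_restrict mE fi) => // t _.
  by rewrite patchE; case: ifP.
Qed.

Lemma cmeasurable_primitive f : cintegrable `[0, 1] f ->
  cmeasurable (`[0, 1] : set R) (fun x => cintegral `[0, x] f).
Proof.
move=> [fr fi]; split; apply: subspace_continuous_measurable_fun => //=;
exact: parameterized_integral_continuous.
Qed.

Lemma cmod_primitive_bound f x : cintegrable `[0, 1] f -> 0 <= x <= 1 ->
  cmod (cintegral `[0, x] f) <= \int[mu]_(t in `[0, 1]) cmod (f t).
Proof.
move=> fi /andP[x0 x1]; have fi' := cint_cc (lexx 0) x1 fi.
apply: (le_trans (le_cmod_cintegral _ fi')) => //.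
apply: le_Rintegral_cc => //; first by move=> t _; exact: cmod_ge0.
exact: cintegrable_cmod.
Qed.

(** Open intervals are used because the intervals in the definition of absolute continuity may share
    end points. *)
Lemma trivIset_open_itv n (u v : 'I_n -> R) :
  (forall k l, k != l -> v k <= u l \/ v l <= u k) ->
  trivIset [set` index_enum 'I_n] (fun k => `]u k, v k[%classic).
Proof.
move=> uv k l _ _ [t [/=]]; rewrite !in_itv/= => /andP[ukt tvk] /andP[ult tvl].
apply/eqP/negPn/negP => /uv[h|h].
- by have := lt_trans (lt_le_trans tvk h) ult; rewrite ltxx.
- by have := lt_trans (lt_le_trans tvl h) ukt; rewrite ltxx.
Qed.

(** The increments add up to at most the integral of |f| over the union of the intervals, which is
    small by absolute continuity of the integral. *)
Lemma abs_continuous_primitive f (c : R[i]) : cintegrable `[0, 1] f ->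
  abs_continuous 0 1 (fun x => c + cintegral `[0, x] f).
Proof.
move=> fi e e0; have icf := cintegrable_cmod (measurable_itv _) fi.
have [d d0 dP] := rint_small (measurable_itv _) icf e0.
exists d => // n u v uv disj sumd.
pose F (k : 'I_n) := `]u k, v k[%classic.
have triv : trivIset [set` index_enum 'I_n] F by exact: trivIset_open_itv.
pose D := \big[setU/set0]_(k < n) F k.
have mD : measurable D.
  by apply: bigsetU_measurable => k _; exact: measurable_itv.
have DS : D `<=` `[0, 1].
  rewrite /D; elim/big_ind: _ => // [A B|k _].
    by rewrite subUset.
  have [uk [ukv vk]] := uv k.
  by apply: subset_itv; rewrite bnd_simp.
have mF k : measurable (F k) by exact: measurable_itv.
have muF k : mu (F k) = (v k - u k)%:E.
  have [_ [+ _]] := uv k; rewrite lebesgue_measure_itv/= lte_fin le_eqVlt.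
  by case: ltP => // _; rewrite orbF => /eqP ->; rewrite subrr.
have muD : (mu D < d%:E)%E.
  rewrite /D (@measure_bigsetU_ord _ _ _ mu n xpredT F mF).
    rewrite (eq_bigr (fun k => (v k - u k)%:E)); last by move=> k _; exact: muF.
    by rewrite sumEFin lte_fin.
  by apply: sub_trivIset triv => k _; rewrite /= mem_index_enum.
have := dP D mD DS muD; apply: le_lt_trans.
have icf' : mu.-integrable D (fun x => (cmod (f x))%:E) by exact: rintS icf.
rewrite (@eq_Rintegral _ _ _ mu D (fun t => cmod (f t))); last first.
  by move=> t _; rewrite ger0_norm ?cmod_ge0.
have -> : \int[mu]_(t in D) cmod (f t) =
    \sum_(k < n) \int[mu]_(t in F k) cmod (f t).
  rewrite /Rintegral (@ge0_integral_bigsetU _ _ _ mu _ F _ (index_enum 'I_n)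
    mF (index_enum_uniq _) triv).
  - rewrite sum_fine// => k _.
    apply: (@integrable_fin_num _ _ _ mu (F k) (mF k)).
    apply: rintS icf => //; have [uk [ukv vk]] := uv k.
    by apply: subset_itv; rewrite bnd_simp.
  - by apply/measurable_EFinP; exact: rint_meas icf'.
  - by move=> t _; rewrite lee_fin cmod_ge0.
apply: ler_sum => k _; have [uk [ukv vk]] := uv k.
rewrite opprD addrACA subrr add0r.
have v0 := le_trans uk ukv; have u1 := le_trans ukv vk.
rewrite (cintegralB_cc uk ukv); last exact: cint_cc fi.
apply: (le_trans (le_cmod_cintegral _ _)) => //; first exact: cint_cc fi.
rewrite -Rintegral_itv_obnd_cbnd; last first.
  by apply: rintS icf => //; apply: subset_itv; rewrite bnd_simp.
rewrite -Rintegral_itv_bndo_bndc//.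
by apply: rintS icf => //; apply: subset_itv; rewrite bnd_simp.
Qed.

(** Lebesgue's differentiation theorem for the two parts of [f]; x > 0 because the primitive starts
    at 0. *)
Lemma is_cderive_primitive f (c : R[i]) : cintegrable setT f ->
  {ae mu, forall x, 0 < x ->
     is_cderive (fun u => c + cintegral `[0, u] f) x (f x)}.
Proof.
move=> [fr fi].
have loc (g : R -> R) : mu.-integrable setT (fun t => (g t)%:E) ->
    locally_integrable setT g.
  move=> gi; have := integrable_locally measurableT gi.
  by rewrite patch_setT.
have ftc (g : R -> R) (r : R) : mu.-integrable setT (fun t => (g t)%:E) ->
    {ae mu, forall x, 0 < x ->
      is_derive x (1 : R) (fun u => r + \int[mu]_(t in `[0, u]) g t) (g x)}.
  move=> gi; have := @FTC1 _ g (BLeft 0) (fun y => rintS (measurable_itv _)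
    measurableT (@subsetT _ _) gi) (loc _ gi).
  apply: (@filterS _ _ (ae_filter_ringOfSetsType mu)) => x + x0 => /(_ _)[].
    by rewrite lte_fin.
  move=> dg eg; rewrite -[g x]add0r; apply: is_deriveD.
  by rewrite -eg derive1E; exact: derivableP.
have := ftc _ (complex.Re c) fr; have := ftc _ (complex.Im c) fi.
apply: (@filterS2 _ _ (ae_filter_ringOfSetsType mu)) => x hi hr x0; split.
- by under eq_fun do rewrite cReD; exact: hr.
- by under eq_fun do rewrite cImD; exact: hi.
Qed.

(** Adding the tail bound 2 C 2^{-n} to [u n] gives a nonincreasing sequence that is bounded below.
    This yields convergence and the upper bound; the lower one comes from the same argument for
    [- u]. *)
Lemma geometric_cvg (u : nat -> R) (C : R) :
  (forall n, `|u n.+1 - u n| <= C * 2^-1 ^+ n) ->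
  cvgn u /\ forall n, `|limn u - u n| <= 2 * C * 2^-1 ^+ n.
Proof.
have half (v : nat -> R) : (forall n, `|v n.+1 - v n| <= C * 2^-1 ^+ n) ->
    cvgn v /\ forall n, limn v <= v n + 2 * C * 2^-1 ^+ n.
  move=> vC; pose e n : R := 2 * C * 2^-1 ^+ n.
  have C0 : 0 <= C by have := vC 0%N; rewrite expr0 mulr1; exact: le_trans.
  have e0 : e @ \oo --> (0 : R).
    rewrite -(mulr0 (2 * C)); apply: cvgM; first exact: cvg_cst.
    by apply: cvg_expr; rewrite ger0_norm// invf_lt1// ltr1n.
  have eS n : e n = e n.+1 + C * 2^-1 ^+ n by rewrite /e exprS; lra.
  have eP n : 0 <= e n by rewrite !mulr_ge0// exprn_ge0// invr_ge0.
  pose w n := v n + e n.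
  have wni : nonincreasing_seq w.
    apply/nonincreasing_seqP => n; rewrite /w (eS n).
    by have := vC n; rewrite ler_norml => /andP[]; lra.
  have lb : has_lbound (range w).
    exists (v 0%N - e 0%N) => _ [n _ <-].
    suff : v 0%N - e 0%N + e n <= v n by have := eP n; rewrite /w; lra.
    elim: n => [|n ih]; first by rewrite subrK.
    by move: ih; rewrite (eS n); have := vC n; rewrite ler_norml => /andP[]; lra.
  have cw := nonincreasing_is_cvgn wni lb.
  have wE : v = (fun n => w n - e n) by apply/funext => n; rewrite /w addrK.
  have cv : v @ \oo --> limn w - 0 by rewrite wE; apply: cvgB.
  split; first by apply/cvg_ex; eexists; exact: cv.
  move=> n; rewrite (cvg_lim _ cv)// subr0.
  exact: nonincreasing_cvgn_ge.
move=> uC; have [cu hu] := half u uC.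
have [|_ hNu] := half (fun n => - u n).
  by move=> n; rewrite -opprD normrN uC.
split=> // n; rewrite ler_norml; apply/andP; split.
- by have := hNu n; rewrite limN//; lra.
- by have := hu n; lra.
Qed.

(** Picard iteration: in the norm weighted by [om], the integral operator contracts by 1/2, whatever
    the size of [A]. Boundedness and measurability pass to the limit. *)
Lemma volterra (A : 'I_2 -> 'I_2 -> R -> R[i]) (w : 'I_2 -> R[i]) :
  (forall j l, cintegrable `[0, 1] (A j l)) ->
  exists z : 'I_2 -> R -> R[i],
    [/\ forall j, cmeasurable (`[0, 1] : set R) (z j),
        exists M : R, forall j x, 0 <= x <= 1 -> cmod (z j x) <= M &
        forall j x, 0 <= x <= 1 -> z j x =
          w j + cintegral `[0, x] (fun t => \sum_l A j l t * z l t)].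
Proof.
move=> iA; pose q t := \sum_j \sum_l cmod (A j l t).
have q0 t : 0 <= q t.
  by apply: sumr_ge0 => j _; apply: sumr_ge0 => l _; exact: cmod_ge0.
have iq : mu.-integrable `[0, 1] (fun t => (q t)%:E).
  apply: rint_sum => // j; apply: rint_sum => // l; exact: cintegrable_cmod.
(* The rate 4 makes the constant 2 / k of [exp_weight] equal to 1/2. *)
pose a x := \int[mu]_(t in `[0, x]) q t; pose om x := expR (4 * a x).
have k4 : 0 < 4 :> R by [].
have omP x : 0 <= x <= 1 ->
    mu.-integrable `[0, x] (fun t => (q t * om t)%:E) /\
    \int[mu]_(t in `[0, x]) (q t * om t) <= 2^-1 * om x.
  move=> x01; have [iqo] := exp_weight k4 (fun t _ => q0 t) iq x01.
  by move=> h; split=> //; apply: le_trans h _; rewrite -/(om x); lra.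
have om1 x : 1 <= om x.
  by rewrite -expR0 ler_expR mulr_ge0//; apply: Rintegral_ge0 => t _.
have om_le x : 0 <= x <= 1 -> om x <= om 1.
  move=> /andP[x0 x1]; rewrite ler_expR ler_pM2l//.
  by apply: le_Rintegral_cc.
clearbody om.
pose good (u : 'I_2 -> R -> R[i]) :=
  (forall j, cmeasurable (`[0, 1] : set R) (u j)) /\
  exists M : R, forall j x, 0 <= x <= 1 -> cmod (u j x) <= M.
have igood u : good u -> forall j,
    cintegrable `[0, 1] (fun t => \sum_l A j l t * u l t).
  move=> [mu_ [M uM]] j; apply: cintegrable_sum => // l.
  apply: (eq_cintegrable (f := fun t => u l t * A j l t)) => //.
    by move=> t _; rewrite mulrC.
  apply: (@cintegrableM_bounded _ _ _ _ M) => // t.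
  by rewrite /= in_itv/= => /uM.
have contr u (M : R) : good u -> 0 <= M ->
    (forall l t, 0 <= t <= 1 -> cmod (u l t) <= M * om t) ->
    forall j x, 0 <= x <= 1 ->
      cmod (cintegral `[0, x] (fun t => \sum_l A j l t * u l t)) <= M / 2 * om x.
  move=> gu M0 uM j x x01; have [iqo le2] := omP x x01.
  have /andP[x0 x1] := x01.
  apply: (@le_trans _ _ (\int[mu]_(t in `[0, x]) (M * (q t * om t)))).
    apply: le_cmod_cintegral_bound => //.
    - exact: cint_cc (igood _ gu j).
    - exact: rintZ.
    - move=> t; rewrite /= in_itv/= => /andP[t0 tx].
      have t01 : 0 <= t <= 1 by rewrite t0 (le_trans tx).
      rewrite mulrCA; apply: (@le_trans _ _ (\sum_l cmod (A j l t) * (M * om t))).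
        apply: le_trans (cmod_sum _ _ _) _; apply: ler_sum => l _.
        by rewrite cmodM; apply: ler_wpM2l; [exact: cmod_ge0|exact: uM].
      rewrite -mulr_suml; apply: ler_wpM2r.
        by rewrite mulr_ge0// (le_trans _ (om1 t)).
      rewrite /q [leRHS](bigD1 j)//= lerDl; apply: sumr_ge0 => i _.
      by apply: sumr_ge0 => l _; exact: cmod_ge0.
  rewrite RintegralZl// -mulrA; exact: ler_wpM2l.
pose T (u : 'I_2 -> R -> R[i]) j x :=
  w j + cintegral `[0, x] (fun t => \sum_l A j l t * u l t).
pose zn n := iter n T (fun j _ => w j).
have Tgood u : good u -> good (T u).
  move=> gu; split=> [j|].
    apply: cmeasurableD; first exact: cmeasurable_cst.
    by apply: cmeasurable_primitive; exact: igood.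
  exists (\sum_j (cmod (w j) +
    \int[mu]_(t in `[0, 1]) cmod (\sum_l A j l t * u l t))) => j x x01.
  apply: le_trans (cmodD _ _) _; rewrite [leRHS](bigD1 j)//= -[leLHS]addr0.
  apply: lerD; first by rewrite lerD2l; exact/cmod_primitive_bound/x01/igood.
  apply: sumr_ge0 => i _; rewrite addr_ge0 ?cmod_ge0//.
  by apply: Rintegral_ge0 => t _; exact: cmod_ge0.
pose W := \sum_j cmod (w j).
have W0 : 0 <= W by apply: sumr_ge0 => j _; exact: cmod_ge0.
have wW j : cmod (w j) <= W.
  by rewrite /W (bigD1 j)//= lerDl; apply: sumr_ge0 => i _; exact: cmod_ge0.
clearbody W.
have zgood n : good (zn n).
  elim: n => [|n ih]; last exact: Tgood.
  by split=> [j|]; [exact: cmeasurable_cst|exists W => j x _; exact: wW].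
have goodB u v : good u -> good v -> good (fun j x => u j x - v j x).
  move=> [mu_ [M uM]] [mv [N vN]]; split=> [j|].
    by apply: cmeasurableD => //; exact: cmeasurableN.
  exists (M + N) => j x x01; apply: le_trans (cmodB _ _) _.
  by rewrite lerD ?uM ?vN.
have TB u v j x : good u -> good v -> 0 <= x <= 1 -> T u j x - T v j x =
    cintegral `[0, x] (fun t => \sum_l A j l t * (u l t - v l t)).
  move=> gu gv /andP[x0 x1].
  rewrite /T opprD addrACA subrr add0r -cintegralB//;
    [|exact: cint_cc (igood _ gu j)|exact: cint_cc (igood _ gv j)].
  apply: eq_cintegral => t _; rewrite -sumrB.
  by apply: eq_bigr => l _; rewrite mulrBr.
have step n j x : 0 <= x <= 1 ->
    cmod (zn n.+1 j x - zn n j x) <= W * 2^-1 ^+ n * om x.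
  elim: n j x => [|n ih] j x x01.
    rewrite /= /T addrAC subrr add0r expr0.
    apply: (le_trans (contr _ W (zgood 0%N) W0 _ j x x01)).
      by move=> l t _; rewrite (le_trans (wW l))// ler_peMr.
    rewrite mulr1; apply: ler_wpM2r; first exact: le_trans (om1 x).
    by rewrite ler_pdivrMr// ler_peMr// ler1n.
  rewrite [zn n.+2]/(T (zn n.+1)) [zn n.+1]/(T (zn n)) TB//.
  have := contr (fun l t => zn n.+1 l t - zn n l t) (W * 2^-1 ^+ n).
  rewrite exprSr mulrA; apply => //; first exact: goodB.
    by rewrite mulr_ge0// exprn_ge0// invr_ge0.
  exact: (zgood n.+1).
have [C C0 CE] : exists2 C, 0 <= C & C = W * om 1.
  by exists (W * om 1) => //; rewrite mulr_ge0// (le_trans _ (om1 1)).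
have stepC n j x : 0 <= x <= 1 ->
    cmod (zn n.+1 j x - zn n j x) <= C * 2^-1 ^+ n.
  move=> x01; apply: le_trans (step n j x x01) _; rewrite CE mulrAC.
  apply: ler_wpM2r; first by rewrite exprn_ge0 ?invr_ge0.
  by apply: ler_wpM2l => //; exact: om_le.
have cR j x : 0 <= x <= 1 -> cvgn (fun n => complex.Re (zn n j x)) /\
    forall n, `|limn (fun n => complex.Re (zn n j x)) - complex.Re (zn n j x)|
      <= 2 * C * 2^-1 ^+ n.
  move=> x01; apply: geometric_cvg => n.
  by rewrite -cReN -cReD (le_trans (Re_le_cmod _))// stepC.
have cI j x : 0 <= x <= 1 -> cvgn (fun n => complex.Im (zn n j x)) /\
    forall n, `|limn (fun n => complex.Im (zn n j x)) - complex.Im (zn n j x)|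
      <= 2 * C * 2^-1 ^+ n.
  move=> x01; apply: geometric_cvg => n.
  by rewrite -cImN -cImD (le_trans (Im_le_cmod _))// stepC.
pose z j x := Complex (limn (fun n => complex.Re (zn n j x)))
                      (limn (fun n => complex.Im (zn n j x))).
(* The tail bound 2 C 2^{-n} occurs once for each of the real and imaginary parts. *)
have zC n j x : 0 <= x <= 1 -> cmod (z j x - zn n j x) <= 4 * C * 2^-1 ^+ n.
  move=> x01; apply: le_trans (cmod_le_ReIm _) _; rewrite cReD cImD cReN cImN.
  have := (cR j x x01).2 n; have := (cI j x x01).2 n.
  by rewrite [complex.Re (z j x)]/= [complex.Im (z j x)]/=; lra.
have gz : good z.
  split=> [j|].
    split; [apply: (@measurable_fun_cvg _ _ _ _ (fun n x => complex.Re (zn n j x)))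
           |apply: (@measurable_fun_cvg _ _ _ _ (fun n x => complex.Im (zn n j x)))].
    - by move=> m; exact: ((zgood m).1 j).1.
    - by move=> x; rewrite /= in_itv/= => x01; exact: (cR j x x01).1.
    - by move=> m; exact: ((zgood m).1 j).2.
    - by move=> x; rewrite /= in_itv/= => x01; exact: (cI j x x01).1.
  exists (4 * C + W) => j x x01.
  rewrite -[z j x](subrK (w j)); apply: le_trans (cmodD _ _) _.
  by apply: lerD => //; have := zC 0%N j x x01; rewrite expr0 mulr1.
exists z; split; [exact: gz.1|exact: gz.2|].
move=> j x x01; apply/eqP; rewrite -subr_eq0; apply/eqP/Normc.eq0_normc.
apply/eqP; rewrite eq_le cmod_ge0 andbT.
pose K := (4 * C + 4 * C * om 1).
(* The residual is split at the iterate n + 1: both its distance to [z] and the image under [T] of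
   the distance of the iterate n are of order 2^{-n}. *)
have bound n : cmod (z j x - T z j x) <= K * 2^-1 ^+ n.
  have -> : z j x - T z j x = (z j x - zn n.+1 j x) + (T (zn n) j x - T z j x).
    by rewrite -[zn n.+1]/(T (zn n)) addrA subrK.
  have h0 : 0 <= 2^-1 ^+ n :> R by rewrite exprn_ge0// invr_ge0.
  have M0 : 0 <= 4 * C * 2^-1 ^+ n by rewrite mulr_ge0// mulr_ge0.
  apply: le_trans (cmodD _ _) _; rewrite /K mulrDl; apply: lerD.
    apply: le_trans (zC n.+1 j x x01) _; apply: ler_wpM2l; first exact: mulr_ge0.
    by rewrite exprS ler_piMl// invf_le1// ler1n.
  rewrite TB//; apply: (le_trans (contr _ _ _ M0 _ j x x01)).
  - exact: goodB.
  - move=> l t t01; rewrite -cmodN opprB; apply: le_trans (zC n l t t01) _.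
    exact: ler_peMr.
  - rewrite [leRHS]mulrAC; apply: ler_pM.
    + exact: divr_ge0.
    + exact: le_trans (om1 x).
    + by rewrite ler_pdivrMr// ler_peMr// ler1n.
    + exact: om_le.
have lim : (fun n => K * 2^-1 ^+ n) @ \oo --> (0 : R).
  rewrite -(mulr0 K); apply: cvgM; first exact: cvg_cst.
  by apply: cvg_expr; rewrite ger0_norm// invf_lt1// ltr1n.
have : cmod (z j x - T z j x) <= limn (fun n => K * 2^-1 ^+ n).
  apply: limr_ge; first by apply/cvg_ex; eexists; exact: lim.
  by apply: nearW; exact: bound.
by rewrite (cvg_lim _ lim).
Qed.

End Volterra.

(** * Solutions of the system at lambda = - i k *)

Section ExponentialSolutions.
Context {R : realType}.
Local Notation mu := (@lebesgue_measure R).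
Variables (b1 b2 : R).
Implicit Types (Q : R -> 'M[R[i]]_2) (s : bool) (j l : 'I_2).

Definition bcoef j : R := if j == ord0 then b1 else b2.

Definition init_coef s j : R[i] := if j == ord0 then 1 else (-1) ^+ s.

Definition lam (k : nat) : R[i] := - 'i%C * (k%:R)%:C%C.

Lemma cexpC (r : R) : cexp r%:C%C = (expR r)%:C%C.
Proof. by rewrite /cexp /= cos0 sin0 mulr1 mulr0. Qed.

Lemma e0_lam s k x j : e0 b1 b2 s (lam k) x j ord0 =
  init_coef s j * (expR (k%:R * (bcoef j * x)))%:C%C.
Proof.
have expE (b : R) : cexp ('i%C * b%:C%C * lam k * x%:C%C) =
    (expR (k%:R * (b * x)))%:C%C.
  rewrite -cexpC; congr cexp; apply: complex_ext; rewrite /lam !ReImE /=; ring.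
rewrite /e0 mxE /init_coef /bcoef; case: ifP => _; rewrite expE//.
by rewrite mul1r.
Qed.

(* The variation-of-constants form of the equation at [lambda = - i k]. *)
Definition duhamel s Q (k : nat) (y : 'I_2 -> R -> R[i]) : Prop :=
  [/\ forall j, cmeasurable (`[0, 1] : set R) (y j),
      exists M : R, forall j x, 0 <= x <= 1 -> cmod (y j x) <= M &
      forall j x, 0 <= x <= 1 -> y j x =
        init_coef s j * (expR (k%:R * (bcoef j * x)))%:C%C +
        cintegral `[0, x] (fun t => \sum_l
          - ('i%C * (bcoef j)%:C%C) * Q t j l *
            ((expR (k%:R * (bcoef j * (x - t))))%:C%C * y l t))].

Lemma expR_lip (c x y : R) : 0 <= x <= 1 -> 0 <= y <= 1 ->
  `|expR (c * x) - expR (c * y)| <= expR `|c| * `|c| * `|x - y|.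
Proof.
have key x' y' : 0 <= x' <= 1 -> 0 <= y' <= 1 ->
    expR (c * x') - expR (c * y') <= expR `|c| * `|c| * `|x' - y'|.
  move=> /andP[x0 x1] _.
  have h : expR (c * x') - expR (c * y') <= expR (c * x') * (c * x' - c * y').
    have := expR_ge1Dx (c * y' - c * x').
    rewrite -(ler_pM2l (expR_gt0 (c * x'))) -expRD.
    rewrite (_ : c * x' + (c * y' - c * x') = c * y'); last by ring.
    rewrite -[X in 1 + X]opprB; move: (c * x' - c * y') => D; lra.
  apply: le_trans h _; rewrite -mulrA; apply: (le_trans (ler_norm _)).
  rewrite normrM ger0_norm ?expR_ge0// -mulrBr normrM.
  apply: ler_wpM2r; first exact: mulr_ge0.
  rewrite ler_expR (le_trans (ler_norm _))// normrM (ger0_norm x0).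
  exact: ler_piMr.
move=> hx hy; rewrite ler_norml; apply/andP; split; last exact: key.
by rewrite lerNl opprB distrC; exact: key.
Qed.

(** The increment of a product is u(y) (f(y) - f(x)) + (u(y) - u(x)) f(x): absolute continuity
    controls the first term, the Lipschitz bound the second. *)
Lemma abs_continuousM (u : R -> R) (f : R -> R[i]) (L N M : R) :
  (forall x y, 0 <= x <= 1 -> 0 <= y <= 1 -> `|u x - u y| <= L * `|x - y|) ->
  (forall x, 0 <= x <= 1 -> `|u x| <= N) ->
  (forall x, 0 <= x <= 1 -> cmod (f x) <= M) ->
  abs_continuous 0 1 f -> abs_continuous 0 1 (fun x => (u x)%:C%C * f x).
Proof.
move=> uL uN fM acf e e0.
have N0 : 0 <= N by apply: le_trans (uN 0 _); rewrite ?lexx ?ler01.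
have M0 : 0 <= M by apply: le_trans (fM 0 _); rewrite ?cmod_ge0 ?lexx ?ler01.
have L0 : 0 <= L.
  have := uL 1 0; rewrite subr0 normr1 mulr1 => uL1.
  by apply: le_trans (uL1 _ _); rewrite ?lexx ?ler01.
(* The summands 1 keep the denominators positive when [N] or [L * M] vanishes. *)
have N10 : 0 < N + 1 by lra.
have eN0 : 0 < e / 2 / (N + 1) by rewrite !divr_gt0.
have [d d0 dP] := acf _ eN0.
have LM0 : 0 < L * M + 1 by rewrite ltr_wpDl// mulr_ge0.
exists (Num.min d (e / 2 / (L * M + 1))).
  by rewrite lt_min d0 !divr_gt0.
move=> n x y xy disj; rewrite lt_min => /andP[sd se].
have {}dP := dP n x y xy disj sd.
have bound k : cmod ((u (y k))%:C%C * f (y k) - (u (x k))%:C%C * f (x k)) <=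
    N * cmod (f (y k) - f (x k)) + L * M * (y k - x k).
  have [x0 [xky y1]] := xy k.
  have x01 : 0 <= x k <= 1 by rewrite x0 (le_trans xky).
  have y01 : 0 <= y k <= 1 by rewrite (le_trans x0 xky).
  have -> : (u (y k))%:C%C * f (y k) - (u (x k))%:C%C * f (x k) =
    (u (y k))%:C%C * (f (y k) - f (x k)) + (u (y k) - u (x k))%:C%C * f (x k).
    by rewrite rmorphB /=; ring.
  apply: le_trans (cmodD _ _) _; rewrite !cmodM !cmodC; apply: lerD.
    by apply: ler_wpM2r; [exact: cmod_ge0|exact: uN].
  rewrite mulrAC; apply: ler_pM => //; [exact: cmod_ge0| |exact: fM].
  by apply: le_trans (uL _ _ y01 x01) _; rewrite ger0_norm// subr_ge0.
apply: le_lt_trans (ler_sum _ (fun k _ => bound k)) _.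
rewrite big_split /= -!mulr_sumr [ltRHS](_ : e = e / 2 + e / 2); last by lra.
apply: ler_ltD.
  apply: (@le_trans _ _ (N * (e / 2 / (N + 1)))).
    by apply: ler_wpM2l => //; exact: ltW.
  rewrite mulrA ler_pdivrMr// mulrC ler_wpM2l//; lra.
apply: (@le_lt_trans _ _ (L * M * (e / 2 / (L * M + 1)))).
  by apply: ler_wpM2l; [exact: mulr_ge0|exact: ltW].
rewrite mulrA ltr_pdivrMr// mulrC ltr_pM2l ?divr_gt0//; lra.
Qed.

Lemma is_cderiveM_real (u : R -> R) (f : R -> R[i]) x (du : R) (df : R[i]) :
  is_derive x (1 : R) u du -> is_cderive f x df ->
  is_cderive (fun t => (u t)%:C%C * f t) x (du%:C%C * f x + (u x)%:C%C * df).
Proof.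
move=> hu [hr hi]; split.
- have -> : (fun t => complex.Re ((u t)%:C%C * f t)) = u * (fun t => complex.Re (f t)).
    by apply/funext => t; rewrite cReM /= mul0r subr0.
  apply: (is_derive_eq (is_deriveM hu hr)).
  by rewrite cReD !cReM /GRing.scale /=; ring.
- have -> : (fun t => complex.Im ((u t)%:C%C * f t)) = u * (fun t => complex.Im (f t)).
    by apply/funext => t; rewrite cImM /= mul0r addr0.
  apply: (is_derive_eq (is_deriveM hu hi)).
  by rewrite cImD !cImM /GRing.scale /=; ring.
Qed.

Lemma is_derive_expR_scale (c x : R) :
  is_derive x (1 : R) (fun t => expR (c * t)) (c * expR (c * x)).
Proof.
have h : is_derive x (1 : R) (fun t : R => c * t) c.
  apply: (is_derive_eq (is_deriveZ c (is_derive_id x 1))).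
  by rewrite /GRing.scale /= mulr1.
have := is_derive1_comp (is_derive_expR (c * x)) h.
by move=> /is_derive_eq; apply; rewrite mulrC.
Qed.

(** The substitution y_j = e^{k b_j x} z_j removes the diagonal part and leaves a Volterra system
    for z with coefficients - i b_j e^{k (b_l - b_j) t} Q_{jl}. The same [y] is shown to satisfy the
    integral form, used for estimates, and the differential form, which gives access to the kernel
    identity. *)
Lemma exp_solution_exists s Q k : b1 != 0 -> b2 != 0 -> potential Q ->
  exists y : 'I_2 -> R -> R[i], duhamel s Q k y /\
    e_solution b1 b2 s Q (lam k) (fun x => \col_j y j x).
Proof.
move=> b10 b20 [_ iQ].
pose ex c t := (expR (k%:R * c * t))%:C%C : R[i].
have exD c d t : ex c t * ex d t = ex (c + d) t.
  by rewrite /ex -rmorphM -expRD mulrDr mulrDl.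
have ex_meas c : cmeasurable (`[0, 1] : set R) (ex c).
  apply: cmeasurable_real; apply: measurable_funTS.
  by apply: measurableT_comp => //; exact: measurable_funM.
have ex_bound c t : 0 <= t <= 1 -> cmod (ex c t) <= expR `|k%:R * c|.
  move=> /andP[t0 t1]; rewrite cmodC ger0_norm ?expR_ge0// ler_expR.
  rewrite (le_trans (ler_norm _))// normrM (ger0_norm t0); exact: ler_piMr.
pose A j l t : R[i] :=
  - ('i%C * (bcoef j)%:C%C) * (ex (bcoef l - bcoef j) t * Q t j l).
have iA j l : cintegrable `[0, 1] (A j l).
  apply: cintegrableZ => //.
  apply: (@cintegrableM_bounded _ _ _ _ (expR `|k%:R * (bcoef l - bcoef j)|)) => //.
  by move=> t; rewrite /= in_itv/=; exact: ex_bound.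
have [z [mz [M zM] zE]] := @volterra R A (init_coef s) iA.
(* Extension by zero, since the differentiation theorem is applied to functions integrable on the
   whole line. *)
pose g j t := if t \in (`[0, 1]%classic : set R) then \sum_l A j l t * z l t else 0.
have ig01 j : cintegrable `[0, 1] (fun t => \sum_l A j l t * z l t).
  apply: cintegrable_sum => // l.
  apply: (eq_cintegrable (f := fun t => z l t * A j l t)) => //.
    by move=> t _; rewrite mulrC.
  by apply: (@cintegrableM_bounded _ _ _ _ M) => // t; rewrite /= in_itv/= => /zM.
have ig j : cintegrable setT (g j).
  by apply: cintegrable_restrict => //; exact: ig01.
have gE j t : 0 <= t <= 1 -> g j t = \sum_l A j l t * z l t.
  by move=> t01; rewrite /g mem_set//= in_itv.
pose zz j x := init_coef s j + cintegral `[0, x] (g j).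
have zzE j x : 0 <= x <= 1 -> zz j x = z j x.
  move=> /[dup] /andP[x0 x1] x01; rewrite zE//; congr (_ + _).
  apply: eq_cintegral => t /set_mem; rewrite /= in_itv/= => /andP[t0 tx].
  by rewrite gE// t0 (le_trans tx).
pose y j x := ex (bcoef j) x * zz j x.
exists y; split.
  split.
  - move=> j; apply: cmeasurableM => //; split.
    + apply: eq_measurable_fun (mz j).1 => t /set_mem.
      by rewrite /= in_itv/= => /zzE ->.
    + apply: eq_measurable_fun (mz j).2 => t /set_mem.
      by rewrite /= in_itv/= => /zzE ->.
  - exists (\sum_j expR `|k%:R * bcoef j| * M) => j x x01.
    have M0 : 0 <= M by apply: le_trans (zM j x x01); exact: cmod_ge0.
    rewrite [leRHS](bigD1 j)//= -[leLHS]addr0; apply: lerD; last first.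
      by apply: sumr_ge0 => i _; rewrite mulr_ge0// expR_ge0.
    rewrite /y cmodM; apply: ler_pM; rewrite ?cmod_ge0//; first exact: ex_bound.
    by rewrite zzE// zM.
  - move=> j x x01; rewrite /y {1}/zz mulrDr [_ * init_coef _ _]mulrC; congr (_ + _).
      by rewrite /ex mulrA.
    have /andP[x0 x1] := x01.
    rewrite -cintegralZ//; last exact: cintegrableS (ig j).
    apply: eq_cintegral => t /set_mem; rewrite /= in_itv/= => /andP[t0 tx].
    have t01 : 0 <= t <= 1 by rewrite t0 (le_trans tx).
    rewrite gE// mulr_sumr; apply: eq_bigr => l _.
    rewrite zzE// /A.
    have -> : (expR (k%:R * (bcoef j * (x - t))))%:C%C * (ex (bcoef l) t * z l t) =
      ex (bcoef j) x * ex (bcoef l - bcoef j) t * z l t.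
      rewrite mulrA; congr (_ * _); rewrite /ex -!rmorphM -!expRD.
      by congr (_ %:C%C); congr expR; ring.
    ring.
have eigx j : init_coef s j = zz j 0.
  rewrite /zz set_itv1 /cintegral !Rintegral_set1.
  by rewrite -[LHS]addr0; congr (_ + _); apply: complex_ext.
split.
- move=> j; rewrite (_ : (fun x => _) = (fun x => ex (bcoef j) x * zz j x)).
    2: by apply/funext => x; rewrite mxE.
  apply: (@abs_continuousM _ _ (expR `|k%:R * bcoef j| * `|k%:R * bcoef j|)
    (expR `|k%:R * bcoef j|) M).
  + by move=> x x' hx hx'; exact: expR_lip.
  + by move=> x hx; rewrite -cmodC; exact: ex_bound.
  + by move=> x hx; rewrite zzE// zM.
  + by apply: abs_continuous_primitive; exact: cintegrableS (ig j).
- have ae j := is_cderive_primitive (init_coef s j) (ig j).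
  have := ae ord0; have := ae ord_max.
  apply: (@filterS2 _ _ (ae_filter_ringOfSetsType mu)) => x h1 h0.
  rewrite in_itv/= => /andP[x0 x1].
  have x01 : 0 <= x <= 1 by rewrite !ltW.
  have hz j : is_cderive (zz j) x (g j x).
    have : j = ord0 \/ j = ord_max.
      by case: j => [[|[|//]] hj]; [left|right]; apply: val_inj.
    by case=> ->; [exact: h0|exact: h1].
  (* Solving the equation at lambda = - i k for B^{-1} y' gives k y - i Q y. *)
  pose v := (k%:R)%:C%C *: (\col_j y j x) - 'i%C *: (Q x *m \col_j y j x).
  exists (Bmx b1 b2 *m v).
    move=> j; rewrite (_ : (fun u => _) = (fun u => ex (bcoef j) u * zz j u)).
      2: by apply/funext => u; rewrite mxE.
    have := is_cderiveM_real (is_derive_expR_scale (k%:R * bcoef j) x) (hz j).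
    set D := (X in is_cderive _ _ X -> _).
    suff -> : (Bmx b1 b2 *m v) j ord0 = D by [].
    rewrite /D /Bmx mul_diag_mx !mxE gE// mulr_sumr.
    have -> : (if j == ord0 then b1%:C%C else b2%:C%C) = (bcoef j)%:C%C.
      by rewrite /bcoef; case: ifP.
    rewrite mulrBr !mulr_sumr -sumrN; congr (_ + _).
      by rewrite /y /ex !rmorphM /=; ring.
    apply: eq_bigr => l _; rewrite mxE /y zzE// /A.
    have -> : (expR (k%:R * bcoef j * x))%:C%C *
      (- ('i%C * (bcoef j)%:C%C) * (ex (bcoef l - bcoef j) x * Q x j l) * z l x) =
      - ('i%C * (bcoef j)%:C%C) * Q x j l * z l x *
      (ex (bcoef j) x * ex (bcoef l - bcoef j) x) by rewrite /ex; ring.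
    rewrite exD addrC subrK; ring.
  rewrite mulKmx; last first.
    rewrite unitmxE det_diag unitfE; apply/prodf_neq0 => j _.
    by rewrite mxE; case: ifP => _; rewrite eq_complex /= eqxx andbT.
  rewrite /v scalerBr !scalerA -/(lam k) mulNr -expr2 sqr_i.
  by rewrite opprK scale1r subrK.
- apply/colP => j; rewrite !mxE /y -eigx /ex mulr0 expR0 mul1r.
  by rewrite /init_coef.
Qed.

End ExponentialSolutions.

(** * Uniform bounds for polynomial combinations of the solutions *)

Section ExponentialSums.
Context {R : realType}.
Local Notation mu := (@lebesgue_measure R).
Variables (b1 b2 : R).
Hypotheses (hb1 : b1 < 0) (hb2 : 0 < b2).
Implicit Types (Q : R -> 'M[R[i]]_2) (s : bool) (j l : 'I_2) (p : {poly R}).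

Let b := bcoef b1 b2.

Definition expsum p (y : nat -> 'I_2 -> R -> R[i]) j (x tau : R) : R[i] :=
  \sum_(k < size p) (p`_k * expR (k%:R * tau))%:C%C * y k j x.

(* The shifted frequencies [tau] for which [[b1 x, b2 x] + tau] stays in
   [[b1, b2]]. *)
Definition admissible (x tau : R) :=
  [/\ 0 <= x <= 1, b1 <= b1 * x + tau & b2 * x + tau <= b2].

(** An integrable majorant for every row of B Q at once, so that one Gronwall weight serves both
    components. *)
Definition qpot Q (t : R) : R := (`|b1| + `|b2|) * \sum_j \sum_l cmod (Q t j l).

Definition pot1 Q : R := \int[mu]_(t in `[0, 1]) qpot Q t.

Lemma mulr_shuffle (T : comPzRingType) (c d e f g : T) :
  e * (c * d * (f * g)) = c * (d * (e * f * g)).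
Proof. ring. Qed.

Lemma bcoef_norm j : `|b j| <= `|b1| + `|b2|.
Proof. by rewrite /b /bcoef; case: ifP => _; rewrite (lerDl, lerDr). Qed.

Lemma bcoef_bounds j : b1 <= b j <= b2.
Proof.
have b12 : b1 <= b2 by rewrite ltW// (lt_trans hb1).
by rewrite /b /bcoef; case: ifP => _; rewrite lexx b12.
Qed.

Lemma qpot_ge0 Q t : 0 <= qpot Q t.
Proof.
rewrite mulr_ge0 ?addr_ge0//; apply: sumr_ge0 => j _; apply: sumr_ge0 => l _.
exact: cmod_ge0.
Qed.

Lemma qpot_integrable Q : potential Q ->
  mu.-integrable `[0, 1] (fun t => (qpot Q t)%:E).
Proof.
move=> [_ iQ]; apply: rintZ => //; apply: rint_sum => // j.
by apply: rint_sum => // l; exact: cintegrable_cmod.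
Qed.

Lemma pot1_ge Q x : potential Q -> 0 <= x <= 1 ->
  \int[mu]_(t in `[0, x]) qpot Q t <= pot1 Q.
Proof.
move=> pQ /andP[x0 x1]; apply: le_Rintegral_cc => //.
  by move=> t _; exact: qpot_ge0.
exact: qpot_integrable.
Qed.

Lemma potentialB Q Q' : potential Q -> potential Q' ->
  potential (fun x => Q x - Q' x).
Proof.
move=> [d iQ] [d' iQ']; split=> [x j x01|j l].
  by rewrite !mxE d// d'// subr0.
apply: (eq_cintegrable (f := fun x => Q x j l - Q' x j l)) => //.
  by move=> x _; rewrite !mxE.
exact: cintegrableB.
Qed.

(** As b1 <= b_j <= b2, the interval [b1 t, b2 t] + tau + b_j (x - t) is contained in [b1 x, b2 x] +
    tau. *)
Lemma admissible_shift x tau j t : admissible x tau -> 0 <= t <= x ->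
  admissible t (tau + b j * (x - t)).
Proof.
move=> [/andP[x0 x1] h1 h2] /andP[t0 tx]; have /andP[c1 c2] := bcoef_bounds j.
have xt : 0 <= x - t by rewrite subr_ge0.
have g1 := ler_wpM2r xt c1; have g2 := ler_wpM2r xt c2.
split; first by rewrite t0 (le_trans tx).
- apply: le_trans h1 _; rewrite [tau + _]addrC addrA lerD2r -lerBlDl -mulrBr.
  exact: g1.
- apply: le_trans h2; rewrite [tau + _]addrC addrA lerD2r -lerBrDl -mulrBr.
  exact: g2.
Qed.

Lemma admissible0 x : 0 <= x <= 1 -> admissible x 0.
Proof.
move=> /andP[x0 x1]; split; rewrite ?x0//.
- by rewrite addr0; rewrite -[leLHS]mulr1 ler_nM2l.
- by rewrite addr0; rewrite -[leRHS]mulr1 ler_pM2l.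
Qed.

(** A crude bound, depending on [p] and on all the solutions involved; it provides the finite a
    priori constant from which Gronwall's iteration starts. *)
Lemma expsum_bounded s Q p y :
  (forall k, duhamel b1 b2 s Q k (y k)) ->
  exists M : R, forall j x tau, 0 <= x <= 1 -> tau <= b2 - b1 ->
    cmod (expsum p y j x tau) <= M.
Proof.
move=> yD; rewrite /expsum; elim: (size p) => [|n [M MP]].
  by exists 0 => j x tau _ _; rewrite big_ord0 cmod0.
have [_ [N NP] _] := yD n.
exists (M + `|p`_n| * expR (n%:R * (b2 - b1)) * N) => j x tau x01 tb.
rewrite big_ord_recr/=; apply: le_trans (cmodD _ _) _.
apply: lerD; first exact: MP.
rewrite cmodM cmodC normrM (ger0_norm (expR_ge0 _)).
apply: ler_pM; [exact: mulr_ge0 (expR_ge0 _)|exact: cmod_ge0| |exact: NP].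
by apply: ler_wpM2l => //; rewrite ler_expR ler_wpM2l.
Qed.

Lemma duhamel_integrable s Q Q' k y x tau j l : potential Q ->
  duhamel b1 b2 s Q' k y -> 0 <= x <= 1 ->
  cintegrable `[0, x] (fun t =>
    Q t j l * ((expR (k%:R * (tau + b j * (x - t))))%:C%C * y l t)).
Proof.
move=> [_ iQ] [my [M yM] _] /andP[x0 x1].
apply: (cintegrableS (E := `[0, 1])) => //; first exact: sub_cc.
pose T := expR (k%:R * (`|tau| + (`|b1| + `|b2|) * 1)).
apply: (eq_cintegrable (f := fun t =>
    ((expR (k%:R * (tau + b j * (x - t))))%:C%C * y l t) * Q t j l)) => //.
  by move=> t _; rewrite mulrC.
apply: (@cintegrableM_bounded _ _ _ _ (T * M)) => //.
  apply: cmeasurableM => //; apply: cmeasurable_real; apply: measurable_funTS.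
  apply: measurableT_comp => //; apply: measurable_funM => //.
  apply: measurable_funD => //; apply: measurable_funM => //.
  exact: measurable_funB.
move=> t; rewrite /= in_itv/= => /[dup] t01 /andP[t0 t1].
rewrite cmodM; apply: ler_pM; rewrite ?cmod_ge0 ?yM//.
rewrite cmodC ger0_norm ?expR_ge0// ler_expR ler_wpM2l//; apply: lerD.
  exact: ler_norm.
apply: (le_trans (ler_norm _)); rewrite normrM; apply: ler_pM => //.
  exact: bcoef_norm.
by rewrite ler_norml; lra.
Qed.

Lemma expsum_shift_integrable s Q Q' p y x tau j l : potential Q ->
  (forall k, duhamel b1 b2 s Q' k (y k)) -> 0 <= x <= 1 ->
  cintegrable `[0, x] (fun t =>
    Q t j l * expsum p y l t (tau + b j * (x - t))).
Proof.
move=> pQ yD x01.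
apply: (eq_cintegrable (f := fun t => \sum_(k < size p) (p`_k)%:C%C *
  (Q t j l * ((expR (k%:R * (tau + b j * (x - t))))%:C%C * y k l t)))) => //.
  move=> t _; rewrite /expsum mulr_sumr; apply: eq_bigr => k _.
  by rewrite rmorphM /=; ring.
apply: cintegrable_sum => // k; apply: cintegrableZ => //.
exact: duhamel_integrable (yD k) _.
Qed.

(** Since e^{k tau} e^{k b_j (x - t)} = e^{k (tau + b_j (x - t))}, the propagator acts on the
    combination as a translation of tau, the same for all k. The free terms add up to a value of p
    (e^u). *)
Lemma expsum_duhamel s Q p y j x tau : potential Q ->
  (forall k, duhamel b1 b2 s Q k (y k)) -> 0 <= x <= 1 ->
  expsum p y j x tau =
    init_coef s j * (p.[expR (b j * x + tau)])%:C%C +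
    cintegral `[0, x] (fun t => \sum_l - ('i%C * (b j)%:C%C) *
      (Q t j l * expsum p y l t (tau + b j * (x - t)))).
Proof.
move=> pQ yD x01.
pose h k l t : R[i] := - ('i%C * (b j)%:C%C) * (Q t j l *
  ((expR (k%:R * (tau + b j * (x - t))))%:C%C * y k l t)).
have ih k l : cintegrable `[0, x] (h k l).
  by apply: cintegrableZ => //; exact: duhamel_integrable (yD k) _.
have expS k a c : (expR (k%:R * (a + c)))%:C%C =
    (expR (k%:R * a))%:C%C * (expR (k%:R * c))%:C%C :> R[i].
  by rewrite -rmorphM -expRD mulrDr.
have term (k : 'I_(size p)) : (p`_k * expR (k%:R * tau))%:C%C * y k j x =
    init_coef s j * (p`_k * expR (b j * x + tau) ^+ k)%:C%C +
    cintegral `[0, x] (fun t => (p`_k)%:C%C * \sum_l h k l t).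
  have [_ _ ->//] := yD k; rewrite mulrDr; congr (_ + _).
    have -> : expR (b j * x + tau) ^+ k =
        expR (k%:R * (b j * x)) * expR (k%:R * tau).
      by rewrite -expRM_natl mulrDr expRD.
    by rewrite !rmorphM /= -/b; ring.
  rewrite -cintegralZ//; last first.
    apply: cintegrable_sum => // l.
    have := duhamel_integrable 0 j l pQ (yD k) x01.
    move=> /(cintegrableZ (- ('i%C * (b j)%:C%C)) (measurable_itv _)).
    apply: eq_cintegrable => // t _; rewrite add0r mulrA; ring.
  apply: eq_cintegral => t _; rewrite rmorphM /= -mulrA; congr (_ * _).
  rewrite mulr_sumr.
  apply: eq_bigr => l _.
  rewrite /h (expS k tau (b j * (x - t))).
  exact: mulr_shuffle.
rewrite {1}/expsum (eq_bigr _ (fun k _ => term k)) big_split /=; congr (_ + _).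
  rewrite -mulr_sumr; congr (_ * _).
  by rewrite horner_coef rmorph_sum.
rewrite -cintegral_sum//; last first.
  by move=> k; apply: cintegrableZ => //; apply: cintegrable_sum.
apply: eq_cintegral => t _.
transitivity (\sum_(k < size p) \sum_l (p`_k)%:C%C * h k l t).
  by apply: eq_bigr => k _; rewrite mulr_sumr.
rewrite exchange_big /=; apply: eq_bigr => l _.
rewrite /expsum !mulr_sumr; apply: eq_bigr => k _.
rewrite /h rmorphM /= mulrCA; congr (_ * _).
by rewrite mulrCA; congr (_ * _); rewrite mulrA.
Qed.

(** The integral equation relates different shifts, so the inequality closes only for majorants [H]
    that depend on [t] alone and hold for all components and all admissible shifts. The weight
    e^{4a} halves such a majorant, and [halving_bound] concludes. *)
Lemma gronwall_admissible (E : 'I_2 -> R -> R -> R) (q : R -> R) (al M0 : R) :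
  0 <= al -> (forall t, 0 <= q t) -> mu.-integrable `[0, 1] (fun t => (q t)%:E) ->
  (forall j x tau, admissible x tau -> E j x tau <= M0) ->
  (forall j x tau, admissible x tau -> 0 <= E j x tau) ->
  (forall H : R -> R,
    (forall x, 0 <= x <= 1 -> mu.-integrable `[0, x] (fun t => (q t * H t)%:E)) ->
    (forall t, 0 <= t <= 1 -> 0 <= H t) ->
    (forall l t tau, admissible t tau -> E l t tau <= H t) ->
    forall j x tau, admissible x tau ->
      E j x tau <= al + \int[mu]_(t in `[0, x]) (q t * H t)) ->
  forall j x tau, admissible x tau ->
    E j x tau <= 2 * al * expR (4 * \int[mu]_(t in `[0, 1]) q t).
Proof.
move=> al0 q0 iq EM E0 step.
pose a x := \int[mu]_(t in `[0, x]) q t; pose om x := expR (4 * a x).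
have k4 : 0 < 4 :> R by [].
have omP := exp_weight k4 (fun t _ => q0 t) iq; rewrite /= in omP.
have om1 x : 1 <= om x.
  by rewrite -expR0 ler_expR mulr_ge0//; apply: Rintegral_ge0 => t _.
have M00 : 0 <= M0.
  have h : admissible 0 0 by apply: admissible0; rewrite lexx ler01.
  exact: le_trans (E0 ord0 _ _ h) (EM ord0 _ _ h).
have key := @halving_bound R ('I_2 * R * R)%type (fun r => admissible r.1.2 r.2)
  (fun r => E r.1.1 r.1.2 r.2) (fun r => om r.1.2) M0 al al0.
move=> j x tau hx; apply: (@le_trans _ _ (2 * al * om x)).
  apply: (key _ _ _ (j, x, tau)) => //.
  - move=> [[j' x'] tau'] /= h; apply: le_trans (EM _ _ _ h) _.
    exact: ler_peMr.
  - move=> M MM0 EMM [[j' x'] tau'] /= h.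
    have x'01 : 0 <= x' <= 1 by case: h.
    apply: (le_trans (step (fun t => M * om t) _ _ _ j' x' tau' h)).
    + move=> r r01; have [io _] := omP r r01.
      have := rintZ M (measurable_itv _) io.
      by apply: eq_rint => // t _; rewrite mulrCA.
    + by move=> t _; rewrite mulr_ge0// (le_trans _ (om1 t)).
    + by move=> l t tau'' h'; exact: (EMM (l, t, tau'')).
    + rewrite lerD2l; have [io le2] := omP x' x'01.
      rewrite (@eq_Rintegral _ _ _ mu _ (fun t => M * (q t * om t))); last first.
        by move=> t _; rewrite mulrCA.
      rewrite RintegralZl// -mulrA; apply: ler_wpM2l => //.
      by apply: le_trans le2 _; rewrite -/(a x') -/(om x'); lra.
apply: ler_wpM2l; first exact: mulr_ge0.
rewrite ler_expR ler_pM2l//; case: hx => /andP[x0 x1] _ _.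
exact: le_Rintegral_cc.
Qed.

Lemma qpot_bound Q (j : 'I_2) t (F : 'I_2 -> R[i]) (H : R) : 0 <= H ->
  (forall l, cmod (F l) <= H) ->
  cmod (\sum_l - ('i%C * (b j)%:C%C) * (Q t j l * F l)) <= qpot Q t * H.
Proof.
move=> H0 FH; apply: le_trans (cmod_sum _ _ _) _.
apply: (@le_trans _ _ (\sum_l (`|b1| + `|b2|) * cmod (Q t j l) * H)).
  apply: ler_sum => l _; rewrite !cmodM cmodN cmodM cmodC cmod_i mul1r mulrA.
  apply: ler_pM; rewrite ?mulr_ge0 ?cmod_ge0//.
  by apply: ler_wpM2r; [exact: cmod_ge0|exact: bcoef_norm].
rewrite -mulr_suml -mulr_sumr; apply: ler_wpM2r => //; apply: ler_wpM2l.
  by rewrite addr_ge0.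
rewrite [leRHS](bigD1 j)//= lerDl; apply: sumr_ge0 => i _.
by apply: sumr_ge0 => l _; exact: cmod_ge0.
Qed.

Lemma tau_bound x tau : admissible x tau -> tau <= b2 - b1.
Proof.
move=> [/andP[x0 x1] _ h]; have := mulr_ge0 (ltW hb2) x0; move: hb1; lra.
Qed.

(** Admissibility places b_j x + tau in [b1, b2], where |p (e^u)| <= 1, so Gronwall's argument runs
    with free term 1 and the bound does not depend on [p]. *)
Lemma expsum_bound s Q p y : potential Q ->
  (forall k, duhamel b1 b2 s Q k (y k)) ->
  (forall u, b1 <= u <= b2 -> `|p.[expR u]| <= 1) ->
  forall j x tau, admissible x tau ->
    cmod (expsum p y j x tau) <= 2 * expR (4 * pot1 Q).
Proof.
move=> pQ yD p1; rewrite -[2]mulr1.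
have [M MP] := expsum_bounded p yD.
apply: (@gronwall_admissible (fun j x tau => cmod (expsum p y j x tau)) _ _ M).
- by [].
- exact: qpot_ge0.
- exact: qpot_integrable.
- by move=> j x tau h; apply: MP; [case: h|exact: tau_bound h].
- by move=> *; exact: cmod_ge0.
move=> H iH H0 EH j x tau h; have x01 : 0 <= x <= 1 by case: h.
rewrite (expsum_duhamel _ _ _ pQ yD x01); apply: le_trans (cmodD _ _) _.
apply: lerD.
  have -> : cmod (init_coef s j * (p.[expR (b j * x + tau)])%:C%C) =
      `|p.[expR (b j * x + tau)]|.
    rewrite cmodM cmodC /init_coef; case: ifP => _; first by rewrite cmod1 mul1r.
    by rewrite -signr_odd; case: (odd _); rewrite ?expr1 ?expr0 ?cmodN cmod1 mul1r.
  apply: p1; case: h => _ h1 h2; have /andP[c1 c2] := bcoef_bounds j.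
  case/andP: x01 => x0 x1; rewrite (le_trans h1) ?lerD2r ?ler_wpM2r//=.
  by rewrite (le_trans _ h2) ?lerD2r ?ler_wpM2r.
apply: le_cmod_cintegral_bound => //.
- apply: cintegrable_sum => // l; apply: cintegrableZ => //.
  exact: expsum_shift_integrable yD _.
- exact: iH.
- move=> t; rewrite /= in_itv/= => t0x.
  have t01 : 0 <= t <= 1.
    by case/andP: t0x => -> tx; rewrite (le_trans tx)//; case/andP: x01.
  apply: qpot_bound; first exact: H0.
  by move=> l; apply: EH; exact: admissible_shift.
Qed.

(** The free terms cancel, and Q E - Q' E' = (Q - Q') E + Q' (E - E'). The first term is a source
    bounded by the previous estimate; the second is handled by Gronwall's argument for Q'. *)
Lemma expsum_dist s Q Q' p y y' : potential Q -> potential Q' ->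
  (forall k, duhamel b1 b2 s Q k (y k)) ->
  (forall k, duhamel b1 b2 s Q' k (y' k)) ->
  (forall u, b1 <= u <= b2 -> `|p.[expR u]| <= 1) ->
  forall j x tau, admissible x tau ->
    cmod (expsum p y j x tau - expsum p y' j x tau) <=
    2 * (pot1 (fun x => Q x - Q' x) * (2 * expR (4 * pot1 Q))) *
    expR (4 * pot1 Q').
Proof.
move=> pQ pQ' yD yD' p1; have pB := potentialB pQ pQ'.
have EB := expsum_bound pQ yD p1; set N := 2 * expR (4 * pot1 Q) in EB *.
have N0 : 0 <= N by rewrite mulr_ge0// expR_ge0.
have [M MP] := expsum_bounded p yD; have [M' MP'] := expsum_bounded p yD'.
apply: (@gronwall_admissible
  (fun j x tau => cmod (expsum p y j x tau - expsum p y' j x tau)) _ _ (M + M')).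
- by rewrite mulr_ge0//; apply: Rintegral_ge0 => t _; exact: qpot_ge0.
- exact: qpot_ge0.
- exact: qpot_integrable.
- move=> j x tau h; have x01 : 0 <= x <= 1 by case: h.
  apply: le_trans (cmodB _ _) _; apply: lerD.
    exact: MP x01 (tau_bound h).
  exact: MP' x01 (tau_bound h).
- by move=> *; exact: cmod_ge0.
move=> H iH H0 EH j x tau h; have x01 : 0 <= x <= 1 by case: h.
have /andP[x0 x1] := x01.
rewrite (expsum_duhamel _ _ _ pQ yD x01) (expsum_duhamel _ _ _ pQ' yD' x01).
rewrite opprD addrACA subrr add0r.
have iE (P P' : R -> 'M[R[i]]_2) z : potential P ->
    (forall k, duhamel b1 b2 s P' k (z k)) ->
    cintegrable `[0, x] (fun t => \sum_l - ('i%C * (b j)%:C%C) *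
      (P t j l * expsum p z l t (tau + b j * (x - t)))).
  move=> pP zD; apply: cintegrable_sum => // l; apply: cintegrableZ => //.
  exact: expsum_shift_integrable zD _.
rewrite -cintegralB//; [|exact: iE yD|exact: iE yD'].
have iB : mu.-integrable `[0, x] (fun t => (qpot (fun x => Q x - Q' x) t * N)%:E).
  apply: (eq_rint (f := fun t => N * qpot (fun x => Q x - Q' x) t)) => //.
    by move=> t _; rewrite mulrC.
  by apply: rintZ => //; apply: rint_cc (qpot_integrable pB).
apply: (@le_trans _ _ (\int[mu]_(t in `[0, x])
    (qpot (fun x => Q x - Q' x) t * N + qpot Q' t * H t))).
  apply: le_cmod_cintegral_bound => //.
  - by apply: cintegrableB => //; [exact: iE yD|exact: iE yD'].
  - by apply: rintD => //; exact: iH.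
  - move=> t; rewrite /= in_itv/= => t0x.
    have t01 : 0 <= t <= 1.
      by case/andP: t0x => -> tx; rewrite (le_trans tx).
    rewrite -sumrB.
    have -> : \sum_l (- ('i%C * (b j)%:C%C) *
        (Q t j l * expsum p y l t (tau + b j * (x - t))) -
        - ('i%C * (b j)%:C%C) *
        (Q' t j l * expsum p y' l t (tau + b j * (x - t)))) =
      \sum_l - ('i%C * (b j)%:C%C) *
        ((Q t - Q' t) j l * expsum p y l t (tau + b j * (x - t))) +
      \sum_l - ('i%C * (b j)%:C%C) * (Q' t j l *
        (expsum p y l t (tau + b j * (x - t)) -
         expsum p y' l t (tau + b j * (x - t)))).
      by rewrite -big_split; apply: eq_bigr => l _; rewrite !mxE /=; ring.
    apply: le_trans (cmodD _ _) _; apply: lerD.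
      apply: (@qpot_bound (fun t => Q t - Q' t) j t _ N N0) => l.
      by apply: EB; exact: admissible_shift.
    apply: qpot_bound; first exact: H0.
    by move=> l; apply: EH; exact: admissible_shift.
rewrite RintegralD//; last exact: iH.
rewrite lerD2r RintegralZr//; last by apply: rint_cc (qpot_integrable pB).
by apply: ler_wpM2r => //; exact: pot1_ge.
Qed.

End ExponentialSums.

(** * Uniform continuity on compact sets *)

Section UniformContinuity.
Context {R : realType}.

(** A pseudodistance [dist] between points replaces the distance of values, so that the statement
    covers real functions and complex functions measured by [cmod]. Compactness yields one [d] from
    the local radii, each halved to leave room for the triangle inequality. *)
Lemma heine (T : pseudoMetricType R) (K : set T) (dist : T -> T -> R) :
  compact K ->
  (forall x y, dist x y = dist y x) ->
  (forall x y z, dist x z <= dist x y + dist y z) ->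
  (forall x, K x -> forall e, 0 < e -> exists2 r, 0 < r &
     forall z, K z -> ball x r z -> dist x z < e) ->
  forall e : R, 0 < e -> exists2 d : R, 0 < d &
    forall x y, K x -> K y -> ball x d y -> dist x y < e.
Proof.
move=> cK dS dT loc e e0.
pose P (d : R) x := K x -> forall y, K y -> ball x d y -> dist x y < e.
have : \forall d \near 0^'+, K `<=` P d.
  move/compact_near_coveringP : cK; apply => x Kx.
  have [r r0 rP] := loc x Kx (e / 2) (divr_gt0 e0 (ltr0Sn _ _)).
  exists (ball x (r / 2), [set d | 0 < d < r / 2]) => /=.
    split; first by apply: nbhsx_ballx; rewrite divr_gt0.
    have h : \forall d \near (0 : R)^'+, 0 < d < r / 2.
      near=> d; apply/andP; split; first by near: d; exact: nbhs_right_gt.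
      by near: d; apply: nbhs_right_lt; rewrite divr_gt0.
    exact: h.
  move=> [x' d] /= [bx' /andP[d0 dr]] Kx' y Ky bxy.
  have bxy' : ball x r y.
    rewrite (splitr r); apply: ball_triangle bx' _.
    exact: le_ball (ltW dr) _ bxy.
  have bxx' : ball x r x'.
    by apply: le_ball bx'; rewrite ler_pdivrMr// ler_peMr// ?ler1n// ltW.
  rewrite (splitr e) (le_lt_trans (dT x' x y))// ltrD//; last exact: rP.
  by rewrite dS; exact: rP.
move=> h; have [d [d0 dP]] : exists d : R, 0 < d /\ K `<=` P d.
  near (0 : R)^'+ => d; exists d; split; first by near: d; exact: nbhs_right_gt.
  by near: d; exact: h.
by exists d => // x y Kx Ky; exact: dP.
Unshelve. all: by end_near. Qed.

Lemma heine_segment (f : R -> R) (a b : R) : continuous f ->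
  forall e, 0 < e -> exists2 d, 0 < d & forall x y, a <= x <= b -> a <= y <= b ->
    `|x - y| < d -> `|f x - f y| < e.
Proof.
move=> cf e e0.
have [||x y z|x _ r r0|d d0 dP] :=
    @heine R `[a, b] (fun x y => `|f x - f y|) _ _ _ _ e e0.
- exact: segment_compact.
- by move=> x y; exact: distrC.
- exact: ler_distD.
- have /cvgrPdist_lt /(_ r r0) /nbhs_ballP[s /= s0 sP] := cf x.
  by exists s => // z _; exact: sP.
- exists d => // x y xab yab xy; apply: dP; rewrite ?in_itv//.
Qed.

End UniformContinuity.

(** * Weierstrass approximation by Bernstein polynomials and by polynomials in e^u *)

Section Bernstein.
Context {R : realType}.
Implicit Types (g : nat -> R) (v : R).

(* The Bernstein polynomial [\sum_k g k * 'C(n, k) * v ^ k * (1 - v) ^ (n - k)],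
   defined by the Pascal recursion. *)
Fixpoint bernstein n g : {poly R} :=
  if n is m.+1 then 'X * bernstein m (g \o S) + (1 - 'X) * bernstein m g
  else (g 0%N)%:P.

Lemma bernsteinS n g v : (bernstein n.+1 g).[v] =
  v * (bernstein n (g \o S)).[v] + (1 - v) * (bernstein n g).[v].
Proof. by rewrite /= !hornerE. Qed.

Lemma bernstein_le n g g' v : 0 <= v <= 1 ->
  (forall k, (k <= n)%N -> g k <= g' k) ->
  (bernstein n g).[v] <= (bernstein n g').[v].
Proof.
move=> /andP[v0 v1]; elim: n g g' => [|n ih] g g' gg.
  by rewrite /= !hornerE gg.
rewrite !bernsteinS; apply: lerD; apply: ler_wpM2l; rewrite ?subr_ge0//.
  by apply: ih => k kn /=; apply: gg.
by apply: ih => k kn; apply: gg; exact: leqW.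
Qed.

Lemma bernsteinB n g c v :
  (bernstein n (fun k => g k - c)).[v] = (bernstein n g).[v] - c.
Proof.
elim: n g => [|n ih] g; first by rewrite /= !hornerE.
rewrite !bernsteinS ih (_ : _ \o S = fun k => (g \o S) k - c)// ih; ring.
Qed.

Lemma bernsteinN n g v :
  (bernstein n (fun k => - g k)).[v] = - (bernstein n g).[v].
Proof.
elim: n g => [|n ih] g; first by rewrite /= !hornerE.
rewrite !bernsteinS ih (_ : _ \o S = fun k => - (g \o S) k)// ih; ring.
Qed.

(** The second moment about [a] of the binomial law with parameters n and v. The induction needs
    every [a], because the shift in the Pascal recursion replaces [a] by [a - 1]. *)
Lemma bernstein_quadratic n c r a v :
  (bernstein n (fun k => c + r * (k%:R - a) ^+ 2)).[v] =
  c + r * (n%:R * v * (1 - v) + (n%:R * v - a) ^+ 2).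
Proof.
elim: n a => [|n ih] a; first by rewrite /= !hornerE /=; ring.
rewrite bernsteinS ih.
rewrite (_ : _ \o S = fun k => c + r * (k%:R - (a - 1)) ^+ 2); last first.
  by apply/funext => k /=; rewrite -natr1; ring.
rewrite ih -natr1; ring.
Qed.

(** Uniform continuity and boundedness give |f w - f v| <= e/2 + K (w - v)^2 on all of [0, 1].
    Positivity of the Bernstein operator carries this over to the polynomial, where the quadratic
    term becomes a variance of order 1/n. *)
Lemma weierstrass (f : R -> R) (e : R) : continuous f -> 0 < e ->
  exists p : {poly R}, forall v, 0 <= v <= 1 -> `|p.[v] - f v| <= e.
Proof.
move=> cf e0; have e20 : 0 < e / 2 by rewrite divr_gt0.
have [d d0 dP] := heine_segment 0 1 cf e20.
have [M M0 fM] : exists2 M, 0 <= M & forall v, 0 <= v <= 1 -> `|f v| <= M.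
  have [c _ cP] := @EVT_max R (fun v => `|f v|) 0 1 ler01
    (continuous_subspaceT (fun x => continuous_comp (cf x) (@norm_continuous _ _ _))).
  by exists `|f c| => // v v01; apply: cP; rewrite in_itv.
(* At distance at least [d] the oscillation 2 M is at most K (w - v)^2. *)
pose K := 2 * M / d ^+ 2.
have K0 : 0 <= K by apply: divr_ge0; [exact: mulr_ge0|exact: sqr_ge0].
have dist v w : 0 <= v <= 1 -> 0 <= w <= 1 ->
    `|f w - f v| <= e / 2 + K * (w - v) ^+ 2.
  move=> v01 w01; have [wv|dwv] := ltP `|w - v| d.
    by rewrite (le_trans (ltW (dP _ _ w01 v01 wv)))// lerDl mulr_ge0// sqr_ge0.
  apply: (@le_trans _ _ (2 * M)).
    by apply: le_trans (ler_normB _ _) _; have := fM _ v01; have := fM _ w01; lra.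
  apply: (@le_trans _ _ (K * d ^+ 2)).
    by rewrite /K divfK// expf_neq0// gt_eqF.
  rewrite -[leLHS]add0r; apply: lerD; first exact: ltW.
  apply: ler_wpM2l => //; rewrite -[leRHS]real_normK ?num_real//.
  by rewrite ler_pXn2r// nnegrE ltW.
(* The degree n + 1 is chosen so that K / (n + 1) <= e / 2, which suffices as v (1 - v) <= 1. *)
have [n nP] : exists n : nat, 2 * K / e < n.+1%:R.
  by exists (Num.truncn (2 * K / e)); exact: truncnS_gt.
have n0 : 0 < n.+1%:R :> R by rewrite ltr0n.
pose g k := f (k%:R / n.+1%:R).
have kn01 k : (k <= n.+1)%N -> 0 <= k%:R / n.+1%:R :> R /\ k%:R / n.+1%:R <= 1 :> R.
  by move=> kn; rewrite divr_ge0//; split=> //; rewrite ler_pdivrMr// mul1r ler_nat.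
exists (bernstein n.+1 g) => v v01.
have var : K / n.+1%:R ^+ 2 * (n.+1%:R * v * (1 - v)) <= e / 2.
  have -> : K / n.+1%:R ^+ 2 * (n.+1%:R * v * (1 - v)) =
      K / n.+1%:R * (v * (1 - v)).
    by field; rewrite gt_eqF.
  apply: (@le_trans _ _ (K / n.+1%:R * 1)).
    apply: ler_wpM2l; first by rewrite divr_ge0// ltW.
    case/andP: v01 => v0 v1; nra.
  rewrite mulr1 ler_pdivrMr//; move: nP; rewrite ltr_pdivrMr//; lra.
have bnd k : (k <= n.+1)%N -> `|g k - f v| <=
    e / 2 + K / n.+1%:R ^+ 2 * (k%:R - n.+1%:R * v) ^+ 2.
  move=> kn; have [h0 h1] := kn01 k kn.
  have h01 : 0 <= (k%:R / n.+1%:R : R) <= 1 by rewrite h0.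
  apply: le_trans (dist _ _ v01 h01) _.
  rewrite le_eqVlt; apply/orP; left; apply/eqP.
  by field; rewrite gt_eqF.
rewrite -bernsteinB ler_norml; apply/andP; split.
- rewrite lerNl -bernsteinN.
  apply: le_trans (bernstein_le (g' := fun k => e / 2 +
    K / n.+1%:R ^+ 2 * (k%:R - n.+1%:R * v) ^+ 2) v01 _) _.
    by move=> k kn; apply: le_trans (bnd k kn); rewrite -normrN ler_norm.
  rewrite bernstein_quadratic subrr expr0n /= addr0 [leRHS](splitr e) lerD2l.
  exact: var.
- apply: le_trans (bernstein_le (g' := fun k => e / 2 +
    K / n.+1%:R ^+ 2 * (k%:R - n.+1%:R * v) ^+ 2) v01 _) _.
    by move=> k kn; apply: le_trans (bnd k kn); rewrite ler_norm.
  rewrite bernstein_quadratic subrr expr0n /= addr0 [leRHS](splitr e) lerD2l.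
  exact: var.
Qed.

(** The substitution v = (e^u - e^a) / (e^b - e^a) maps [a, b] onto [0, 1] and is affine in e^u, so
    composing with it turns a polynomial in v into a polynomial in e^u. *)
Lemma exp_weierstrass (f : R -> R) (a b e : R) : a < b -> continuous f -> 0 < e ->
  exists p : {poly R}, forall u, a <= u <= b -> `|p.[expR u] - f u| <= e.
Proof.
move=> ab cf e0; have d0 : 0 < expR b - expR a by rewrite subr_gt0 ltr_expR.
(* The absolute value keeps the argument of [ln] positive for every real v, so that [h] is
   continuous on the whole line. *)
pose h v := f (ln (expR a + `|v| * (expR b - expR a))).
have ch : continuous h.
  move=> v; apply: (@continuous_comp R R R
      (fun v => expR a + `|v| * (expR b - expR a)) (f \o @ln R)).
    apply: cvgD; first exact: cvg_cst.
    by apply: cvgM; [exact: norm_continuous|exact: cvg_cst].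
  apply: continuous_comp; last exact: cf.
  by apply: continuous_ln; rewrite ltr_wpDr ?expR_gt0// mulr_ge0// ltW.
have [p pP] := weierstrass ch e0.
exists (p \Po ((expR b - expR a)^-1 *: ('X - (expR a)%:P))) => u /andP[au ub].
rewrite horner_comp !hornerE.
set v := (X in p.[X]).
have v01 : 0 <= v <= 1.
  rewrite /v [_^-1 * _]mulrC; apply/andP; split.
    by rewrite divr_ge0// ?subr_ge0 ?ler_expR// ltW.
  by rewrite ler_pdivrMr// mul1r lerD2r ler_expR.
have -> : f u = h v.
  rewrite /h ger0_norm; last by case/andP: v01.
  by rewrite /v mulrAC mulVf ?gt_eqF// mul1r addrC subrK expRK.
exact: pP.
Qed.

End Bernstein.

(** * The L^1 norm as a supremum over continuous test functions *)

Section Duality.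
Context {R : realType}.
Local Notation mu := (@lebesgue_measure R).

Lemma measurable_fun_cts (D : set R) (f : R -> R) : continuous f ->
  measurable_fun D f.
Proof. by move=> cf; apply: measurable_funTS; exact: continuous_measurable_fun. Qed.

Lemma rintM_bounded (D : set R) (u f : R -> R) (M : R) : measurable D ->
  measurable_fun D u -> (forall t, D t -> `|u t| <= M) ->
  mu.-integrable D (fun t => (f t)%:E) ->
  mu.-integrable D (fun t => (u t * f t)%:E).
Proof.
move=> mD mu_ uM fi; apply: (rint_le (g := fun t => M * `|f t|)) => //.
- by apply: measurable_funM => //; exact: rint_meas.
- by move=> t Dt; rewrite normrM ler_wpM2r// uM.
- by apply: rintZ => //; exact: rint_norm.
Qed.

(* The sign of [f] is approximated by [g / (|g| + e)] with [g] continuous and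
   close to [f] in mean, cut off near [0] so as to vanish on [t <= 0]. *)
Lemma Rintegral_norm_dual (f : R -> R) (x M : R) : 0 <= x ->
  mu.-integrable `[0, x] (fun t => (f t)%:E) ->
  (forall psi : R -> R, continuous psi -> (forall t, `|psi t| <= 1) ->
     (forall t, t <= 0 -> psi t = 0) ->
     \int[mu]_(t in `[0, x]) (psi t * f t) <= M) ->
  \int[mu]_(t in `[0, x]) `|f t| <= M.
Proof.
move=> x0 fi H.
(* The four units of error are twice the distance from f to g and twice the mass of f near 0; the
   term e x comes from regularizing the sign of g. *)
suff key (e : R) : 0 < e -> \int[mu]_(t in `[0, x]) `|f t| <= M + e * (4 + x).
  apply/ler_addgt0Pr => e e0; have x40 : 0 < 4 + x by rewrite ltr_pwDl.
  apply: (le_trans (key (e / (4 + x)) _)); first exact: divr_gt0.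
  by rewrite divfK// gt_eqF.
move=> e0.
have mux : (mu (`[0%R, x]%classic : set R) < +oo)%E.
  by rewrite lebesgue_measure_itv/=; case: ifP => // _; rewrite ltry.
have [g_ [gc gi gf]] := approximation_continuous_integrable
  (measurable_itv `[0, x]) mux fi.
have [g cg gi'] : exists2 g : R -> R, continuous g &
    mu.-integrable `[0, x] (fun t => (g t)%:E) /\
    \int[mu]_(t in `[0, x]) `|f t - g t| <= e.
  have : \forall n \near \oo,
     (\int[mu]_(z in `[0%R, x]) `|(f z - g_ n z)%:E| < e%:E)%E.
    move/fine_cvgP : gf => [fin /cvgrPdist_lt /(_ e e0)].
    move=> h; near=> n.
    have fn : (\int[mu]_(z in `[0%R, x]) `|(f z - g_ n z)%:E|)%E \is a fin_num.
      by near: n.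
    rewrite -(fineK fn) lte_fin.
    have : `|0 - fine (\int[mu]_(z in `[0%R, x]) `|(f z - g_ n z)%:E|)%E| < e.
      by near: n.
    by rewrite sub0r normrN; apply: le_lt_trans; exact: ler_norm.
  move=> h; near \oo => n; exists (g_ n) => //; split; first exact: gi.
  rewrite -lee_fin /Rintegral fineK; last first.
    rewrite ge0_fin_numE; last by apply: integral_ge0 => t _; rewrite lee_fin.
    by apply: (@lt_trans _ _ e%:E); [near: n|rewrite ltry].
  by apply: ltW; near: n.
have [d d0 dP] := rint_small (measurable_itv `[0, x]) fi e0.
pose eta := d / 2; have eta0 : 0 < eta by rewrite divr_gt0.
(* The ramp equal to 0 for t <= 0, to t / eta on [0, eta] and to 1 beyond. *)
pose clip t := (`|t / eta| + 1 - `|t / eta - 1|) / 2.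
pose psi t := g t / (`|g t| + e) * clip t.
have ge_ t : 0 < `|g t| + e by rewrite ltr_wpDl.
have clip01 t : 0 <= clip t <= 1.
  rewrite /clip; case: (ger0P (t / eta)) => h1; case: (ger0P (t / eta - 1)) => h2;
    lra.
have sgn1 t : `|g t / (`|g t| + e)| <= 1.
  by rewrite normrM normfV (ger0_norm (ltW (ge_ t))) ler_pdivrMr// mul1r lerDl ltW.
have psi1 t : `|psi t| <= 1.
  rewrite normrM -[leRHS]mulr1; apply: ler_pM => //.
  by case/andP: (clip01 t) => ? ?; rewrite ger0_norm.
have psi0 t : t <= 0 -> psi t = 0.
  move=> t0; have h : t / eta <= 0 by rewrite pmulr_lle0 ?invr_gt0.
  rewrite /psi (_ : clip t = 0) ?mulr0// /clip (ler0_norm h) ler0_norm; lra.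
have cpsi : continuous psi.
  move=> t; apply: cvgM.
    apply: cvgM; first exact: cg.
    apply: cvgV; first by rewrite gt_eqF.
    apply: cvgD; last exact: cvg_cst.
    exact: (continuous_comp (cg t) (@norm_continuous _ _ _)).
  have ct : (fun t => t / eta) @ t --> t / eta by apply: cvgM => //; exact: cvg_cst.
  apply: cvgM; last exact: cvg_cst.
  apply: cvgB; first by apply: cvgD; [exact: cvg_norm|exact: cvg_cst].
  by apply: cvg_norm; apply: cvgB => //; exact: cvg_cst.
have pw t : `[0, x]%classic t -> `|f t| <= psi t * f t + 2 * `|f t - g t| + e +
    2 * ((fun t => `|f t|) \_ (`[0, eta] : set R)) t.
  rewrite /= in_itv/= => /andP[t0 tx]; rewrite patchE.
  have [teta|teta] := leP t eta.
    rewrite mem_set/= ?in_itv/= ?t0//.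
    have h : `|psi t * f t| <= `|f t| by rewrite normrM ler_piMl.
    have : - (psi t * f t) <= `|f t| by apply: le_trans h; rewrite -normrN ler_norm.
    have := normr_ge0 (f t - g t); have := e0; lra.
  rewrite memNset/= ?in_itv/= ?t0/= ?leNgt ?teta// mulr0 addr0.
  have -> : psi t = g t / (`|g t| + e).
    have h : 1 <= t / eta by rewrite ler_pdivlMr// mul1r ltW.
    rewrite /psi (_ : clip t = 1) ?mulr1// /clip !ger0_norm; lra.
  set w := g t / _; have w1 : `|w| <= 1 by exact: sgn1.
  (* Here g^2 / (|g| + e) >= |g| - e, because (|g| - e) (|g| + e) = g^2 - e^2. *)
  have wg : `|g t| - e <= w * g t.
    rewrite /w mulrAC ler_pdivlMr// -expr2 -[g t ^+ 2]real_normK ?num_real//.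
    by have := sqr_ge0 e; rewrite expr2; nra.
  have fg : `|w * (f t - g t)| <= `|f t - g t| by rewrite normrM ler_piMl.
  have : - (w * (f t - g t)) <= `|f t - g t|.
    by apply: le_trans fg; rewrite -normrN ler_norm.
  have : `|f t| <= `|g t| + `|f t - g t|.
    by rewrite addrC; have := ler_normD (f t - g t) (g t); rewrite subrK.
  rewrite mulrBr; move: wg; lra.
have ifg : mu.-integrable `[0, x] (fun t => `|f t - g t|%:E).
  by apply: rint_norm => //; apply: rintB => //; exact: gi'.1.
have ipf : mu.-integrable `[0, x] (fun t => (psi t * f t)%:E).
  apply: (@rintM_bounded _ _ _ 1) => //; first exact: measurable_fun_cts.
have ires : mu.-integrable `[0, x]
    (fun t => (((fun t => `|f t|) \_ (`[0, eta] : set R)) t)%:E).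
  apply: (rint_le (g := fun t => `|f t|)) => //; last exact: rint_norm.
    have h : measurable_fun (`[0, x] `&` `[0, eta] : set R) (fun t => `|f t|).
      apply: measurable_funS (rint_meas (rint_norm (measurable_itv _) fi)).
        exact: measurable_itv.
      exact: subIsetl.
    exact: ((measurable_restrict _ (measurable_itv _) (measurable_itv _)).1 h).
  by move=> t _; rewrite patchE; case: ifP; rewrite ?normr_id ?normr0.
apply: (@le_trans _ _ (\int[mu]_(t in `[0, x]) (psi t * f t + 2 * `|f t - g t| + e +
    2 * ((fun t => `|f t|) \_ (`[0, eta] : set R)) t))).
  apply: le_Rintegral => //; first exact: rint_norm.
  apply: rintD => //; last exact: rintZ.
  apply: rintD => //; last exact: rint_cst_cc.
  by apply: rintD => //; exact: rintZ.
rewrite RintegralD//; last 2 first.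
- apply: rintD => //; last exact: rint_cst_cc.
  by apply: rintD => //; exact: rintZ.
- exact: rintZ.
rewrite RintegralD//; last 2 first.
- by apply: rintD => //; exact: rintZ.
- exact: rint_cst_cc.
rewrite RintegralD//; last exact: rintZ.
rewrite !RintegralZl// Rintegral_cst_cc// subr0 -Rintegral_mkcondr.
have small : \int[mu]_(t in `[0, x] `&` `[0, eta]) `|f t| <= e.
  apply: ltW; apply: dP; [exact: measurableI|exact: subIsetl|].
  apply: (@le_lt_trans _ _ (mu `[0, eta]%classic)).
    by apply: le_measure; rewrite ?inE//; exact: measurableI.
  by rewrite mu_cc ?(ltW eta0)// subr0 lte_fin ltr_pdivrMr// ltr_pMr// ltr1n.
have arith (A B C : R) : A <= M -> B <= e -> C <= e ->
    A + 2 * B + e * x + 2 * C <= M + e * (4 + x) by lra.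
exact: arith (H psi cpsi psi1 psi0) gi'.2 small.
Unshelve. all: by end_near. Qed.

End Duality.

(** * Recovering the L^1 norms of two kernels from their joint exponential moments *)

Section KernelDuality.
Context {R : realType}.
Local Notation mu := (@lebesgue_measure R).
Variables (b1 b2 : R).
Hypotheses (hb1 : b1 < 0) (hb2 : 0 < b2).

Section Test.
Variables (x M : R) (D1 D2 : R -> R[i]) (sg : R[i]).
Hypotheses (x01 : 0 <= x <= 1) (iD1 : cintegrable `[0, x] D1)
  (iD2 : cintegrable `[0, x] D2) (sg1 : cmod sg = 1).

Let test (phi : R -> R) : R[i] := cintegral `[0, x] (fun t =>
  (phi (b1 * t))%:C%C * D1 t + sg * ((phi (b2 * t))%:C%C * D2 t)).

Hypothesis testM : forall p : {poly R},
  (forall u, b1 <= u <= b2 -> `|p.[expR u]| <= 1) ->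
  cmod (test (fun u => p.[expR u])) <= M.

Let frange1 t : 0 <= t <= x -> b1 <= b1 * t <= b2.
Proof.
move=> /andP[t0 tx]; have /andP[_ x1] := x01; have t1 := le_trans tx x1.
apply/andP; split; first by rewrite -[leLHS]mulr1 ler_nM2l.
by apply: (@le_trans _ _ 0); [rewrite nmulr_rle0|exact: ltW].
Qed.

Let frange2 t : 0 <= t <= x -> b1 <= b2 * t <= b2.
Proof.
move=> /andP[t0 tx]; have /andP[_ x1] := x01; have t1 := le_trans tx x1.
apply/andP; split; last by rewrite -[leRHS]mulr1 ler_pM2l.
by apply: (@le_trans _ _ 0); [exact: ltW|rewrite pmulr_rge0].
Qed.

Let cts_scale (phi : R -> R) (c : R) : continuous phi ->
  continuous (fun t => phi (c * t)).
Proof.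
move=> cphi t; apply: (@continuous_comp R R R (fun t => c * t) phi); last exact: cphi.
by apply: cvgM => //; exact: cvg_cst.
Qed.

Let phi_integrable (phi : R -> R) (N c : R) (D : R -> R[i]) :
  continuous phi -> (forall u, b1 <= u <= b2 -> `|phi u| <= N) ->
  (forall t, 0 <= t <= x -> b1 <= c * t <= b2) -> cintegrable `[0, x] D ->
  cintegrable `[0, x] (fun t => (phi (c * t))%:C%C * D t).
Proof.
move=> cphi phiN cP iD.
apply: (@cintegrableM_bounded _ _ D (fun t => (phi (c * t))%:C%C) N) => //.
  by apply: cmeasurable_real; apply: measurable_fun_cts; exact: cts_scale.
move=> t tx; rewrite cmodC; apply: phiN; apply: cP.
by move: tx; rewrite /= in_itv.
Qed.

Let integrand_integrable (phi : R -> R) (N : R) :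
  continuous phi -> (forall u, b1 <= u <= b2 -> `|phi u| <= N) ->
  cintegrable `[0, x] (fun t =>
    (phi (b1 * t))%:C%C * D1 t + sg * ((phi (b2 * t))%:C%C * D2 t)).
Proof.
move=> cphi phiN; apply: cintegrableD => //.
  exact: phi_integrable cphi phiN frange1 iD1.
apply: cintegrableZ => //.
exact: phi_integrable cphi phiN frange2 iD2.
Qed.

Let cont_pexp (p : {poly R}) : continuous (fun u => p.[expR u]).
Proof.
move=> u; apply: (@continuous_comp R R R (@expR R) (horner p)).
  exact: continuous_expR.
exact: continuous_horner.
Qed.

(** An e-approximation [p] of [phi] is bounded by 1 + e on [b1, b2], so p / (1 + e) is a legitimate
    test polynomial. Rescaling and the approximation error together cost e (M + I). *)
Lemma test_cts (phi : R -> R) : continuous phi -> (forall u, `|phi u| <= 1) ->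
  cmod (test phi) <= M.
Proof.
move=> cphi phi1; set I := \int[mu]_(t in `[0, x]) (cmod (D1 t) + cmod (D2 t)).
have icD1 := cintegrable_cmod (measurable_itv _) iD1.
have icD2 := cintegrable_cmod (measurable_itv _) iD2.
have I0 : 0 <= I.
  by apply: Rintegral_ge0 => t _; rewrite addr_ge0 ?cmod_ge0.
have M0 : 0 <= M.
  apply: le_trans (cmod_ge0 _) (testM (p := 0) _) => u _.
  by rewrite horner0 normr0 ler01.
suff key (e : R) : 0 < e -> cmod (test phi) <= M + e * (M + I).
  apply/ler_addgt0Pr => e e0; have h : 0 < M + I + 1 by rewrite ltr_wpDl ?addr_ge0.
  apply: (le_trans (key (e / (M + I + 1)) _)); first exact: divr_gt0.
  rewrite lerD2l mulrAC ler_pdivrMr// ler_wpM2l ?lerDl// ltW//.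
move=> e0; have b12 : b1 < b2 by exact: lt_trans hb2.
have [p pP] := exp_weierstrass b12 cphi e0.
have e1 : 0 < 1 + e by rewrite ltr_wpDl.
pose p' := (1 + e)^-1 *: p.
have p'P u : b1 <= u <= b2 -> `|p'.[expR u]| <= 1.
  move=> hu; rewrite /p' hornerZ normrM ger0_norm ?invr_ge0 ?(ltW e1)//.
  rewrite mulrC ler_pdivrMr// mul1r -[p.[_]](subrK (phi u)) addrC.
  apply: le_trans (ler_normD _ _) _; apply: lerD; first exact: phi1.
  exact: pP.
have iphi := integrand_integrable cphi (fun u _ => phi1 u).
have ip' := integrand_integrable (@cont_pexp p') p'P.
have -> : test phi = (1 + e)%:C%C * test (fun u => p'.[expR u]) +
    cintegral `[0, x] (fun t =>
      (phi (b1 * t) - p.[expR (b1 * t)])%:C%C * D1 t +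
      sg * ((phi (b2 * t) - p.[expR (b2 * t)])%:C%C * D2 t)).
  rewrite /test -cintegralZ// -cintegralD//.
  - apply: eq_cintegral => t _; rewrite /p' !hornerZ.
    have E (r : R) : (r)%:C%C = (1 + e)%:C%C * ((1 + e)^-1 * r)%:C%C :> R[i].
      by rewrite -rmorphM mulrA divff ?gt_eqF// mul1r.
    rewrite !rmorphB /= [(p.[expR (b1 * t)])%:C%C]E.
    by rewrite [(p.[expR (b2 * t)])%:C%C]E; ring.
  - exact: cintegrableZ.
  - apply: (@integrand_integrable (fun u => phi u - p.[expR u]) e).
      by move=> u; apply: cvgB; [exact: cphi|exact: cont_pexp].
    by move=> u hu; rewrite distrC; exact: pP.
apply: le_trans (cmodD _ _) _; rewrite cmodM cmodC ger0_norm ?(ltW e1)//.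
have -> : M + e * (M + I) = (1 + e) * M + e * I by ring.
apply: lerD; first by apply: ler_wpM2l; [exact: ltW|exact: testM].
rewrite /I -RintegralZl//; last exact: rintD.
apply: le_cmod_cintegral_bound => //.
- apply: (@integrand_integrable (fun u => phi u - p.[expR u]) e).
    by move=> u; apply: cvgB; [exact: cphi|exact: cont_pexp].
  by move=> u hu; rewrite distrC; exact: pP.
- by apply: rintZ => //; exact: rintD.
- move=> t; rewrite /= in_itv/= => ht; apply: le_trans (cmodD _ _) _.
  rewrite !cmodM sg1 mul1r !cmodC mulrDr; apply: lerD; apply: ler_wpM2r;
    rewrite ?cmod_ge0// distrC; apply: pP; [exact: frange1|exact: frange2].
Qed.

(** Real and imaginary parts are tested separately against real functions, hence the factor 2. *)
Let norm_dual (D : R -> R[i]) : cintegrable `[0, x] D ->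
  (forall psi : R -> R, continuous psi -> (forall t, `|psi t| <= 1) ->
     (forall t, t <= 0 -> psi t = 0) ->
     cmod (cintegral `[0, x] (fun t => (psi t)%:C%C * D t)) <= M) ->
  \int[mu]_(t in `[0, x]) cmod (D t) <= 2 * M.
Proof.
move=> iD H; have [iDr iDi] := iD; have /andP[x0 x1] := x01.
have hr : \int[mu]_(t in `[0, x]) `|complex.Re (D t)| <= M.
  apply: Rintegral_norm_dual => // psi c1 c2 c3.
  apply: le_trans (H psi c1 c2 c3); apply: le_trans (Re_le_cmod _).
  rewrite /= (@eq_Rintegral _ _ _ mu _ (fun t => complex.Re ((psi t)%:C%C * D t))).
    exact: ler_norm.
  by move=> t _; rewrite cReM /= mul0r subr0.
have hi : \int[mu]_(t in `[0, x]) `|complex.Im (D t)| <= M.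
  apply: Rintegral_norm_dual => // psi c1 c2 c3.
  apply: le_trans (H psi c1 c2 c3); apply: le_trans (Im_le_cmod _).
  rewrite /= (@eq_Rintegral _ _ _ mu _ (fun t => complex.Im ((psi t)%:C%C * D t))).
    exact: ler_norm.
  by move=> t _; rewrite cImM /= mul0r addr0.
apply: (@le_trans _ _ (\int[mu]_(t in `[0, x])
    (`|complex.Re (D t)| + `|complex.Im (D t)|))).
  apply: le_Rintegral => //; first exact: cintegrable_cmod.
    by apply: rintD => //; exact: rint_norm.
  by move=> t _; exact: cmod_le_ReIm.
rewrite RintegralD//; [|exact: rint_norm|exact: rint_norm].
by rewrite mulrDl mul1r; exact: lerD.
Qed.

(* A test function vanishing on one half-line separates the two kernels,
   whose frequencies [b1 t] and [b2 t] have opposite signs. *)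
Lemma kernel_dual : \int[mu]_(t in `[0, x]) cmod (D1 t) <= 2 * M /\
  \int[mu]_(t in `[0, x]) cmod (D2 t) <= 2 * M.
Proof.
have inv_scale (c : R) (psi : R -> R) : continuous psi ->
    continuous (fun u : R => psi (u / c)).
  move=> h; rewrite (_ : (fun u => _) = (fun u => psi (c^-1 * u))).
    exact: cts_scale.
  by apply/funext => u; rewrite mulrC.
split; apply: norm_dual => // psi cpsi psi1 psi0.
- have := test_cts (inv_scale b1 _ cpsi) (fun u => psi1 _).
  rewrite /test; congr (cmod _ <= M); apply: eq_cintegral => t /set_mem.
  rewrite /= in_itv/= => /andP[t0 tx].
  rewrite [b1 * t]mulrC mulfK ?lt_eqF// (psi0 (b2 * t / b1)) ?mul0r ?mulr0 ?addr0//.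
  by rewrite nmulr_lle0 ?invr_lt0// pmulr_rge0.
- have := test_cts (inv_scale b2 _ cpsi) (fun u => psi1 _).
  rewrite /test (@eq_cintegral _ _ _ (fun t => sg * ((psi t)%:C%C * D2 t))).
    rewrite cintegralZ ?cmodM ?sg1 ?mul1r//.
    apply: (@cintegrableM_bounded _ _ D2 (fun t => (psi t)%:C%C) 1) => //.
      by apply: cmeasurable_real; exact: measurable_fun_cts.
    by move=> t _; rewrite cmodC.
  move=> t /set_mem; rewrite /= in_itv/= => /andP[t0 tx].
  rewrite [b2 * t]mulrC mulfK ?gt_eqF// (psi0 (b1 * t / b2)) ?mul0r ?add0r//.
  by rewrite pmulr_lle0 ?invr_gt0// nmulr_rle0.
Qed.

End Test.
End KernelDuality.

(** * Continuous kernels on the triangle and traces of their limits *)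

Section Kernels.
Context {R : realType}.
Local Notation mu := (@lebesgue_measure R).
Implicit Types (f g : R * R -> R[i]) (x t e : R).

Lemma OmegaP x t : Omega (x, t) <-> 0 <= t <= x /\ x <= 1.
Proof. by split=> [[/= -> [-> ->]]|[/andP[? ?] ?]]. Qed.

Lemma Omega_compact : compact (@Omega R).
Proof.
apply: (@subclosed_compact (R * R)%type Omega (`[0, 1]%classic `*` `[0, 1]%classic)).
- rewrite (_ : Omega = [set q : R * R | 0 <= q.2] `&`
    ([set q | 0 <= q.1 - q.2] `&` [set q | q.1 <= 1])).
    2: by apply/seteqP; split=> q /=; rewrite /Omega /= subr_ge0.
  have c1 : continuous (fun q : R * R => q.1) by move=> q; exact: cvg_fst.
  have c2 : continuous (fun q : R * R => q.2) by move=> q; exact: cvg_snd.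
  apply: closedI; last apply: closedI.
  + apply: (closed_comp (f := fun q : R * R => q.2) (D := [set r | 0 <= r])).
      by move=> q _; exact: c2.
    exact: closed_ge.
  + apply: (closed_comp (f := fun q : R * R => q.1 - q.2)
        (D := [set r | 0 <= r])).
      by move=> q _; apply: cvgB; [exact: c1|exact: c2].
    exact: closed_ge.
  + apply: (closed_comp (f := fun q : R * R => q.1) (D := [set r | r <= 1])).
      by move=> q _; exact: c1.
    exact: closed_le.
- by apply: compact_setX; exact: segment_compact.
- move=> [x t] /OmegaP[/andP[t0 tx] x1] /=; rewrite !in_itv/=.
  by rewrite (le_trans t0 tx) x1 t0 (le_trans tx x1).
Qed.

Lemma C_Omega_dist g q : C_Omega g -> Omega q -> forall e, 0 < e ->
  exists2 r : R, 0 < r & forall q', Omega q' -> ball q r q' -> cmod (g q - g q') < e.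
Proof.
move=> cg Oq e e0; have := (subspace_continuousP _ _).1 cg q Oq.
have e0' : (0 : R[i]) < e%:C%C by rewrite ltcR.
move=> /cvgrPdist_lt /(_ _ e0').
rewrite near_withinE => /nbhs_ballP[r /= r0 rP].
exists r => // q' Oq' bq; have := rP q' bq Oq'.
by rewrite normCE ltcR.
Qed.

Lemma C_Omega_unif g : C_Omega g -> forall e, 0 < e -> exists2 d : R, 0 < d &
  forall q q', Omega q -> Omega q' -> ball q d q' -> cmod (g q - g q') < e.
Proof.
move=> cg e e0; apply: (@heine _ _ Omega (fun q q' => cmod (g q - g q'))) => //.
- exact: Omega_compact.
- by move=> q q'; rewrite -cmodN opprB.
- move=> q q' q''; have -> : g q - g q'' = (g q - g q') + (g q' - g q'').
    by rewrite addrA subrK.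
  exact: cmodD.
- by move=> q Oq r r0; exact: C_Omega_dist.
Qed.

(** The segment from the origin to a point of the triangle is cut into [N] steps shorter than the
    uniform modulus for oscillation 1, and [N] is the same for all points. *)
Lemma C_Omega_bounded g : C_Omega g ->
  exists2 M : R, 0 <= M & forall q, Omega q -> cmod (g q) <= M.
Proof.
move=> cg; have [d d0 dP] := C_Omega_unif cg ltr01.
have O0 : Omega ((0 : R), (0 : R)) by apply/OmegaP; rewrite !lexx ler01.
pose N := (Num.truncn d^-1).+1; have N0 : 0 < N%:R :> R by rewrite ltr0n.
have Nd : N%:R^-1 < d.
  by rewrite invf_plt ?posrE// truncnS_gt.
exists (cmod (g (0, 0)) + N%:R); first by rewrite addr_ge0 ?cmod_ge0.
move=> [x t] /OmegaP[/andP[t0 tx] x1].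
pose q k : R * R := (k%:R / N%:R * x, k%:R / N%:R * t).
have x0 : 0 <= x := le_trans t0 tx.
have kN k : (k <= N)%N -> 0 <= (k%:R / N%:R : R) <= 1.
  by move=> kN; rewrite divr_ge0 ?ler_pdivrMr ?mul1r ?ler_nat// ltW.
have Oq k : (k <= N)%N -> Omega (q k).
  move=> kN'; have /andP[k0 k1] := kN k kN'; apply/OmegaP.
  rewrite mulr_ge0// ler_wpM2l//.
  by split=> //; rewrite mulr_ile1.
have -> : (x, t) = q N by rewrite /q divff ?gt_eqF// !mul1r.
suff h k : (k <= N)%N -> cmod (g (q k)) <= cmod (g (0, 0)) + k%:R by exact: h.
elim: k => [_|k ih kN']; first by rewrite /q !mul0r addr0.
have step (y : R) : 0 <= y <= 1 -> `|k%:R / N%:R * y - k.+1%:R / N%:R * y| < d.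
  move=> /andP[y0 y1]; apply: (le_lt_trans _ Nd).
  rewrite -mulrBl -mulrBl -[k.+1%:R]natr1 opprD addrA subrr sub0r mulN1r mulNr normrN.
  have Ni0 : 0 <= N%:R^-1 :> R by rewrite invr_ge0 ltW.
  by rewrite ger0_norm ?mulr_ge0// ler_piMr.
have -> : g (q k.+1) = g (q k) + (g (q k.+1) - g (q k)) by rewrite addrC subrK.
rewrite -[k.+1%:R]natr1 [leRHS]addrA.
apply: le_trans (cmodD _ _) _; apply: lerD; first exact: ih (ltnW kN').
rewrite -cmodN opprB; apply: ltW; apply: dP; [exact: Oq (ltnW _)|exact: Oq|].
by split; rewrite /ball /=; apply: step; rewrite ?x0 ?t0 ?(le_trans tx).
Qed.

Lemma within_continuousP (u : R -> R) (A : set R) :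
  (forall t, A t -> forall e, 0 < e -> exists2 r, 0 < r &
     forall t', A t' -> `|t - t'| < r -> `|u t - u t'| < e) ->
  {within A, continuous u}.
Proof.
move=> h; apply/subspace_continuousP => t At; apply/cvgrPdist_lt => e e0.
have [r r0 rP] := h t At e e0; rewrite near_withinE; apply/nbhs_ballP.
by exists r => // t' /= bt At'; exact: rP.
Qed.

Lemma C_Omega_section g x : C_Omega g -> 0 <= x <= 1 ->
  cintegrable `[0, x] (fun t => g (x, t)).
Proof.
move=> cg /andP[x0 x1]; have [M M0 gM] := C_Omega_bounded cg.
have Ot t : `[0, x]%classic t -> Omega (x, t).
  by rewrite /= in_itv/= => tx; exact/OmegaP.
have loc t : `[0, x]%classic t -> forall e, 0 < e -> exists2 r, 0 < r &
    forall t', `[0, x]%classic t' -> `|t - t'| < r ->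
      cmod (g (x, t) - g (x, t')) < e.
  move=> tx e e0; have [r r0 rP] := C_Omega_dist cg (Ot _ tx) e0.
  exists r => // t' tx' tt'; apply: rP; first exact: Ot.
  by split=> //; exact: ballxx.
have cm : cmeasurable (`[0, x] : set R) (fun t => g (x, t)).
  split; apply: subspace_continuous_measurable_fun => //;
    apply: within_continuousP => t tx e e0;
    have [r r0 rP] := loc t tx e e0; exists r => // t' tx' tt';
    apply: (le_lt_trans _ (rP t' tx' tt')).
  - by rewrite -cReN -cReD; exact: Re_le_cmod.
  - by rewrite -cImN -cImD; exact: Im_le_cmod.
apply: (@cintegrable_dominated _ _ _ (fun=> M)) => //; first exact: rint_cst_cc.
by move=> t /Ot; exact: gM.
Qed.

Lemma Omega_measurable : measurable (@Omega R).
Proof.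
rewrite (_ : Omega = (snd @^-1` `[0%R, +oo[) `&`
  ((fun q : R * R => q.1 - q.2) @^-1` `[0%R, +oo[) `&` (fst @^-1` `]-oo, 1%R])).
  2: by apply/seteqP; split=> q; rewrite /Omega /= !in_itv/= !andbT subr_ge0;
    [move=> [? [? ?]]|move=> [[? ?] ?]].
apply: measurableI; first apply: measurableI.
- by rewrite -[X in measurable X]setTI; exact: measurable_snd.
- rewrite -[X in measurable X]setTI.
  have h : measurable_fun setT (fun q : R * R => q.1 - q.2).
    by apply: measurable_funB; [exact: measurable_fst|exact: measurable_snd].
  exact: h.
- by rewrite -[X in measurable X]setTI; exact: measurable_fst.
Qed.

Lemma section_measurable f x : cmeasurable Omega f -> 0 <= x <= 1 ->
  cmeasurable (`[0, x] : set R) (fun t => f (x, t)).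
Proof.
move=> [mr mi] /andP[x0 x1].
have mp : measurable_fun (`[0, x] : set R) (fun t : R => (x, t)).
  by apply: measurable_funTS; exact: measurable_pair1.
have sub : [set (x, t) | t in (`[0, x] : set R)] `<=` Omega.
  by move=> _ [t /= + <-]; rewrite in_itv/= => tx; exact/OmegaP.
by split; [exact: (measurable_comp Omega_measurable sub mr mp)
          |exact: (measurable_comp Omega_measurable sub mi mp)].
Qed.

Lemma norm_Xinf_ae f e : (norm_Xinf f < e%:E)%E ->
  {ae mu, forall x, 0 <= x <= 1 ->
     (\int[mu]_(t in `[0%R, x]) (cmod (f (x, t)))%:E < e%:E)%E}.
Proof.
move=> fe; have := ess_sup_ge mu ((fun x : R =>
  \int[lebesgue_measure]_(t in `[0%R, x]) (cmod (f (x, t)))%:E)%E \_ `[0%R, 1%R]).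
apply: (@filterS _ _ (ae_filter_ringOfSetsType mu)) => x + x01.
rewrite patchE mem_set/= ?in_itv//; move=> h; exact: le_lt_trans h fe.
Qed.

Lemma ae_interval (P : R -> Prop) (a b : R) : a < b -> {ae mu, forall x, P x} ->
  exists2 x, a <= x <= b & P x.
Proof.
move=> ab [A [mA A0 PA]]; apply: contrapT => h.
have sub : `[a, b] `<=` A.
  move=> x; rewrite /= in_itv/= => xab; apply: PA => /= Px; apply: h.
  by exists x.
have : (mu `[a, b]%classic <= mu A)%E by apply: le_measure; rewrite ?inE.
rewrite A0 lebesgue_measure_itv/= lte_fin ab -EFinD lee_fin subr_le0.
by rewrite leNgt ab.
Qed.

(* The essential bound on the sections of a continuous kernel holds at every
   [x], by continuity in [x]. *)
Lemma C_Omega_ae_bound g c : C_Omega g ->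
  {ae mu, forall x, 0 <= x <= 1 -> \int[mu]_(t in `[0, x]) cmod (g (x, t)) <= c} ->
  forall x, 0 <= x <= 1 -> \int[mu]_(t in `[0, x]) cmod (g (x, t)) <= c.
Proof.
move=> cg ae x0 /andP[x00 x01]; have [M M0 gM] := C_Omega_bounded cg.
apply/ler_addgt0Pr => e e0.
have e20 : 0 < e / 2 by rewrite divr_gt0.
have [d d0 dP] := C_Omega_unif cg e20.
(* Within distance [r] values of [g] differ by less than e / 2, and a strip of width [r] carries a
   mass of at most e / 2. *)
pose r := Num.min d (e / 2 / (M + 1)) / 2.
have M10 : 0 < M + 1 by rewrite ltr_wpDl.
have r0 : 0 < r by rewrite divr_gt0// lt_min d0 divr_gt0.
have rd : r < d.
  by rewrite ltr_pdivrMr// gt_min ltr_pMr// ltr1n.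
have rM : M * r <= e / 2.
  apply: (@le_trans _ _ (M * (e / 2 / (M + 1)))).
    apply: ler_wpM2l => //; rewrite ler_pdivrMr//.
    have h : 0 <= e / 2 / (M + 1) by rewrite divr_ge0// ltW.
    by rewrite ge_min; apply/orP; right; rewrite ler_peMr// ler1n.
  by rewrite mulrA ler_pdivrMr// mulrC; apply: ler_wpM2l; [exact: ltW|rewrite lerDl].
have [|x /andP[xa xb] xP] :=
    @ae_interval _ (Num.max 0 (x0 - r)) (Num.min 1 (x0 + r)) _ ae.
  rewrite lt_min !gt_max ltr01 /=; apply/and3P; split.
  - by rewrite ltrBlDr ltr_pwDr.
  - exact: ltr_wpDl.
  - by rewrite ltrBlDr -addrA ltrDl addr_gt0.
move: xa xb; rewrite ge_max le_min => /andP[x_0 xr] /andP[x_1 xr'].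
have {}xP : \int[mu]_(t in `[0, x]) cmod (g (x, t)) <= c by apply: xP; rewrite x_0.
have dx : `|x0 - x| <= r.
  by rewrite ler_norml; apply/andP; split; lra.
have ig y : 0 <= y <= 1 -> mu.-integrable `[0, y] (fun t => (cmod (g (y, t)))%:E).
  by move=> y01; apply: cintegrable_cmod => //; exact: C_Omega_section.
have x0101 : 0 <= x0 <= 1 by rewrite x00.
have x_01 : 0 <= x <= 1 by rewrite x_0.
(* Both sections live on [0, m], where they are compared; what remains of the section at [x0] has
   length at most [r]. *)
pose m := Num.min x x0.
have m0 : 0 <= m by rewrite le_min x_0.
have mx : m <= x by rewrite ge_min lexx.
have mx0 : m <= x0 by rewrite ge_min lexx orbT.
have x0m : x0 - m <= r.
  rewrite /m; case: (leP x x0) => _; last by rewrite subrr ltW.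
  exact: le_trans (ler_norm _) dx.
rewrite (Rintegral_split m0 mx0 (ig _ x0101)).
have h1 : \int[mu]_(t in `[0, m]) cmod (g (x0, t)) <= c + e / 2.
  apply: (@le_trans _ _ (\int[mu]_(t in `[0, m]) (cmod (g (x, t)) + e / 2))).
    apply: le_Rintegral => //.
    - exact: rint_cc (ig _ x0101).
    - by apply: rintD => //; [exact: rint_cc (ig _ x_01)|exact: rint_cst_cc].
    - move=> t; rewrite /= in_itv/= => /andP[t0 tm].
      rewrite -(subrK (g (x, t)) (g (x0, t))) addrC.
      apply: le_trans (cmodD _ _) _; rewrite lerD2l; apply: ltW; apply: dP.
      + by apply/OmegaP; rewrite t0 (le_trans tm).
      + by apply/OmegaP; rewrite t0 (le_trans tm).
      + by split; [apply: le_lt_trans dx rd|exact: ballxx].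
  rewrite RintegralD//; [|exact: rint_cc (ig _ x_01)|exact: rint_cst_cc].
  rewrite Rintegral_cst_cc// subr0; apply: lerD.
    apply: le_trans xP; apply: le_Rintegral_cc => //; last exact: ig.
    by move=> t _; exact: cmod_ge0.
  by rewrite ler_piMr ?(ltW e20)// (le_trans mx).
have h2 : \int[mu]_(t in `[m, x0]) cmod (g (x0, t)) <= e / 2.
  apply: (@le_trans _ _ (\int[mu]_(t in `[m, x0]) M)).
    apply: le_Rintegral => //; [exact: rint_cc (ig _ x0101)|exact: rint_cst_cc|].
    move=> t; rewrite /= in_itv/= => /andP[mt tx0]; apply: gM; apply/OmegaP.
    by rewrite (le_trans m0 mt).
  by rewrite Rintegral_cst_cc//; apply: le_trans rM; apply: ler_wpM2l.
by rewrite [X in c + X]splitr addrA; exact: lerD.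
Qed.

Lemma norm_XinfB f g :
  norm_Xinf (fun q => f q - g q) = norm_Xinf (fun q => g q - f q).
Proof.
rewrite /norm_Xinf; congr (ess_sup _ (_ \_ _)); apply/funext => x.
by apply: eq_integral => t _; rewrite -cmodN opprB.
Qed.

Lemma C_OmegaB g g' : C_Omega g -> C_Omega g' -> C_Omega (fun q => g q - g' q).
Proof. by move=> cg cg' q; apply: cvgB; [exact: cg|exact: cg']. Qed.

Lemma integral_Rintegral (D : set R) (u : R -> R) : measurable D ->
  mu.-integrable D (fun t => (u t)%:E) ->
  (\int[mu]_(t in D) (u t)%:E)%E = (\int[mu]_(t in D) u t)%:E.
Proof.
move=> mD ui; rewrite /Rintegral fineK//.
exact: (@integrable_fin_num _ _ _ mu D mD).
Qed.

(** The two distances to [f] are controlled for almost every x only. The difference of the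
    continuous kernels inherits the bound almost everywhere, hence everywhere by continuity. *)
Lemma C_Omega_triangle f g g' e e' : cmeasurable Omega f ->
  C_Omega g -> C_Omega g' ->
  (norm_Xinf (fun q => g q - f q)%R < e%:E)%E ->
  (norm_Xinf (fun q => g' q - f q)%R < e'%:E)%E ->
  forall x, 0 <= x <= 1 ->
    \int[mu]_(t in `[0, x]) cmod (g (x, t) - g' (x, t)) <= e + e'.
Proof.
move=> mf cg cg' /norm_Xinf_ae h /norm_Xinf_ae h'.
apply: (C_Omega_ae_bound (C_OmegaB cg cg')).
apply: (@filterS2 _ _ (ae_filter_ringOfSetsType mu) _ _ _ _ h h') => x {}h {}h' x01.
have ms := section_measurable mf x01.
have ig := C_Omega_section cg x01; have ig' := C_Omega_section cg' x01.
have mm (g0 : R * R -> R[i]) : cintegrable `[0, x] (fun t => g0 (x, t)) ->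
    measurable_fun (`[0, x] : set R) (fun t => (cmod (g0 (x, t) - f (x, t)))%:E).
  move=> i0; apply/measurable_EFinP; apply: cmeasurable_cmod.
  by apply: cmeasurableD; [exact: cintegrable_meas|exact: cmeasurableN].
rewrite -lee_fin -integral_Rintegral//; last first.
  by apply: cintegrable_cmod => //; exact: cintegrableB.
apply: (@le_trans _ _ (\int[mu]_(t in `[0%R, x]) ((cmod (g (x, t) - f (x, t)))%:E +
    (cmod (g' (x, t) - f (x, t)))%:E))%E).
  apply: ge0_le_integral => //.
  - by move=> t _; rewrite lee_fin cmod_ge0.
  - apply/measurable_EFinP; apply: cmeasurable_cmod; apply: cintegrable_meas.
    exact: cintegrableB.
  - by apply: emeasurable_funD; exact: mm.
  - move=> t _; rewrite -EFinD lee_fin.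
    have -> : g (x, t) - g' (x, t) = (g (x, t) - f (x, t)) - (g' (x, t) - f (x, t)).
      by rewrite opprB addrA subrK.
    exact: cmodB.
rewrite ge0_integralD//; [|by move=> t _; rewrite lee_fin cmod_ge0|exact: mm
  |by move=> t _; rewrite lee_fin cmod_ge0|exact: mm].
by rewrite EFinD; apply: leeD; apply: ltW; [exact: h|exact: h'].
Qed.

Lemma trace_integrable f x : cintegrable `[0, x] (trace f x).
Proof. by rewrite /trace; case: xgetP => [g _ []//|_]; exact: cintegrable0. Qed.

(* [trace f x] vanishes identically when it is the default value of [xget]. *)
Lemma trace_approx f e : Xinf_0 f -> 0 < e ->
  exists2 g, C_Omega g & forall x, 0 <= x <= 1 ->
    trace f x = (fun=> 0) \/
    \int[mu]_(t in `[0, x]) cmod (trace f x t - g (x, t)) <= e.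
Proof.
move=> [mf fP] e0; have e40 : 0 < e / 4 by rewrite divr_gt0.
have [g cg ge_] := fP _ e40; exists g => // x x01.
rewrite /trace; case: xgetP => [tr _ [itr trP]|_]; last by left.
right.
(* The defining property of a trace speaks of sequences of continuous kernels; one is built with
   rate 1 / (n + 1). Three errors of e / 4 then occur: [phi n] against the trace, [phi n] against f,
   and g against f. *)
have /choice[phi phiP] : forall n : nat, exists g, C_Omega g /\
    (norm_Xinf (fun q => g q - f q)%R < (n.+1%:R^-1)%:E)%E.
  move=> n; have [|g' cg' ge'] := fP n.+1%:R^-1; first by rewrite invr_gt0.
  exists g'; split; first exact: cg'.
  rewrite norm_XinfB; exact: ge'.
have nXge0 (u : R * R -> R[i]) : (0 <= norm_Xinf u)%E.
  apply: ess_sup_gee.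
    apply: (@lt_le_trans _ _ (mu (`[0%R, 1%R]%classic : set R))).
      by rewrite lebesgue_measure_itv/= lte_fin ltr01 -EFinD subr0 lte_fin.
    by apply: le_measure; rewrite ?inE.
  apply: nearW => y; rewrite patchE; case: ifP => // _.
  by apply: integral_ge0 => t _; rewrite lee_fin cmod_ge0.
have cvg0 : norm_Xinf (fun q => phi n q - f q) @[n --> \oo] --> 0%E.
  apply: (@squeeze_cvge _ _ _ _ (fun=> 0%E) _ (fun n => (n.+1%:R^-1)%:E)).
  - by apply: nearW => n; rewrite nXge0 ltW//; exact: (phiP n).2.
  - exact: cvg_cst.
  - by apply/fine_cvgP; split; [exact: nearW|exact: cvg_harmonic].
have := trP phi (fun n => (phiP n).1) cvg0.
move=> /fine_cvgP[fin /cvgrPdist_lt /(_ _ e40) tr_small].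
have [n [ne nt nf]] : exists n : nat, [/\ n.+1%:R^-1 < e / 4,
    `|0 - fine (\int[mu]_(t in `[0%R, x]) (cmod (phi n (x, t) - tr t))%:E)%E| < e / 4 &
    (\int[mu]_(t in `[0%R, x]) (cmod (phi n (x, t) - tr t))%:E)%E \is a fin_num].
  near \oo => n; exists n; split.
  - by near: n; exact: near_infty_natSinv_lt (PosNum e40).
  - by near: n.
  - by near: n.
have ig := C_Omega_section cg x01.
have ip := C_Omega_section (phiP n).1 x01.
have pe : (norm_Xinf (fun q => phi n q - f q)%R < (e / 4)%:E)%E.
  by apply: lt_trans (phiP n).2 _; rewrite lte_fin.
rewrite norm_XinfB in ge_.
have h1 := C_Omega_triangle mf (phiP n).1 cg pe ge_ x01.
have h2 : \int[mu]_(t in `[0, x]) cmod (phi n (x, t) - tr t) <= e / 4.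
  by apply: ltW; apply: (le_lt_trans _ nt); rewrite sub0r normrN; exact: ler_norm.
apply: (@le_trans _ _ (\int[mu]_(t in `[0, x]) (cmod (phi n (x, t) - tr t) +
    cmod (phi n (x, t) - g (x, t))))).
  apply: le_Rintegral => //.
  - by apply: cintegrable_cmod => //; exact: cintegrableB.
  - by apply: rintD => //; apply: cintegrable_cmod => //; exact: cintegrableB.
  - move=> t _; rewrite [leRHS]addrC.
    have -> : tr t - g (x, t) = (phi n (x, t) - g (x, t)) - (phi n (x, t) - tr t).
      by rewrite opprB [RHS]addrC [RHS]addrA subrK.
    exact: cmodB.
rewrite RintegralD//; try by apply: cintegrable_cmod => //; exact: cintegrableB.
by apply: le_trans (lerD h2 h1) _; lra.
Unshelve. all: by end_near. Qed.

Lemma trace_bounded f : Xinf_0 f -> exists2 M : R, 0 <= M &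
  forall x, 0 <= x <= 1 -> \int[mu]_(t in `[0, x]) cmod (trace f x t) <= M.
Proof.
move=> fX; have [g cg gP] := trace_approx fX ltr01.
have [M M0 gM] := C_Omega_bounded cg.
exists (1 + M) => [|x x01]; first by rewrite addr_ge0.
have /andP[x0 x1] := x01; case: (gP x x01) => [->|h].
  rewrite (@eq_Rintegral _ _ _ mu _ (fun=> 0)).
    by rewrite Rintegral_cst_cc// mul0r addr_ge0.
  by move=> t _; rewrite cmod0.
have itr := trace_integrable f x; have ig := C_Omega_section cg x01.
apply: (@le_trans _ _ (\int[mu]_(t in `[0, x])
    (cmod (trace f x t - g (x, t)) + M))).
  apply: le_Rintegral => //.
  - exact: cintegrable_cmod.
  - apply: rintD => //; last exact: rint_cst_cc.
    by apply: cintegrable_cmod => //; exact: cintegrableB.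
  - move=> t; rewrite /= in_itv/= => tx.
    rewrite -{1}(subrK (g (x, t)) (trace f x t)).
    by apply: le_trans (cmodD _ _) _; rewrite lerD2l; apply: gM; exact/OmegaP.
rewrite RintegralD//; last 2 first.
- by apply: cintegrable_cmod => //; exact: cintegrableB.
- exact: rint_cst_cc.
rewrite Rintegral_cst_cc// subr0; apply: lerD => //.
by rewrite ler_piMr.
Qed.

End Kernels.

(** * The complex exponential: derivative, primitive, behaviour at 0 *)

Section ComplexExponential.
Context {R : realType}.
Local Notation mu := (@lebesgue_measure R).
Implicit Types (z w c : R[i]) (t : R).

Lemma cexpD z w : cexp (z + w) = cexp z * cexp w.
Proof.
by apply: complex_ext; rewrite ?cReM ?cImM /= cReD cImD expRD ?cosD ?sinD; ring.
Qed.

Lemma cmod_cexp z : cmod (cexp z) = expR (complex.Re z).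
Proof.
rewrite cmodE /= !exprMn -mulrDr cos2Dsin2 mulr1 sqrtr_sqr.
by rewrite ger0_norm// expR_ge0.
Qed.

Lemma Re_scale c t : complex.Re (c * t%:C%C) = complex.Re c * t.
Proof. by rewrite cReM /= mulr0 subr0. Qed.

Lemma Im_scale c t : complex.Im (c * t%:C%C) = complex.Im c * t.
Proof. by rewrite cImM /= mulr0 add0r. Qed.

Lemma is_cderive_cexp c t :
  is_cderive (fun u => cexp (c * u%:C%C)) t (c * cexp (c * t%:C%C)).
Proof.
have he := is_derive_expR_scale (complex.Re c) t.
have hl (r : R) : is_derive t (1 : R) (fun u : R => r * u) r.
  apply: (is_derive_eq (is_deriveZ r (is_derive_id t 1))).
  by rewrite /GRing.scale /= mulr1.
have hc := is_derive1_comp (is_derive_cos (complex.Im c * t)) (hl (complex.Im c)).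
have hs := is_derive1_comp (is_derive_sin (complex.Im c * t)) (hl (complex.Im c)).
split.
- rewrite (_ : (fun u => _) = (fun u => expR (complex.Re c * u)) *
      (cos \o (fun u => complex.Im c * u))).
    2: by apply/funext => u; rewrite /cexp /= Re_scale Im_scale.
  apply: (is_derive_eq (is_deriveM he hc)).
  by rewrite cReM /cexp /= Re_scale Im_scale /GRing.scale /=; ring.
- rewrite (_ : (fun u => _) = (fun u => expR (complex.Re c * u)) *
      (sin \o (fun u => complex.Im c * u))).
    2: by apply/funext => u; rewrite /cexp /= Re_scale Im_scale.
  apply: (is_derive_eq (is_deriveM he hs)).
  by rewrite cImM /cexp /= Re_scale Im_scale /GRing.scale /=; ring.
Qed.

Lemma cexp_continuous c :
  continuous (fun t => complex.Re (cexp (c * t%:C%C))) /\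
  continuous (fun t => complex.Im (cexp (c * t%:C%C))).
Proof.
by split=> t; apply: differentiable_continuous; apply/derivable1_diffP;
  [exact: @ex_derive _ _ _ _ _ _ _ (is_cderive_cexp c t).1
  |exact: @ex_derive _ _ _ _ _ _ _ (is_cderive_cexp c t).2].
Qed.

Lemma cexp_measurable (D : set R) c :
  cmeasurable D (fun t => cexp (c * t%:C%C)).
Proof.
have [c1 c2] := cexp_continuous c.
by split; exact: measurable_fun_cts.
Qed.

Lemma FTC2_cc (f F : R -> R) (u v : R) : u <= v -> continuous f ->
  (forall t, is_derive t (1 : R) F (f t)) ->
  \int[mu]_(t in `[u, v]) f t = F v - F u.
Proof.
rewrite le_eqVlt => /predU1P[<- _ _|uv cf dF].
  by rewrite set_itv1 Rintegral_set1 subrr.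
have cF t : {for t, continuous F}.
  apply: differentiable_continuous; apply/derivable1_diffP.
  exact: ex_derive.
rewrite /Rintegral (continuous_FTC2 (F := F) uv)//.
- exact: continuous_subspaceT.
- split=> [t _||]; first exact: ex_derive.
    exact: cvg_at_right_filter (cF u).
  exact: cvg_at_left_filter (cF v).
- by move=> t _; rewrite derive1E; exact: derive_val.
Qed.

(** Kept in product form, which avoids dividing by [c] and covers c = 0. *)
Lemma cintegral_cexp c (u v : R) : u <= v ->
  c * cintegral `[u, v] (fun t => cexp (c * t%:C%C)) =
  cexp (c * v%:C%C) - cexp (c * u%:C%C).
Proof.
move=> uv; have [c1 c2] := cexp_continuous c.
have ic : cintegrable `[u, v] (fun t => cexp (c * t%:C%C)).
  by split; apply: (@continuous_compact_integrable _ (fun t => _));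
    [exact: segment_compact|exact: continuous_subspaceT
    |exact: segment_compact|exact: continuous_subspaceT].
have cM1 : continuous (fun t => complex.Re (c * cexp (c * t%:C%C))).
  under eq_fun do rewrite cReM.
  by move=> t; apply: cvgB; apply: cvgM;
    [exact: cvg_cst|exact: c1|exact: cvg_cst|exact: c2].
have cM2 : continuous (fun t => complex.Im (c * cexp (c * t%:C%C))).
  under eq_fun do rewrite cImM.
  by move=> t; apply: cvgD; apply: cvgM;
    [exact: cvg_cst|exact: c2|exact: cvg_cst|exact: c1].
rewrite -cintegralZ//; apply: complex_ext.
- rewrite cReD cReN [LHS]/=.
  exact: (FTC2_cc uv cM1 (fun t => (is_cderive_cexp c t).1)).
- rewrite cImD cImN [LHS]/=.
  exact: (FTC2_cc uv cM2 (fun t => (is_cderive_cexp c t).2)).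
Qed.

Lemma cexp_near0 (e : R) : 0 < e -> exists2 r : R, 0 < r &
  forall w, cmod w < r -> cmod (cexp w - 1) < e.
Proof.
(* Writing cexp w = E C + i E S with |E| < 2, the terms |E| |C - 1|, |E - 1| and |E| |S| add up to
   less than 5 eta. *)
move=> e0; pose eta := Num.min 1 (e / 5).
have eta0 : 0 < eta by rewrite lt_min ltr01 divr_gt0.
have [n1 n5] : eta <= 1 /\ eta <= e / 5.
  by split; rewrite ge_min lexx ?orbT.
have at0 (f : R -> R) (l : R) : {for 0, continuous f} -> f 0 = l ->
    exists2 r : R, 0 < r & forall u, `|u| < r -> `|f u - l| < eta.
  move=> /cvgrPdist_lt /(_ eta eta0) /nbhs_ballP[r /= r0 rP] fl.
  exists r => // u ur; rewrite -fl distrC; apply: rP.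
  by rewrite /ball /= sub0r normrN.
have [r1 r10 h1] := at0 _ _ (@continuous_expR R 0) (@expR0 R).
have [r2 r20 h2] := at0 _ _ (@continuous_cos R 0) (@cos0 R).
have [r3 r30 h3] := at0 _ _ (@continuous_sin R 0) (@sin0 R).
exists (Num.min r1 (Num.min r2 r3)); first by rewrite !lt_min r10 r20.
move=> w; rewrite !lt_min => /and3P[w1 w2 w3].
have {}h1 := h1 _ (le_lt_trans (Re_le_cmod w) w1).
have {}h2 := h2 _ (le_lt_trans (Im_le_cmod w) w2).
have {}h3 := h3 _ (le_lt_trans (Im_le_cmod w) w3).
apply: (le_lt_trans (cmod_le_ReIm _)).
rewrite cReD cImD cReN cImN /= oppr0 addr0.
set E := expR _ in h1 *; set C := cos _ in h2 *; set S := sin _ in h3 *.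
rewrite subr0 in h3.
have E2 : `|E| < 2.
  by have := ler_normD (E - 1) 1; rewrite subrK normr1; lra.
have hC : `|E * C - 1| <= `|E| * `|C - 1| + `|E - 1|.
  have -> : E * C - 1 = E * (C - 1) + (E - 1) by ring.
  by rewrite (le_trans (ler_normD _ _))// normrM.
rewrite normrM.
have := normr_ge0 E; have := normr_ge0 (C - 1); have := normr_ge0 S.
move: (`|E|) (`|C - 1|) (`|S|) (`|E - 1|) hC h1 h2 h3 E2.
move=> x1 x2 x3 x4 hC h1 h2 h3 E2 p3 p2 p1.
have m1 : x1 * x2 <= 2 * eta by apply: ler_pM => //; exact: ltW.
have m2 : x1 * x3 <= 2 * eta by apply: ler_pM => //; exact: ltW.
lra.
Qed.

End ComplexExponential.

(** * The functional F: boundedness, Lipschitz dependence, continuity in lambda *)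

Section SupFourier.
Context {R : realType}.
Local Notation mu := (@lebesgue_measure R).
Implicit Types (f : R * R -> R[i]) (lambda : R[i]) (b h x t : R).

(** A supremum is 1-Lipschitz for the uniform distance; the common bound [M] ensures that both
    suprema are genuine least upper bounds. *)
Lemma sup_dist (A B : R -> R) (d M : R) :
  (forall x, 0 <= x <= 1 -> A x <= M) -> (forall x, 0 <= x <= 1 -> B x <= M) ->
  (forall x, 0 <= x <= 1 -> `|A x - B x| <= d) ->
  `|sup [set A x | x in `[0, 1]] - sup [set B x | x in `[0, 1]]| <= d.
Proof.
have half (A' B' : R -> R) : (forall x, 0 <= x <= 1 -> B' x <= M) ->
    (forall x, 0 <= x <= 1 -> A' x <= B' x + d) ->
    sup [set A' x | x in `[0, 1]] <= sup [set B' x | x in `[0, 1]] + d.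
  move=> BM AB; apply: ge_sup.
    by exists (A' 0); exists 0 => //; rewrite /= in_itv/= lexx ler01.
  move=> _ [x + <-]; rewrite /= in_itv/= => x01.
  apply: (le_trans (AB x x01)); rewrite lerD2r; apply: ub_le_sup.
    by exists M => _ [y + <-]; rewrite /= in_itv/=; exact: BM.
  by exists x => //; rewrite /= in_itv.
move=> AM BM ABd; rewrite ler_norml; apply/andP; split.
- suff : sup [set B x | x in `[0, 1]] <= sup [set A x | x in `[0, 1]] + d by lra.
  apply: half => // x x01; have := ABd x x01.
  by rewrite ler_norml => /andP[]; lra.
- suff : sup [set A x | x in `[0, 1]] <= sup [set B x | x in `[0, 1]] + d by lra.
  apply: half => // x x01; have := ABd x x01.
  by rewrite ler_norml => /andP[]; lra.
Qed.

Definition fourier b (D : R -> R[i]) lambda x : R[i] :=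
  cintegral `[0, x] (fun t => D t * cexp ('i%C * b%:C%C * lambda * t%:C%C)).

Definition calFr b f lambda : R :=
  sup [set cmod (fourier b (trace f x) lambda x) | x in `[0, 1]].

Lemma calFE b f lambda : calF b f lambda = (calFr b f lambda)%:C%C.
Proof. by []. Qed.

(** The exponent has real part - b t Im lambda. This is the origin of the factor e^{|b| h}. *)
Lemma cexp_strip b lambda h t : `|complex.Im lambda| <= h -> 0 <= t <= 1 ->
  cmod (cexp ('i%C * b%:C%C * lambda * t%:C%C)) <= expR (`|b| * h).
Proof.
move=> lh /andP[t0 t1]; rewrite cmod_cexp ler_expR Re_scale.
have -> : complex.Re ('i%C * b%:C%C * lambda) = - (b * complex.Im lambda).
  by rewrite !cReM !cImM /=; ring.
apply: (le_trans (ler_norm _)); rewrite normrM normrN normrM (ger0_norm t0).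
rewrite -[leRHS]mulr1; apply: ler_pM => //; exact: ler_wpM2l.
Qed.

Lemma fourier_integrable b D lambda x : 0 <= x <= 1 -> cintegrable `[0, x] D ->
  cintegrable `[0, x] (fun t => D t * cexp ('i%C * b%:C%C * lambda * t%:C%C)).
Proof.
move=> /andP[x0 x1] iD.
apply: (eq_cintegrable
  (f := fun t => cexp ('i%C * b%:C%C * lambda * t%:C%C) * D t)) => //.
  by move=> t _; rewrite mulrC.
apply: (@cintegrableM_bounded _ _ D
  (fun t => cexp ('i%C * b%:C%C * lambda * t%:C%C))
  (expR (`|b| * `|complex.Im lambda|))) => //.
  exact: cexp_measurable.
move=> t; rewrite /= in_itv/= => /andP[t0 tx]; apply: cexp_strip => //.
by rewrite t0 (le_trans tx).
Qed.

Lemma fourier_bound b D lambda h x : `|complex.Im lambda| <= h -> 0 <= x <= 1 ->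
  cintegrable `[0, x] D ->
  cmod (fourier b D lambda x) <= expR (`|b| * h) * \int[mu]_(t in `[0, x]) cmod (D t).
Proof.
move=> lh x01 iD; have icD := cintegrable_cmod (measurable_itv _) iD.
have /andP[x0 x1] := x01.
rewrite -RintegralZl//; apply: le_cmod_cintegral_bound => //.
- exact: fourier_integrable.
- exact: rintZ.
- move=> t; rewrite /= in_itv/= => /andP[t0 tx]; rewrite cmodM mulrC.
  apply: ler_wpM2r; first exact: cmod_ge0.
  by apply: cexp_strip => //; rewrite t0 (le_trans tx).
Qed.

Lemma fourierB b D D' lambda x : 0 <= x <= 1 -> cintegrable `[0, x] D ->
  cintegrable `[0, x] D' ->
  fourier b D lambda x - fourier b D' lambda x =
  fourier b (fun t => D t - D' t) lambda x.
Proof.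
move=> x01 iD iD'; rewrite /fourier -cintegralB//;
  [|exact: fourier_integrable|exact: fourier_integrable].
by apply: eq_cintegral => t _; rewrite mulrBl.
Qed.

Lemma fourier_trace_bounded b f h : Xinf_0 f -> exists M : R,
  forall lambda x, `|complex.Im lambda| <= h -> 0 <= x <= 1 ->
    cmod (fourier b (trace f x) lambda x) <= M.
Proof.
move=> fX; have [M M0 MP] := trace_bounded fX.
exists (expR (`|b| * h) * M) => lambda x lh x01.
apply: le_trans (fourier_bound b lh x01 (trace_integrable f x)) _.
by apply: ler_wpM2l; [exact: expR_ge0|exact: MP].
Qed.

Lemma calFr_lipschitz b f f' lambda h L : Xinf_0 f -> Xinf_0 f' ->
  `|complex.Im lambda| <= h ->
  (forall x, 0 <= x <= 1 ->
     \int[mu]_(t in `[0, x]) cmod (trace f x t - trace f' x t) <= L) ->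
  `|calFr b f lambda - calFr b f' lambda| <= expR (`|b| * h) * L.
Proof.
move=> fX fX' lh hL.
have [M MP] := fourier_trace_bounded b h fX.
have [M' MP'] := fourier_trace_bounded b h fX'.
apply: (@sup_dist _ _ _ (Num.max M M')).
- by move=> x x01; rewrite le_max MP.
- by move=> x x01; rewrite le_max MP' ?orbT.
move=> x x01; apply: (le_trans (dist_cmod _ _)).
have i1 := trace_integrable f x; have i2 := trace_integrable f' x.
rewrite fourierB//.
apply: le_trans (fourier_bound b lh x01 (cintegrableB _ i1 i2)) _ => //.
by apply: ler_wpM2l; [exact: expR_ge0|exact: hL].
Qed.

(** The quotient of the exponentials at lambda' and lambda is e^{i b (lambda' - lambda) t}, close to
    1 uniformly in t in [0, 1], while the traces have uniformly bounded L^1 norms. *)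
Lemma calFr_continuous b f lambda e : Xinf_0 f -> 0 < e ->
  exists2 r : R, 0 < r & forall lambda', cmod (lambda - lambda') < r ->
    `|calFr b f lambda - calFr b f lambda'| < e.
Proof.
move=> fX e0; have [M M0 MP] := trace_bounded fX.
(* This strip contains every lambda' within distance 1 of lambda. *)
pose h := `|complex.Im lambda| + 1; pose E := expR (`|b| * h).
have E0 : 0 < E by exact: expR_gt0.
have EM0 : 0 < E * M + 1 by rewrite ltr_wpDl// mulr_ge0// ltW.
pose d := e / 2 / (E * M + 1).
have d0 : 0 < d by rewrite !divr_gt0.
have [r r0 rP] := cexp_near0 d0.
have b10 : 0 < `|b| + 1 by rewrite ltr_wpDl.
exists (Num.min 1 (r / (`|b| + 1))); first by rewrite lt_min ltr01 divr_gt0.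
move=> lambda'; rewrite lt_min => /andP[l1 lr].
have lh : `|complex.Im lambda| <= h by rewrite lerDl.
have lh' : `|complex.Im lambda'| <= h.
  rewrite /h -[complex.Im lambda'](subrK (complex.Im lambda)) addrC.
  apply: le_trans (ler_normD _ _) _; rewrite lerD2l distrC -cImN -cImD.
  by apply: le_trans (Im_le_cmod _) _; exact: ltW.
have [N NP] := fourier_trace_bounded b h fX.
apply: (@le_lt_trans _ _ (e / 2)); last by rewrite ltr_pdivrMr// ltr_pMr// ltr1n.
apply: (@sup_dist _ _ _ N).
- by move=> x; exact: NP.
- by move=> x; exact: NP.
move=> x x01; have /andP[x0 x1] := x01; apply: (le_trans (dist_cmod _ _)).
have itr := trace_integrable f x.
rewrite /fourier -cintegralB//; [|exact: fourier_integrable|exact: fourier_integrable].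
apply: (@le_trans _ _ (\int[mu]_(t in `[0, x]) (E * d * cmod (trace f x t)))).
  apply: le_cmod_cintegral_bound => //.
  - by apply: cintegrableB => //; exact: fourier_integrable.
  - by apply: rintZ => //; exact: cintegrable_cmod.
  move=> t; rewrite /= in_itv/= => /andP[t0 tx]; have t1 := le_trans tx x1.
  rewrite -mulrBr cmodM mulrC; apply: ler_wpM2r; first exact: cmod_ge0.
  have -> : 'i%C * b%:C%C * lambda' * t%:C%C = 'i%C * b%:C%C * lambda * t%:C%C +
      'i%C * b%:C%C * (lambda' - lambda) * t%:C%C.
    by rewrite -mulrDl -mulrDr addrC subrK.
  rewrite cexpD -[X in X - _]mulr1 -mulrBr cmodM; apply: ler_pM; rewrite ?cmod_ge0//.
    by apply: cexp_strip => //; rewrite t0.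
  rewrite -cmodN opprB; apply: ltW; apply: rP.
  rewrite !cmodM !cmodC (ger0_norm t0) cmod_i mul1r -cmodN opprB.
  apply: (@le_lt_trans _ _ (`|b| * cmod (lambda - lambda'))).
    by rewrite ler_piMr// mulr_ge0// cmod_ge0.
  apply: (@le_lt_trans _ _ ((`|b| + 1) * cmod (lambda - lambda'))).
    by apply: ler_wpM2r; [exact: cmod_ge0|rewrite lerDl].
  by rewrite mulrC -ltr_pdivlMr.
rewrite RintegralZl//; last exact: cintegrable_cmod.
have Ed0 : 0 <= E * d by rewrite mulr_ge0// ltW.
apply: (le_trans (ler_wpM2l Ed0 (MP x x01))).
have -> : E * d * M = (E * M) * d by ring.
have e20 : 0 <= e / 2 by rewrite divr_ge0// ltW.
by rewrite /d mulrA ler_pdivrMr// mulrC; apply: ler_wpM2l => //; rewrite lerDl.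
Qed.

End SupFourier.

(** * Decay of the transform in a strip, uniformly in x *)

Section RiemannLebesgue.
Context {R : realType}.
Local Notation mu := (@lebesgue_measure R).
Implicit Types (f g : R * R -> R[i]) (lambda : R[i]).

Lemma fourier_C_Omega_vanish b h e g : b != 0 -> 0 <= h -> 0 < e -> C_Omega g ->
  exists T : R, forall lambda x, T <= `|complex.Re lambda| ->
    `|complex.Im lambda| <= h -> 0 <= x <= 1 ->
    cmod (fourier b (fun t => g (x, t)) lambda x) <= e.
Proof.
move=> b0 h0 e0 cg; set E := expR (`|b| * h); have E0 : 0 < E by exact: expR_gt0.
have e10 : 0 < e / 2 / E by rewrite !divr_gt0.
have [d d0 dP] := C_Omega_unif cg e10.
have [M M0 gM] := C_Omega_bounded cg.
pose N := (Num.truncn d^-1).+1; have N0 : 0 < N%:R :> R by rewrite ltr0n.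
have Nd : N%:R^-1 < d by rewrite invf_plt ?posrE// truncnS_gt.
have nb0 : 0 < `|b| by rewrite normr_gt0.
(* Chosen so that N M kap <= e / 2 with kap = 2 E / (|b| T); the summand 1 keeps [T] positive when M
   = 0. *)
pose T := 4 * N%:R * M * E / (`|b| * e) + 1.
have T0 : 0 < T.
  rewrite ltr_wpDl// divr_ge0//; last by rewrite ltW// mulr_gt0.
  by rewrite mulr_ge0 ?(ltW E0)// mulr_ge0// mulr_ge0// ltW.
have bT : 0 < `|b| * T by rewrite mulr_gt0.
exists T => lambda x lT lh /[dup] x01 /andP[x0 x1].
set c := 'i%C * b%:C%C * lambda.
have cn : `|b| * T <= cmod c.
  rewrite /c !cmodM cmodC cmod_i mul1r; apply: ler_wpM2l => //.
  by apply: (le_trans lT); exact: Re_le_cmod.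
pose kap := 2 * E / (`|b| * T).
have kap0 : 0 <= kap by rewrite divr_ge0 ?mulr_ge0// ltW.
(* The primitive contributes two boundary terms, each at most [E], divided by |c| >= |b| T; the
   length of the interval does not matter. *)
have osc u v : 0 <= u -> u <= v -> v <= 1 ->
    cmod (cintegral `[u, v] (fun t => cexp (c * t%:C%C))) <= kap.
  move=> u0 uv v1; rewrite /kap ler_pdivlMr//.
  have u1 := le_trans uv v1; have v0 := le_trans u0 uv.
  apply: (@le_trans _ _ (cmod (c * cintegral `[u, v] (fun t => cexp (c * t%:C%C))))).
    by rewrite cmodM mulrC; apply: ler_wpM2r => //; exact: cmod_ge0.
  rewrite cintegral_cexp// (le_trans (cmodB _ _))// mulrDl mul1r.
  by apply: lerD; apply: cexp_strip => //; rewrite ?u0 ?v0.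
(* Whatever x is, [0, x] is cut into [N] pieces, so the number of oscillation errors is uniform in
   x. *)
pose s := x / N%:R; have s0 : 0 <= s by rewrite divr_ge0// ltW.
have sd : s < d.
  by apply: le_lt_trans Nd; rewrite /s ler_piMl// invr_ge0 ltW.
have is_x i : (i <= N)%N -> i%:R * s <= x.
  move=> iN; rewrite /s mulrA ler_pdivrMr// mulrC; apply: ler_wpM2l => //.
  by rewrite ler_nat.
pose G t := g (x, t) * cexp (c * t%:C%C).
have ig := C_Omega_section cg x01.
have iG : cintegrable `[0, x] G by exact: fourier_integrable.
have ic u v : 0 <= u -> v <= x -> cintegrable `[u, v] (fun t => cexp (c * t%:C%C)).
  move=> u0 vx; apply: (cint_cc (x' := 0) (y' := x)) => //.
  apply: (@cintegrable_dominated _ _ _ (fun=> E)) => //.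
  - exact: cexp_measurable.
  - exact: rint_cst_cc.
  - move=> t; rewrite /= in_itv/= => /andP[t0 tx]; apply: cexp_strip => //.
    by rewrite t0 (le_trans tx).
have piece u v : 0 <= u -> u <= v -> v <= x -> v - u <= s ->
    cmod (cintegral `[u, v] G) <= e / 2 * (v - u) + M * kap.
  move=> u0 uv vx vus; have v1 := le_trans vx x1.
  have igu : cintegrable `[u, v] (fun t => g (x, t)) by exact: cint_cc ig.
  have iGu : cintegrable `[u, v] G by exact: cint_cc iG.
  have icu := ic u v u0 vx.
  have icz := cintegrableZ (g (x, u)) (measurable_itv _) icu.
  have -> : cintegral `[u, v] G =
      cintegral `[u, v] (fun t => G t - g (x, u) * cexp (c * t%:C%C)) +
      g (x, u) * cintegral `[u, v] (fun t => cexp (c * t%:C%C)).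
    by rewrite cintegralB// cintegralZ// subrK.
  apply: le_trans (cmodD _ _) _; apply: lerD; last first.
    rewrite cmodM; apply: ler_pM; rewrite ?cmod_ge0//; last exact: osc.
    by apply: gM; apply/OmegaP; rewrite u0 (le_trans uv).
  rewrite -Rintegral_cst_cc//; apply: le_cmod_cintegral_bound => //.
  - exact: cintegrableB.
  - exact: rint_cst_cc.
  - move=> t; rewrite /= in_itv/= => /andP[ut tv].
    have t0 := le_trans u0 ut; have tx := le_trans tv vx.
    rewrite /G -mulrBl cmodM -[leRHS](divfK (lt0r_neq0 E0)); apply: ler_pM;
      rewrite ?cmod_ge0//; last by apply: cexp_strip => //; rewrite t0 (le_trans tx).
    apply: ltW; apply: dP.
    + by apply/OmegaP; rewrite t0.
    + by apply/OmegaP; rewrite u0 (le_trans uv).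
    + split; first exact: ballxx.
      rewrite /ball /= ger0_norm ?subr_ge0//; apply: le_lt_trans sd.
      by apply: le_trans vus; rewrite lerD2r.
have main i : (i <= N)%N ->
    cmod (cintegral `[0, i%:R * s] G) <= e / 2 * (i%:R * s) + i%:R * (M * kap).
  elim: i => [_|i ih iN].
    by rewrite !mul0r set_itv1 /cintegral !Rintegral_set1 cmod0 mulr0 addr0.
  have iss : i%:R * s <= i.+1%:R * s by apply: ler_wpM2r => //; rewrite ler_nat.
  have is0 : 0 <= i%:R * s by rewrite mulr_ge0.
  have diff : i.+1%:R * s - i%:R * s = s.
    by rewrite -mulrBl -natr1 addrAC subrr add0r mul1r.
  rewrite (cintegral_split is0 iss); last exact: cint_cc (is_x _ iN) iG.
  apply: le_trans (cmodD _ _) _.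
  apply: (le_trans (lerD (ih (ltnW iN)) (piece _ _ is0 iss (is_x _ iN) _))).
    by rewrite diff.
  rewrite diff -[i.+1%:R]natr1 le_eqVlt; apply/orP; left; apply/eqP.
  by move: (e / 2) (M * kap) (i%:R : R) => A B C; ring.
have := main N (leqnn N).
have -> : N%:R * s = x by rewrite /s mulrC divfK// gt_eqF.
move=> /le_trans; apply.
rewrite [leRHS](splitr e); apply: lerD.
  by rewrite ler_piMr// ltW// divr_gt0.
rewrite /kap mulrA mulrA ler_pdivrMr//.
have : `|b| * T = 4 * N%:R * M * E / e + `|b|.
  by rewrite /T; field; rewrite !gt_eqF.
move=> ->; rewrite mulrDr.
have -> : e / 2 * (4 * N%:R * M * E / e) = N%:R * M * (2 * E).
  by field; rewrite gt_eqF.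
by rewrite lerDl mulr_ge0// ltW// divr_gt0.
Qed.

(** The trace is replaced by a continuous kernel at distance e / (4 E), an error that the
    exponential enlarges to at most e / 4. If the trace takes its default value 0, the transform
    vanishes. *)
Lemma calFr_vanish b h e f : b != 0 -> 0 <= h -> 0 < e -> Xinf_0 f ->
  exists T : R, forall lambda, T <= `|complex.Re lambda| ->
    `|complex.Im lambda| <= h -> `|calFr b f lambda| < e.
Proof.
move=> b0 h0 e0 fX; set E := expR (`|b| * h); have E0 : 0 < E by exact: expR_gt0.
have e40 : 0 < e / 4 by rewrite divr_gt0.
have e4E : 0 < e / 4 / E by rewrite divr_gt0.
have [g cg gP] := trace_approx fX e4E.
have [T TP] := fourier_C_Omega_vanish b0 h0 e40 cg.
have [M MP] := fourier_trace_bounded b h fX.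
exists T => lambda lT lh.
have key x : 0 <= x <= 1 -> cmod (fourier b (trace f x) lambda x) <= e / 2.
  move=> x01; case: (gP x x01) => [->|hx].
    rewrite /fourier (eq_cintegral (g := fun=> 0)); last by move=> t _; rewrite mul0r.
    by rewrite cintegral0 cmod0 divr_ge0// ltW.
  have itr := trace_integrable f x; have ig := C_Omega_section cg x01.
  rewrite -[fourier _ _ _ _](subrK (fourier b (fun t => g (x, t)) lambda x)).
  apply: le_trans (cmodD _ _) _.
  have -> : e / 2 = E * (e / 4 / E) + e / 4 by field; rewrite gt_eqF.
  apply: lerD; last exact: TP.
  rewrite fourierB//.
  apply: le_trans (fourier_bound b lh x01 (cintegrableB _ itr ig)) _ => //.
  by apply: ler_wpM2l => //; exact: ltW.
have c0 : 0 <= calFr b f lambda.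
  apply: (@le_trans _ _ (cmod (fourier b (trace f 0) lambda 0))); first exact: cmod_ge0.
  apply: ub_le_sup.
    by exists M => _ [y + <-]; rewrite /= in_itv/=; exact: MP.
  by exists 0 => //; rewrite /= in_itv/= lexx ler01.
rewrite ger0_norm//; apply: (@le_lt_trans _ _ (e / 2)); last first.
  by rewrite ltr_pdivrMr// ltr_pMr// ltr1n.
apply: ge_sup.
  by exists (cmod (fourier b (trace f 0) lambda 0)); exists 0 => //;
    rewrite /= in_itv/= lexx ler01.
by move=> _ [y + <-]; rewrite /= in_itv/=; exact: key.
Qed.

Lemma calF_C0 b h f : b != 0 -> 0 <= h -> Xinf_0 f -> C0_strip h (calF b f).
Proof.
move=> b0 h0 fX; split.
  suff : continuous (calF b f : R[i]^o -> R[i]^o) by exact: continuous_subspaceT.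
  move=> z; apply/(cvgrPdist_lt (FF := nbhs_filter (z : R[i]^o))) => eps eps0.
  (* In the order of [R[i]] a positive number is real. *)
  have epsE : eps = (complex.Re eps)%:C%C.
    by move: eps0; rewrite ltcE /= => /andP[/eqP im0 _]; apply: complex_ext.
  have e0 : 0 < complex.Re eps by move: eps0; rewrite ltcE => /andP[].
  have [r r0 rP] := calFr_continuous b z fX e0.
  apply/nbhs_ballP; exists r%:C%C; first by rewrite /= ltcR.
  move=> z' /=; rewrite /ball /= normCE ltcR => /rP zz'.
  by rewrite !calFE -rmorphB normCE cmodC epsE ltcR.
move=> e e0; have [T TP] := calFr_vanish b0 h0 e0 fX.
by exists T => t y tT yh; rewrite calFE cmodC; exact: TP.
Qed.

End RiemannLebesgue.

(** * From the distance of potentials to the distance of kernels *)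

Section KernelDistance.
Context {R : realType}.
Local Notation mu := (@lebesgue_measure R).
Variables (b1 b2 : R).
Hypotheses (hb1 : b1 < 0) (hb2 : 0 < b2).
Implicit Types (Q : R -> 'M[R[i]]_2) (K : R * R -> 'M[R[i]]_2).

Let tr K (j l : 'I_2) x := trace (fun q => K q j l) x.

Let expsc (k : nat) (c t : R) : R[i] := (expR (k%:R * (c * t)))%:C%C.

Let expsc_integrable k c x (D : R -> R[i]) : 0 <= x <= 1 -> cintegrable `[0, x] D ->
  cintegrable `[0, x] (fun t => expsc k c t * D t).
Proof.
move=> /andP[x0 x1] iD.
apply: (@cintegrableM_bounded _ _ D (expsc k c) (expR (k%:R * `|c|))) => //.
  apply: cmeasurable_real; apply: measurable_funTS.
  by apply: measurableT_comp => //; exact: measurable_funM.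
move=> t tx; rewrite cmodC ger0_norm ?expR_ge0// ler_expR ler_wpM2l//.
move: tx; rewrite /= in_itv/= => /andP[t0 tx].
rewrite (le_trans (ler_norm _))// normrM (ger0_norm t0) ler_piMr//.
exact: le_trans tx x1.
Qed.

(** The kernel identity at lambda = - i k, read as an exponential moment of order k of row [j]; the
    sign is that of the second component of e^0. *)
Lemma kernel_moment s Q K k y x j : is_kernel b1 b2 s Q K ->
  e_solution b1 b2 s Q (lam k) (fun x => \col_j y j x) -> 0 <= x <= 1 ->
  y j x = init_coef s j * (expR (k%:R * (bcoef b1 b2 j * x)))%:C%C +
    cintegral `[0, x] (fun t => expsc k b1 t * tr K j ord0 x t +
      (-1) ^+ s * (expsc k b2 t * tr K j ord_max x t)).
Proof.
move=> [_ hK] sol x01; have x01' : x \in `[0, 1] by rewrite in_itv.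
have := congr1 (fun M : 'cV[R[i]]_2 => M j ord0) (hK _ _ sol _ x01').
rewrite mxE => ->; rewrite mxE e0_lam; congr (_ + _).
rewrite mxE; apply: eq_cintegral => t _.
rewrite mxE big_ord_recl big_ord1 !mxE !eqxx /=.
have expE (b : R) : cexp ('i%C * b%:C%C * lam k * t%:C%C) = expsc k b t.
  rewrite /expsc -cexpC; congr cexp; apply: complex_ext.
    by rewrite /lam !ReImE /=; ring.
  by rewrite /lam !ReImE /=; ring.
rewrite !expE (_ : lift ord0 ord0 = ord_max); last exact: val_inj.
rewrite /tr; move: (trace _ _ _) (trace _ _ _) (expsc _ _ _) (expsc _ _ _).
by move=> u v c d; rewrite (mulrC v) (mulrCA u) (mulrC u).
Qed.

Lemma kernel_dist s Q Q' K K' j l x : potential Q -> potential Q' ->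
  is_kernel b1 b2 s Q K -> is_kernel b1 b2 s Q' K' -> 0 <= x <= 1 ->
  \int[mu]_(t in `[0, x]) cmod (tr K j l x t - tr K' j l x t) <=
  2 * (2 * (pot1 b1 b2 (fun x => Q x - Q' x) * (2 * expR (4 * pot1 b1 b2 Q))) *
       expR (4 * pot1 b1 b2 Q')).
Proof.
move=> pQ pQ' kK kK' x01; set M := (X in _ <= 2 * X).
have b10 : b1 != 0 by rewrite lt_eqF.
have b20 : b2 != 0 by rewrite gt_eqF.
have /choice[y yP] := fun k => exp_solution_exists s k b10 b20 pQ.
have /choice[y' yP'] := fun k => exp_solution_exists s k b10 b20 pQ'.
have itr K0 i : cintegrable `[0, x] (tr K0 j i x) by exact: trace_integrable.
pose D i t := tr K j i x t - tr K' j i x t.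
have iD i : cintegrable `[0, x] (D i) by exact: cintegrableB.
pose sg : R[i] := (-1) ^+ s.
have sg1 : cmod sg = 1.
  by rewrite /sg -signr_odd; case: (odd _); rewrite ?expr1 ?expr0 ?cmodN cmod1.
have itest K0 k : cintegrable `[0, x] (fun t => expsc k b1 t * tr K0 j ord0 x t +
    sg * (expsc k b2 t * tr K0 j ord_max x t)).
  apply: cintegrableD => //; first exact: expsc_integrable.
  by apply: cintegrableZ => //; exact: expsc_integrable.
have moment k : y k j x - y' k j x = cintegral `[0, x] (fun t =>
    expsc k b1 t * D ord0 t + sg * (expsc k b2 t * D ord_max t)).
  rewrite (kernel_moment j kK (yP k).2 x01) (kernel_moment j kK' (yP' k).2 x01).
  have cancel (u v w : R[i]) : u + v - (u + w) = v - w.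
    by rewrite opprD addrACA subrr add0r.
  rewrite cancel -(cintegralB (measurable_itv _) (itest K k) (itest K' k)).
  apply: eq_cintegral => t _.
  rewrite /D !mulrBr opprD addrACA; congr (_ + _).
(* The shift 0 is admissible for every x in [0, 1]. There the combination of the moments with the
   coefficients of [p] is the pairing of the kernel differences with p (e^u). *)
have testM (p : {poly R}) : (forall u, b1 <= u <= b2 -> `|p.[expR u]| <= 1) ->
    cmod (cintegral `[0, x] (fun t => (p.[expR (b1 * t)])%:C%C * D ord0 t +
      sg * ((p.[expR (b2 * t)])%:C%C * D ord_max t))) <= M.
  move=> p1; have := expsum_dist hb1 hb2 pQ pQ' (fun k => (yP k).1)
    (fun k => (yP' k).1) p1 j (admissible0 hb1 hb2 x01).
  rewrite -/M; congr (cmod _ <= _).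
  rewrite /expsum -sumrB.
  transitivity (\sum_(k < size p) cintegral `[0, x] (fun t => (p`_k)%:C%C *
     (expsc k b1 t * D ord0 t + sg * (expsc k b2 t * D ord_max t)))).
    apply: eq_bigr => k _; rewrite mulr0 expR0 mulr1 -mulrBr moment cintegralZ//.
    apply: cintegrableD => //; first exact: expsc_integrable.
    by apply: cintegrableZ => //; exact: expsc_integrable.
  rewrite -cintegral_sum//; last first.
    move=> k; apply: cintegrableZ => //.
    apply: cintegrableD => //; first exact: expsc_integrable.
    by apply: cintegrableZ => //; exact: expsc_integrable.
  apply: eq_cintegral => t _.
  have hE (c : R) : (p.[expR (c * t)])%:C%C =
      \sum_(k < size p) (p`_k)%:C%C * expsc k c t.
    rewrite horner_coef rmorph_sum; apply: eq_bigr => k _.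
    by rewrite /expsc expRM_natl rmorphM.
  rewrite !hE !mulr_suml mulr_sumr -big_split; apply: eq_bigr => k _ /=.
  rewrite mulrDr; congr (_ + _); first by rewrite mulrA.
  by rewrite mulrCA; congr (_ * _); rewrite mulrA.
have [h1 h2] := kernel_dual hb1 hb2 x01 (iD ord0) (iD ord_max) sg1 testM.
have : l = ord0 \/ l = ord_max.
  by case: l => [[|[|//]] hl]; [left|right]; apply: val_inj.
by case=> ->; [exact: h1|exact: h2].
Qed.

Lemma mxmod_le (M : 'M[R[i]]_2) (c : R) : 0 <= c ->
  (forall j l, cmod (M j l) <= c) -> mxmod M <= c.
Proof. by move=> c0 Mc; apply: bigmax_le => // -[j l] _; exact: Mc. Qed.

Lemma cmod_le_mxmod (M : 'M[R[i]]_2) j l : cmod (M j l) <= mxmod M.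
Proof.
exact: (le_bigmax _ (fun jl : 'I_2 * 'I_2 => cmod (M jl.1 jl.2)) (j, l)).
Qed.

(** The constant 8 is the product of the three factors 2 in [kernel_dist]. *)
Lemma norm_strip_dist s b h Q Q' K K' : potential Q -> potential Q' ->
  is_kernel b1 b2 s Q K -> is_kernel b1 b2 s Q' K' ->
  (norm_strip h (fun z => mxcalF b K z - mxcalF b K' z)%R <=
   (expR (`|b| * h) *
    (8 * expR (4 * pot1 b1 b2 Q) * expR (4 * pot1 b1 b2 Q') *
     pot1 b1 b2 (fun x => Q x - Q' x)))%:E)%E.
Proof.
move=> pQ pQ' kK kK'; apply: ge_ereal_sup => _ [z zh <-]; rewrite lee_fin.
have P0 : 0 <= pot1 b1 b2 (fun x => Q x - Q' x).
  by apply: Rintegral_ge0 => t _; exact: qpot_ge0.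
apply: mxmod_le.
  by rewrite mulr_ge0 ?expR_ge0// mulr_ge0// mulr_ge0 ?expR_ge0// mulr_ge0 ?expR_ge0.
move=> j l; rewrite !mxE !calFE -rmorphB cmodC.
apply: calFr_lipschitz => //; [exact: (kK.1 j l).2|exact: (kK'.1 j l).2|].
move=> x x01; apply: (le_trans (kernel_dist j l pQ pQ' kK kK' x01)).
rewrite le_eqVlt; apply/orP; left; apply/eqP; ring.
Qed.

(** Continuity at [Q] prescribes no radius for [Q']; this bounds its norm in terms of [Q] and the
    distance. *)
Lemma pot1_triangle Q Q' : potential Q -> potential Q' ->
  pot1 b1 b2 Q' <= pot1 b1 b2 Q + pot1 b1 b2 (fun x => Q x - Q' x).
Proof.
move=> pQ pQ'; have pB := potentialB pQ pQ'.
rewrite /pot1 -RintegralD//; [|exact: qpot_integrable|exact: qpot_integrable].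
apply: le_Rintegral => //; first exact: qpot_integrable.
  by apply: rintD => //; exact: qpot_integrable.
move=> t _; rewrite /qpot -mulrDr; apply: ler_wpM2l; first exact: addr_ge0.
rewrite -big_split; apply: ler_sum => j _; rewrite -big_split; apply: ler_sum => l _ /=.
rewrite !mxE; apply: (@le_trans _ _ (cmod (Q t j l - (Q t j l - Q' t j l)))).
  by rewrite opprB addrC subrK.
exact: cmodB.
Qed.

(** The 4 counts the entries of the matrix, each at most the maximal modulus. *)
Definition potc : R := 4 * (`|b1| + `|b2|).

Lemma mxmod_measurable Q : potential Q ->
  measurable_fun (`[0, 1] : set R) (fun x => mxmod (Q x)).
Proof.
move=> [_ iQ]; rewrite /mxmod.
have h (r : seq ('I_2 * 'I_2)) : measurable_fun (`[0, 1] : set R)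
    (fun x => \big[Num.max/0]_(jk <- r) cmod (Q x jk.1 jk.2)).
  elim: r => [|jk r ih].
    rewrite (_ : (fun x => _) = fun=> 0); first exact: measurable_cst.
    by apply/funext => x; rewrite big_nil.
  rewrite (_ : (fun x => _) = (fun x => Num.max (cmod (Q x jk.1 jk.2))
      (\big[Num.max/0]_(jk <- r) cmod (Q x jk.1 jk.2)))).
    apply: measurable_maxr => //; apply: cmeasurable_cmod.
    exact: cintegrable_meas.
  by apply/funext => x; rewrite big_cons.
exact: h.
Qed.

Lemma qpot_le Q t : qpot b1 b2 Q t <= potc * mxmod (Q t).
Proof.
rewrite /qpot /potc [4 * _]mulrC -mulrA; apply: ler_wpM2l; first exact: addr_ge0.
apply: (@le_trans _ _ (\sum_(j < 2) \sum_(l < 2) mxmod (Q t))).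
  by apply: ler_sum => j _; apply: ler_sum => l _; exact: cmod_le_mxmod.
by rewrite !sumr_const !card_ord -mulrnA -[leLHS]mulr_natl.
Qed.

(* Hoelder's inequality against the indicator of the unit interval. *)
Lemma pot1_le_Lpnorm p Q : 1 <= p -> potential Q ->
  ((pot1 b1 b2 Q)%:E <= potc%:E * Lpnorm p Q)%E.
Proof.
move=> p1 pQ; pose F := (fun x : R => mxmod (Q x)) \_ (`[0, 1] : set R).
have FE : Lpnorm p Q = ('N[mu]_p%:E [EFin \o F])%E.
  rewrite /Lpnorm; congr Lnorm; apply/funext => x /=.
  by rewrite /F !patchE; case: ifP.
have mF : measurable_fun setT F.
  by apply/(measurable_restrictT _ _).1 => //; exact: mxmod_measurable.
have N1 : ((pot1 b1 b2 Q)%:E <= potc%:E * 'N[mu]_1 [EFin \o F])%E.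
  rewrite Lnorm1 -ge0_integralZl//; last 2 first.
  - by apply: measurableT_comp => //; exact/measurable_EFinP.
  - by rewrite lee_fin mulr_ge0// addr_ge0.
  rewrite /pot1 -integral_Rintegral//; last exact: qpot_integrable.
  rewrite [X in (X <= _)%E]integral_mkcond; apply: ge0_le_integral => //.
  - by move=> x _; rewrite patchE; case: ifP => // _; rewrite lee_fin qpot_ge0.
  - apply/(measurable_restrictT _ _).1 => //; apply/measurable_EFinP.
    by apply: rint_meas; exact: qpot_integrable.
  - apply: measurable_funeM; apply: measurableT_comp => //; exact/measurable_EFinP.
  - move=> x _; rewrite /F !patchE /=; case: ifP => xD; last first.
      by apply: mule_ge0 => //; rewrite lee_fin mulr_ge0// addr_ge0.
    rewrite -EFinM lee_fin; apply: le_trans (qpot_le _ _) _.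
    apply: ler_wpM2l; first by rewrite mulr_ge0// addr_ge0.
    by rewrite patchE xD ler_norm.
apply: (le_trans N1); apply: lee_wpmul2l; first by rewrite lee_fin mulr_ge0// addr_ge0.
(* For p = 1 the two norms coincide. Otherwise [q] is the conjugate exponent, and the indicator has
   L^q norm 1 because the interval has measure 1. *)
rewrite FE; move: p1; rewrite le_eqVlt => /predU1P[<-//|p1].
pose q := p / (p - 1).
have q0 : 0 < q by rewrite divr_gt0 ?subr_gt0// (lt_trans ltr01).
have p0 : 0 < p by rewrite (lt_trans ltr01).
have pq : p^-1 + q^-1 = 1.
  by rewrite /q invf_div mulrBl divff ?gt_eqF// mul1r addrC subrK.
have m1 : measurable_fun setT (\1_(`[0%R, 1%R] : set R) : R -> R).
  exact: measurable_indic.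
have := hoelder mu mF m1 p0 q0 pq.
have -> : (F \* \1_(`[0%R, 1%R] : set R))%R = F.
  apply/funext => x; rewrite /F /= patchE indicE; case: (x \in _) => /=.
    by rewrite mulr1.
  by rewrite mulr0.
move=> /le_trans; apply.
suff -> : ('N[mu]_q%:E [EFin \o (\1_(`[0%R, 1%R] : set R) : R -> R)] = 1)%E.
  by rewrite mule1.
rewrite unlock.
have -> : (\int[mu]_x `|(EFin \o (\1_(`[0%R, 1%R] : set R) : R -> R)) x| `^ q)%E =
   (\int[mu]_x (\1_(`[0%R, 1%R] : set R) x)%:E)%E.
  apply: eq_integral => x _ /=; rewrite indicE; case: (x \in _) => /=.
    by rewrite normr1 powR1.
  by rewrite normr0 powR0// gt_eqF.
have mu1 : mu (`[0%R, 1%R] : set R) = 1%E.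
  by apply: etrans (mu_cc ler01) _; rewrite subr0.
transitivity ((1 : \bar R) `^ q^-1)%E; last by rewrite poweR_EFin powR1.
by rewrite integral_indic// setIT; congr (_ `^ _)%E; exact: mu1.
Qed.

End KernelDistance.

(** * Continuity of the composition and its Lipschitz property on balls *)

Theorem corollary5p13 (R : realType) (b1 b2 : R) (hb1 : b1 < 0) (hb2 : 0 < b2)
    (p : R) (hp : 1 <= p) :
  (forall (s : bool) (b h : R), b != 0 -> 0 <= h ->
     (forall Q K, Lp_potential p Q -> is_kernel b1 b2 s Q K ->
        mxC0_strip h (mxcalF b K)) /\
     (forall Q K, Lp_potential p Q -> is_kernel b1 b2 s Q K ->
        forall eps : R, 0 < eps -> exists2 delta : R, 0 < delta &
          forall Q' K', Lp_potential p Q' -> is_kernel b1 b2 s Q' K' ->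
            (Lpnorm p (fun x => Q x - Q' x)%R < delta%:E)%E ->
            (norm_strip h (fun z => mxcalF b K z - mxcalF b K' z)%R
               < eps%:E)%E)) /\
  (forall r : R, 0 < r -> exists C : R,
     forall (s : bool) (b h : R), b != 0 -> 0 <= h ->
     forall Q Q' K K',
       Uball p r Q -> Uball p r Q' ->
       is_kernel b1 b2 s Q K -> is_kernel b1 b2 s Q' K' ->
       (norm_strip h (fun z => mxcalF b K z - mxcalF b K' z)%R
          <= (expR (`|b| * h) * C)%:E * Lpnorm p (fun x => Q x - Q' x)%R)%E).
Proof.
have c0 : 0 < potc b1 b2.
  by rewrite mulr_gt0// ltr_wpDl// normr_gt0 gt_eqF.
split.
- move=> s b h b0 h0; split=> [Q K _ [KX _] j l|].
    have := calF_C0 b0 h0 (KX j l).2.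
    by rewrite (_ : (fun z => mxcalF b K z j l) = calF b (fun q => K q j l))//;
      apply/funext => z; rewrite mxE.
  move=> Q K [pQ _] kK eps eps0.
  set E := expR (`|b| * h); have E0 : 0 < E by exact: expR_gt0.
  (* The minimum with 1 in the radius keeps the weighted norm of [Q'] below P + 1, so [kap] bounds
     the Lipschitz factor near [Q]. *)
  pose P := pot1 b1 b2 Q; pose kap := 8 * expR (4 * P) * expR (4 * (P + 1)).
  have kap0 : 0 < kap by rewrite !mulr_gt0 ?expR_gt0.
  have d0 : 0 < Num.min 1 (eps / 2 / (E * kap)).
    by rewrite lt_min ltr01 !divr_gt0// mulr_gt0.
  exists (Num.min 1 (eps / 2 / (E * kap)) / potc b1 b2); first exact: divr_gt0.
  move=> Q' K' [pQ' _] kK' small.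
  have B1 : pot1 b1 b2 (fun x => Q x - Q' x) <= Num.min 1 (eps / 2 / (E * kap)).
    rewrite -lee_fin; apply: le_trans (pot1_le_Lpnorm b1 b2 hp (potentialB pQ pQ')) _.
    apply: (@le_trans _ _ ((potc b1 b2)%:E *
       (Num.min 1 (eps / 2 / (E * kap)) / potc b1 b2)%:E)%E).
      by apply: lee_wpmul2l; [rewrite lee_fin ltW|exact: ltW].
    by rewrite -EFinM lee_fin mulrC divfK// gt_eqF.
  apply: (le_lt_trans (norm_strip_dist hb1 hb2 b h pQ pQ' kK kK')).
  rewrite lte_fin -/E; move: B1; rewrite le_min => /andP[B1 B2].
  have tri := pot1_triangle b1 b2 pQ pQ'.
  apply: (@le_lt_trans _ _ (E * (kap * (eps / 2 / (E * kap))))).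
    apply: ler_wpM2l; first exact: ltW.
    apply: ler_pM => //.
    + by apply: Rintegral_ge0 => t _; exact: qpot_ge0.
    + rewrite /kap; apply: ler_wpM2l; first by rewrite mulr_ge0 ?expR_ge0.
      by rewrite ler_expR ler_pM2l// (le_trans tri)// lerD2l.
  have Ek : 0 < E * kap by exact: mulr_gt0.
  rewrite mulrA mulrC divfK ?(gt_eqF Ek)//.
  by rewrite ltr_pdivrMr// ltr_pMr// ltr1n.
- move=> r r0; set c := potc b1 b2 in c0 *.
  (* On the ball both weighted L^1 norms are at most c r; the last factor [c] converts the L^1
     distance into the L^p distance. *)
  exists (8 * expR (4 * (c * r)) * expR (4 * (c * r)) * c).
  move=> s b h b0 h0 Q Q' K K' [pQ nQ] [pQ' nQ'] kK kK'.
  have bound P : potential P -> (Lpnorm p P <= r%:E)%E -> pot1 b1 b2 P <= c * r.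
    move=> pP nP; rewrite -lee_fin EFinM.
    apply: (le_trans (pot1_le_Lpnorm b1 b2 hp pP)).
    by apply: lee_wpmul2l => //; rewrite lee_fin ltW.
  apply: (le_trans (norm_strip_dist hb1 hb2 b h pQ pQ' kK kK')).
  set E := expR (`|b| * h).
  have H := pot1_le_Lpnorm b1 b2 hp (potentialB pQ pQ').
  set A := 8 * expR (4 * (c * r)) * expR (4 * (c * r)).
  have A0 : 0 <= A by rewrite mulr_ge0 ?expR_ge0// mulr_ge0 ?expR_ge0.
  apply: (@le_trans _ _ ((E * A)%:E * (pot1 b1 b2 (fun x => Q x - Q' x))%:E)%E).
    rewrite -EFinM lee_fin -[leRHS]mulrA; apply: ler_wpM2l; first exact: expR_ge0.
    apply: ler_wpM2r; first by apply: Rintegral_ge0 => t _; exact: qpot_ge0.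
    apply: ler_pM; [by rewrite mulr_ge0 ?expR_ge0|exact: expR_ge0| |].
      by apply: ler_wpM2l => //; rewrite ler_expR ler_pM2l// bound.
    by rewrite ler_expR ler_pM2l// bound.
  rewrite mulrA [in leRHS]EFinM -muleA; apply: lee_wpmul2l => //.
  by rewrite lee_fin mulr_ge0// expR_ge0.
Qed.
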